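(* For any $\beta>1$, $$\kappa(\beta)=\frac12\left(\frac{1}{\beta^2-1}+\frac{6}{\pi^2\beta^3(\beta+1)}\left(\frac{\Gamma''\left(\frac{\beta-1}{\beta}\right)}{\Gamma\left(\frac{\beta-1}{\beta}\right)}-\left(\frac{\Gamma'\left(\frac{\beta-1}{\beta}\right)}{\Gamma\left(\frac{\beta-1}{\beta}\right)}\right)^2\right)-\frac{\beta^2}{(\beta^2-1)^2}\right),$$ and $$\kappa(\beta)\underset{\beta\downarrow1}{\sim}\left(\frac{3}{2\pi^2}-\frac18\right)\frac{1}{(\beta-1)^2},\qquad \kappa(\beta)\underset{\beta\to+\infty}{\sim}\left(\frac{6}{\pi^2}\zeta(3)-\frac12\right)\frac{1}{\beta^5}.$$
   Context: Let $(\xi_i)_{i\ge1}$ be the atoms of a Poisson point process on $\mathbb{R}$ with intensity measure $e^{-x}\,dx$ (the limiting extremal process of the Random Energy Model). For $\beta>1$ let $Z(\beta)=\sum_{i\ge1}e^{\beta\xi_i}$, which is a.s. finite. For $\beta,\beta'>1$ let $$\mathbf{C}(\beta,\beta')=\frac{\mathrm{Cov}(\log Z(\beta),\log Z(\beta'))}{\sigma(\log Z(\beta))\,\sigma(\log Z(\beta'))},\qquad \sigma(X)=\sqrt{\mathrm{Var}(X)}.$$ The temperature susceptibility $\kappa(\beta)$ is the coefficient such that $\mathbf{C}(\beta,\beta+h)=1-\kappa(\beta)h^2+o(h^2)$ as $h\to0$ (this coefficient exists for every $\beta>1$). $\Gamma$ is the Euler Gamma function, $\zeta$ the Riemann zeta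 function, and $f\sim g$ means $f/g\to1$. *)

(* Defs.v *)
From HB Require Import structures.
From mathcomp Require Import all_boot all_order all_algebra.
From mathcomp Require Import all_classical all_reals all_analysis.
From mathcomp Require Import measurable_realfun.

Set Implicit Arguments.
Unset Strict Implicit.
Unset Printing Implicit Defensive.

Import Order.TTheory GRing.Theory Num.Theory.
Import numFieldNormedType.Exports.

Local Open Scope classical_set_scope.
Local Open Scope ring_scope.

Section special_functions.
Context {R : realType}.

(* Only meaningful for x > 0. *)
Definition Gamma (x : R) : R :=
  \int[lebesgue_measure]_(t in `]0, +oo[) (t `^ (x - 1) * expR (- t)).

(* Only meaningful for s > 1. *)
Definition zeta (s : R) : R := limn (series (riemannR s)).

End special_functions.

Section poisson_point_process.
Context {d : measure_display} {T : measurableType d} {R : realType}.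
Variable P : probability T R.

(* Taking B i = setT for i outside a subset of indices gives the product rule
   for every subfamily. *)
Definition mutually_independent (n : nat) (X : 'I_n -> T -> \bar R) : Prop :=
  forall B : 'I_n -> set (\bar R), (forall i, measurable (B i)) ->
  P (\bigcap_i (X i @^-1` B i)) = (\prod_(i < n) P (X i @^-1` B i))%E.

(* The number of atoms in A, counted with multiplicity, possibly +oo. *)
Definition atom_count (xi : nat -> T -> R) (A : set R) (w : T) : \bar R :=
  (\sum_(0 <= i <oo) \d_(xi i w) A)%E.

(* The Poisson probabilities are written out because the library's poisson_pmf
   is constantly 1 when the rate is 0, whereas a set of intensity 0 must almost
   surely contain no atom. *)
Definition is_poisson_point_process
    (mu : set R -> \bar R) (xi : nat -> {RV P >-> R}) : Prop :=
  [/\ forall (A : set R) (k : nat), measurable A -> (mu A < +oo)%E ->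
        P [set w | atom_count xi A w = k%:R%:E] =
        (fine (mu A) ^+ k / k`!%:R * expR (- fine (mu A)))%:E,
      forall A : set R, measurable A -> mu A = +oo%E ->
        P [set w | atom_count xi A w = +oo%E] = 1%E
    & forall (n : nat) (A : 'I_n -> set R), (forall i, measurable (A i)) ->
        trivIset setT A ->
        mutually_independent (fun i => atom_count xi (A i))].

End poisson_point_process.

Definition rem_intensity {R : realType} (A : set R) : \bar R :=
  (\int[lebesgue_measure]_(x in A) (expR (- x))%:E)%E.

Section random_energy_model.
Context {d : measure_display} {T : measurableType d} {R : realType}.
Variables (P : probability T R) (xi : nat -> {RV P >-> R}).

Definition Z (b : R) (w : T) : \bar R :=
  (\sum_(0 <= i <oo) (expR (b * xi i w))%:E)%E.

(* For b > 1, Z b is almost surely finite, so fine only affects a null event. *)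
Definition logZ (b : R) (w : T) : R := ln (fine (Z b w)).

Definition sigma (X : T -> R) : R := Num.sqrt (fine 'V_P[X]).

Definition C (b b' : R) : R :=
  fine (covariance P (logZ b) (logZ b')) / (sigma (logZ b) * sigma (logZ b')).

Definition is_susceptibility (b k : R) : Prop :=
  (fun h : R => C b (b + h) - (1 - k * h ^+ 2)) =o_ (0^') (fun h : R => h ^+ 2).

(* The coefficient k is unique when it exists; 0 is the value otherwise. *)
Definition kappa (b : R) : R := xget 0 [set k | is_susceptibility b k].

End random_energy_model.

(* Main.v *)
Require Import Defs.
From HB Require Import structures.
From mathcomp Require Import all_boot all_order all_algebra.
From mathcomp Require Import all_classical all_reals all_analysis.
From mathcomp Require Import measurable_realfun.
From mathcomp Require Import ring lra.

Set Implicit Arguments.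
Unset Strict Implicit.
Unset Printing Implicit Defensive.

Import Order.TTheory GRing.Theory Num.Theory.
Import numFieldNormedType.Exports.

Local Open Scope classical_set_scope.
Local Open Scope ring_scope.

(** Write [R_h = Z(b+h) / Z(b)] and let [s(b)] be the standard deviation of
[log Z(b)].  Polarisation of the covariance gives
[1 - C(b, b+h) = (Var (log R_h) - (s(b+h) - s(b))^2) / (2 s(b) s(b+h))],
so the susceptibility is determined by the function [s] and by the limit of
[Var (log R_h) / h^2].

Both come from one identity.  The Laplace functional of the Poisson process,
differentiated in a direction [g], is the Mecke formula [campbell_mecke]; it
computes [E (Z(b') exp (- e^s Z(b)))] ([mecke_Z]).  Multiply by [k(s) e^s] and
integrate over [s].  For a fixed outcome the substitution [y = s + log Z(b)]
turns the inner integral into [R_(b'-b)] times the integral of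
[k (y - log Z(b))] against the density [e^(y - e^y)]; on the other side of
Tonelli's theorem what is left is a Gamma integral ([tonelli_Z]).  With [k = 1]
and [b' = b] this identifies the constant in the Laplace transform of [Z(b)] as
[Gamma (1 - 1/b)]; with [k = 1] it gives [E R_h] as a product of values of
Gamma; with [k] a shifted square it gives the mean of [log Z(b)] and its
variance [(b^2 - 1) pi^2 / 6].

The variance of [log R_h] has no such formula, but
[e^u - 1 - u = u^2 / 2 + O(u^3)], so that
[E (log R_h)^2 = 2 (E R_h - 1 - E (log R_h)) + O(h^3)].  The error term is
controlled because [log Z] is convex in [b]: [log R_h] lies between multiples
of [log R_e] and [log R_(-e)] for a fixed [e], with factors of order [h]
([log_ratio_remainder], [var_diff_approx]).  A second-order Taylor expansion of
the closed forms ([variance_rate]) then yields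
[Var (log R_h) / h^2 --> pi^2 / 6 + (b - 1) / b^3 * psi'(1 - 1/b)], where
[psi' = trigamma] is the second derivative of [log Gamma].

For the asymptotics, [trigamma x] is the sum of the [1 / (x + n)^2]: this
follows from the functional equation and from the bound
[trigamma x <= 1 / (x - 1)], and its value at 1 is the Basel sum.  As [b]
decreases to 1 the term [n = 0] dominates; as [b] tends to infinity,
[trigamma (1 - a) = pi^2 / 6 + 2 a zeta(3) + O(a^2)] with [a = 1/b].  The two
limiting constants are nonzero because [pi^2 / 6 < 2] and [zeta(3) >= 1]. *)

(** * The exponential on extended nonnegative reals *)

Section expN.
Context {R : realType}.
Implicit Types x y : \bar R.

(** The map [x |-> exp (- x)], continued to [+oo] by its limit 0: the Laplace
transform of a possibly infinite sum is then the expectation of a bounded real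
variable. *)
Definition expN x : R := if x is r%:E then expR (- r) else 0.

Lemma expN_ge0 x : 0 <= expN x.
Proof. by case: x => //= r; exact: expR_ge0. Qed.

Lemma expN_le1 x : (0 <= x)%E -> expN x <= 1.
Proof. by case: x => //= r; rewrite lee_fin => r0; rewrite -expR0 ler_expR oppr_le0. Qed.

Lemma expND x y : (0 <= x)%E -> (0 <= y)%E -> expN (x + y) = expN x * expN y.
Proof.
move: x y => [x| |] [y| |]//= _ _; rewrite ?mul0r ?mulr0//.
by rewrite opprD expRD.
Qed.

Lemma expN_sum (I : Type) (s : seq I) (f : I -> \bar R) :
  (forall i, 0 <= f i)%E -> expN (\sum_(i <- s) f i) = \prod_(i <- s) expN (f i).
Proof.
move=> f0; elim: s => [|i s ih]; first by rewrite !big_nil/= oppr0 expR0.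
by rewrite !big_cons expND ?ih// sume_ge0.
Qed.

Lemma measurable_expN : measurable_fun setT expN.
Proof.
rewrite (_ : expN = (fun x => expR (- fine x) * \1_(EFin @` setT) x)).
  apply: measurable_funM.
    by apply: measurableT_comp => //; apply: measurableT_comp.
  apply: measurable_indic; rewrite [X in measurable X](_ : _ = ~` [set -oo%E; +oo%E]).
    by apply: measurableC; apply: measurableU; exact: emeasurable_set1.
  by apply/seteqP; split => [_ [r _ <-] []//|[r _|h|h]]; [by exists r|case: h; right|case: h; left].
apply/funext => -[r| |]; rewrite indicE/=.
- by rewrite mem_set ?mulr1//; exists r.
- by rewrite memNset ?mulr0//= => -[].
- by rewrite memNset ?mulr0//= => -[].
Qed.

Lemma cvg_expN (u : (\bar R)^nat) l : (forall n, 0 <= u n)%E ->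
  u n @[n --> \oo] --> l -> expN (u n) @[n --> \oo] --> expN l.
Proof.
move=> u0 ul.
have l0 : (0 <= l)%E.
  rewrite -(cvg_lim (@ereal_hausdorff _) ul).
  by apply: lime_ge; [apply/cvg_ex; exists l|exact: nearW].
case: l l0 ul => [r| |//]; rewrite ?lee_fin => r0 ul.
- have [/= fu ur] := (fine_cvgP _ _).1 ul.
  have h : (fun n => - fine (u n)) @ \oo --> - r by exact: cvgN.
  have /(cvg_trans _) := cvg_comp _ _ h (@continuous_expR R (- r)).
  apply; apply: near_eq_cvg; near=> n.
  have /fineK E : u n \is a fin_num by near: n.
  by rewrite /= -[in RHS]E.
- apply/cvgrPdist_lt => /= e e0.
  move/cvgey_ge : ul => /(_ (1 - ln e)) ul.
  near=> n; have : ((1 - ln e)%:E <= u n)%E by near: n; exact: ul.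
  case: (u n) (u0 n) => [s| |//] _; last by rewrite subrr normr0.
  rewrite lee_fin => h /=; rewrite sub0r normrN ger0_norm ?expR_ge0//.
  rewrite -[ltRHS](lnK e0) ltr_expR; lra.
Unshelve. all: by end_near. Qed.

End expN.

(** The factor may be infinite, which is why the case of a zero series is
separated. *)
Lemma nneseriesZl_ge0 {R : realType} (f : nat -> \bar R) (x : \bar R) :
  (forall i, 0 <= f i)%E -> (0 <= x)%E ->
  (\sum_(0 <= i <oo) (x * f i) = x * \sum_(0 <= i <oo) f i)%E.
Proof.
move=> f0; case: x => [x _|_|//]; first exact: nneseriesZl.
have [h|/existsNP[k /eqP fk]] := pselect (forall k, f k = 0%E).
  by rewrite !eseries0 ?mule0// => i _ _; rewrite ?h ?mule0.
have fk0 : (0 < f k)%E by rewrite lt_neqAle eq_sym fk f0.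
have -> : (\sum_(0 <= i <oo) (+oo * f i) = +oo)%E.
  apply: (@nneseries_pinfty _ _ xpredT k) => //; last by rewrite gt0_mulye.
  by move=> n _; rewrite mule_ge0.
rewrite gt0_mulye// (lt_le_trans fk0)//.
rewrite (@nneseriesD1 _ _ k xpredT)// leeDl// nneseries_ge0//.
Qed.

(** * Products of independent variables *)

Section independence.
Local Open Scope ereal_scope.
Context d (T : measurableType d) (R : realType) (P : probability T R).

Lemma emeasurable_prod (I : Type) (r : seq I) (f : I -> T -> \bar R) :
  (forall i, measurable_fun setT (f i)) ->
  measurable_fun setT (fun w => \prod_(i <- r) f i w).
Proof.
move=> mf; elim: r => [|i r ih].
  by under eq_fun do rewrite big_nil; exact: measurable_cst.
by under eq_fun do rewrite big_cons; exact: emeasurable_funM.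
Qed.

(** Independence is a product rule for events.  It extends to nonnegative series
of indicators by replacing the factors one at a time: the induction is on the
number [j] of factors already turned into series, the other ones being
indicators of arbitrary sets. *)
Lemma integral_prod_independent (n : nat) (X : 'I_n -> T -> \bar R)
    (a : 'I_n -> nat -> \bar R) (D : 'I_n -> nat -> set (\bar R)) :
  (forall i, measurable_fun setT (X i)) -> mutually_independent P X ->
  (forall i k, 0 <= a i k) -> (forall i k, measurable (D i k)) ->
  \int[P]_w \prod_(i < n) \sum_(0 <= k <oo) (a i k * (\1_(D i k) (X i w))%:E) =
  \prod_(i < n) \sum_(0 <= k <oo) (a i k * P (X i @^-1` D i k)).
Proof.
move=> mX iX a0 mD.
pose s i w := \sum_(0 <= k <oo) (a i k * (\1_(D i k) (X i w))%:E).
have s0 i w : 0 <= s i w.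
  by apply: nneseries_ge0 => k _ _; rewrite mule_ge0// lee_fin.
pose S i := \sum_(0 <= k <oo) (a i k * P (X i @^-1` D i k)).
(* The factors of index below j are series, the other ones are indicators. *)
pose F (j : nat) (B : 'I_n -> set (\bar R)) (i : 'I_n) w : \bar R :=
  if (i < j)%N then s i w else (\1_(B i) (X i w))%:E.
have F0 j B i w : 0 <= F j B i w by rewrite /F; case: ifP => // _; rewrite lee_fin.
have mind (B : set (\bar R)) i : measurable B ->
    measurable_fun setT (fun w => (\1_B (X i w))%:E : \bar R).
  move=> mB; apply/measurable_EFinP; apply: measurableT_comp => //.
have ms i : measurable_fun setT (s i).
  apply: ge0_emeasurable_sum => // [k x _ _|k _]; first by rewrite mule_ge0// lee_fin.
  by apply: emeasurable_funM => //; exact: mind.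
have mF j B i : (forall i, measurable (B i)) -> measurable_fun setT (F j B i).
  move=> mB; rewrite (_ : F j B i = if (i < j)%N then s i else
    fun w => (\1_(B i) (X i w))%:E); first by case: ifP => // _; exact: mind.
  by apply/funext => w; rewrite /F; case: ifP.
suff H j (jn : (j <= n)%N) B : (forall i, measurable (B i)) ->
    \int[P]_w \prod_(i < n) F j B i w =
    \prod_(i < n) (if (i < j)%N then S i else P (X i @^-1` B i)).
  have := H n (leqnn n) (fun=> setT) (fun=> measurableT).
  under eq_integral do under eq_bigr do rewrite /F ltn_ord.
  by under [in X in _ = X -> _]eq_bigr do rewrite ltn_ord.
elim: j jn B => [_ B mB|j ih jn B mB].
  rewrite -iX//.
  have mI : measurable (\bigcap_i X i @^-1` B i).
    apply: fin_bigcap_measurable => // i _.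
    by rewrite -[X in measurable X]setTI; exact: mX.
  rewrite -[X in P X]setIT -integral_indic//.
  apply: eq_integral => w _; rewrite /F/= indicE.
  have [h|/existsNP[i h]] := pselect (forall i, B i (X i w)).
    rewrite [RHS](_ : _ = 1) ?big1// => [i _|]; first by rewrite indicE mem_set.
    by rewrite mem_set// => i _; exact: h.
  rewrite [in RHS]memNset/=; last by move=> /(_ i I).
  by rewrite (bigD1 i)//= indicE memNset// mul0e.
pose io := Ordinal jn; pose Bk k i := if i == io then D io k else B i.
have mBk k i : measurable (Bk k i) by rewrite /Bk; case: ifP.
have step (u : 'I_n -> \bar R) v (h : forall i, 0 <= u i) (h' : forall k, 0 <= v k) :
    u io = \sum_(0 <= k <oo) (a io k * v k) ->
    \prod_i u i = \sum_(0 <= k <oo)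
      (a io k * \prod_i (if i == io then v k else u i)).
  move=> uE; rewrite (bigD1 io)//= muleC uE.
  rewrite -nneseriesZl_ge0 ?prode_ge0//; last by move=> i; exact: mule_ge0.
  apply: eq_eseriesr => k _; rewrite [in RHS](bigD1 io)//= eqxx muleCA; congr (_ * _).
  rewrite muleC; congr (_ * _).
  by apply: eq_bigr => i /negPf ->.
have lt_io (i : 'I_n) : i != io -> (i < j.+1)%N = (i < j)%N.
  by move=> iio; rewrite ltnS leq_eqVlt (_ : (i == j :> nat) = false)//; apply/negbTE.
transitivity (\int[P]_w \sum_(0 <= k <oo) (a io k * \prod_(i < n) F j (Bk k) i w)).
  apply: eq_integral => w _.
  rewrite (step _ (fun k => (\1_(D io k) (X io w))%:E))//; last by rewrite /F/= ltnSn.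
  apply: eq_eseriesr => k _; congr (_ * _); apply: eq_bigr => i _; rewrite /F /Bk.
  by have [->|/lt_io ->//] := eqVneq i io; rewrite /= ltnn.
rewrite integral_nneseries//; first last.
- by move=> k x _; rewrite mule_ge0// prode_ge0.
- by move=> k; apply: emeasurable_funM => //; apply: emeasurable_prod => i; exact: mF.
rewrite (step _ (fun k => P (X io @^-1` D io k)))//; last 2 first.
- move=> i; case: ifP => // _; apply: nneseries_ge0 => k _ _.
  by rewrite mule_ge0.
- by rewrite /= ltnSn.
apply: eq_eseriesr => k _; rewrite ge0_integralZl//; last 2 first.
- by apply: emeasurable_prod => i; exact: mF.
- by move=> w _; rewrite prode_ge0.
rewrite ih ?(ltnW jn)//; congr (_ * _); apply: eq_bigr => i _; rewrite /Bk.
by have [->|/lt_io ->//] := eqVneq i io; rewrite /= ltnn.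
Qed.

End independence.

Lemma expR_eseries {R : realType} (x : R) : 0 <= x ->
  (\sum_(0 <= k <oo) (x ^+ k / k`!%:R)%:E = (expR x)%:E)%E.
Proof.
move=> x0; rewrite [in RHS]/expR -EFin_lim; last exact: is_cvg_series_exp_coeff.
apply: congr_lim; apply/funext => n /=.
by rewrite sumEFin.
Qed.

(** Limits in [n] and sums over [i] are both suprema here, hence commute. *)
Lemma nneseries_monotone_cvg {R : realType} (u : nat -> nat -> \bar R) (v : nat -> \bar R) :
  (forall n i, 0 <= u n i)%E -> (forall i, {homo u ^~ i : n m / (n <= m)%N >-> (n <= m)%E}) ->
  (forall i, u n i @[n --> \oo] --> v i) ->
  (\sum_(0 <= i <oo) u n i)%E @[n --> \oo] --> (\sum_(0 <= i <oo) v i)%E.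
Proof.
move=> u0 ndu uv.
have uv_le n i : (u n i <= v i)%E.
  rewrite -(cvg_lim (@ereal_hausdorff _) (uv i)).
  apply: lime_ge; first by apply/cvg_ex; exists (v i).
  by exists n => // m /= nm; exact: ndu.
have v0 i : (0 <= v i)%E by exact: le_trans (uv_le 0%N i).
have ndS : {homo (fun n => \sum_(0 <= i <oo) u n i)%E : n m / (n <= m)%N >-> (n <= m)%E}.
  by move=> n m nm; apply: lee_nneseries => // i _; exact: ndu.
have cS := ereal_nondecreasing_is_cvgn ndS.
suff <- : limn (fun n => \sum_(0 <= i <oo) u n i)%E = (\sum_(0 <= i <oo) v i)%E by [].
apply/eqP; rewrite eq_le; apply/andP; split.
  by apply: lime_le => //; apply: nearW => n; exact: lee_nneseries.
apply: lime_le; first exact: is_cvg_nneseries.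
apply: nearW => m.
have h : (\sum_(0 <= i < m) u n i)%E @[n --> \oo] --> (\sum_(0 <= i < m) v i)%E.
  by apply: cvg_nnesum => // i _; exact: nearW.
rewrite -(cvg_lim (@ereal_hausdorff _) h); apply: lee_lim => //.
  by apply/cvg_ex; eexists; exact: h.
by apply: nearW => n; exact: nneseries_lim_ge.
Qed.

Import HBNNSimple.

(** * The Laplace functional of the Poisson process *)

Section poisson_laplace.
Local Open Scope ereal_scope.
Context d (T : measurableType d) (R : realType) (P : probability T R)
  (xi : nat -> {RV P >-> R}).
Hypothesis hxi : is_poisson_point_process rem_intensity xi.

Lemma measurable_atom_count (A : set R) : measurable A ->
  measurable_fun setT (atom_count xi A).
Proof.
move=> mA; apply: ge0_emeasurable_sum => // k _.
rewrite (_ : (fun x => _) = EFin \o (\1_A \o xi k)); last first.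
  by apply/funext => w; rewrite diracE/= indicE.
by apply/measurable_EFinP; apply: measurableT_comp.
Qed.

Lemma rem_intensity_ge0 (A : set R) : 0 <= rem_intensity A.
Proof. by apply: integral_ge0 => x _; rewrite lee_fin expR_ge0. Qed.

Let expk (c : R) (k : nat) : R := expR (- (c * k%:R)).

(** For a finite intensity this is the exponential series; for an infinite one both
sides vanish, the count being almost surely infinite. *)
Lemma poisson_laplace (c : R) (A : set R) : (0 < c)%R -> measurable A ->
  \sum_(0 <= k <oo) ((expk c k)%:E * P (atom_count xi A @^-1` [set k%:R%:E])) =
  (expN ((1 - expR (- c))%:E * rem_intensity A))%:E.
Proof.
move=> c0 mA; have [hfin hinf _] := hxi.
have mu0 := rem_intensity_ge0 A.
have c1 : (0 < 1 - expR (- c))%R by rewrite subr_gt0 -expR0 ltr_expR oppr_lt0.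
have [muA|] := ltP (rem_intensity A) +oo; last first.
  rewrite leye_eq => /eqP muA; rewrite muA gt0_muley ?lte_fin//=.
  apply: eseries0 => k _ _.
  suff -> : P (atom_count xi A @^-1` [set k%:R%:E]) = 0 by rewrite mule0.
  apply/eqP; rewrite -measure_le0.
  have mN : measurable [set w | atom_count xi A w = +oo].
    rewrite -[X in measurable X]setTI.
    exact: (measurable_atom_count mA measurableT (emeasurable_set1 _)).
  rewrite -[leRHS](_ : P (~` [set w | atom_count xi A w = +oo]) = 0).
    apply: le_measure; rewrite ?inE//.
    - rewrite -[X in measurable X]setTI.
      exact: (measurable_atom_count mA measurableT (emeasurable_set1 _)).
    - exact: measurableC.
    - by move=> w /= ->.
  by rewrite probability_setC// hinf// subee.
set l := fine (rem_intensity A).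
have lE : rem_intensity A = l%:E by rewrite fineK// ge0_fin_numE.
have l0 : (0 <= l)%R by rewrite -lee_fin -lE.
transitivity (\sum_(0 <= k <oo)
    ((expR (- l))%:E * ((l * expR (- c)) ^+ k / k`!%:R)%:E)).
  apply: eq_eseriesr => k _; rewrite hfin// -/l -!EFinM; congr EFin.
  rewrite /expk exprMn -mulrN -expRM_natr mulrN mulNr.
  ring.
rewrite nneseriesZl; last by move=> k _; rewrite lee_fin divr_ge0// exprn_ge0// mulr_ge0// expR_ge0.
rewrite expR_eseries; last by rewrite mulr_ge0// expR_ge0.
rewrite lE -EFinM/= -expRD; congr EFin; congr expR.
by rewrite mulrBl mul1r opprB addrC mulrC.
Qed.

(** Almost surely the count is a natural number when the intensity is finite, since
the Poisson probabilities then add up to 1, and [+oo] otherwise.  So exactly one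
term of the series is nonzero in the first case, and none in the second. *)
Lemma poisson_expN_ae (c : R) (A : set R) : (0 < c)%R -> measurable A ->
  {ae P, forall w, (expN (c%:E * atom_count xi A w))%:E =
   \sum_(0 <= k <oo) ((expk c k)%:E * (\1_[set k%:R%:E] (atom_count xi A w))%:E)}.
Proof.
move=> c0 mA; have [hfin hinf _] := hxi.
have mu0 := rem_intensity_ge0 A.
have mN : measurable [set w | atom_count xi A w = +oo].
  rewrite -[X in measurable X]setTI.
  exact: (measurable_atom_count mA measurableT (emeasurable_set1 _)).
have mNk (k : nat) : measurable (atom_count xi A @^-1` [set k%:R%:E]).
  rewrite -[X in measurable X]setTI.
  exact: (measurable_atom_count mA measurableT (emeasurable_set1 _)).
have [muA|] := ltP (rem_intensity A) +oo; last first.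
  rewrite leye_eq => /eqP muA.
  exists (~` [set w | atom_count xi A w = +oo]); split.
  - exact: measurableC.
  - by rewrite probability_setC// hinf// subee.
  - move=> w /=; apply: contra_not => ->.
    rewrite gt0_muley//= eseries0// => k _ _.
    by rewrite indicE memNset// mule0.
pose B := \bigcup_k (atom_count xi A @^-1` [set k%:R%:E]).
have mB : measurable B by exact: bigcup_measurable.
exists (~` B); split.
- exact: measurableC.
- rewrite probability_setC// measure_bigcup//; last first.
    apply/trivIsetP => i j _ _ ij; rewrite -preimage_setI.
    rewrite (_ : _ `&` _ = set0) ?preimage_set0// -subset0 => x [/= -> []] /eqP.
    by rewrite eqr_nat (negPf ij).
  set l := fine (rem_intensity A).
  have lE : rem_intensity A = l%:E by rewrite fineK// ge0_fin_numE.
  have l0 : (0 <= l)%R by rewrite -lee_fin -lE.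
  rewrite (eq_eseriesl (Q := xpredT)); last by move=> k; rewrite in_setT.
  rewrite (eq_eseriesr (g := fun k => (expR (- l))%:E * (l ^+ k / k`!%:R)%:E)); last first.
    move=> k _; apply: (eq_trans (hfin A k mA muA)).
    by rewrite -/l mulrC EFinM.
  rewrite nneseriesZl; last by move=> k _; rewrite lee_fin divr_ge0// exprn_ge0.
  by rewrite expR_eseries// -EFinM -expRD addNr expR0 subee.
- move=> w /=; apply: contra_not => -[k _ /= ->].
  rewrite (@nneseriesD1 _ _ k xpredT)//; last by move=> i _; rewrite mule_ge0// lee_fin ?expR_ge0.
  rewrite indicE mem_set// mule1 eseries0 ?adde0//= => i _ ik.
  by rewrite indicE memNset ?mule0// => -[] /eqP; rewrite eqr_nat eq_sym (negPf ik).
Qed.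

(** The sum over the atoms of a simple function is a combination of the counts of
its level sets, which are disjoint, so that the counts are independent. *)
Lemma laplace_simple (f : R -> R) : measurable_fun setT f ->
  finite_set (range f) -> (forall x, 0 <= f x)%R ->
  \int[P]_w (expN (\sum_(0 <= i <oo) (f (xi i w))%:E))%:E =
  (expN (\int[lebesgue_measure]_x ((1 - expR (- f x)) * expR (- x))%:E))%:E.
Proof.
move=> mf finf f0; have [_ _ hind] := hxi.
(* The nonzero values of f: atoms where f vanishes do not contribute. *)
pose ys : seq R := [seq y <- finmap.enum_fset (fset_set (range f)) | y != 0%R].
have uys : uniq ys by rewrite filter_uniq// finmap.fset_uniq.
have ys_mem x : (f x \in ys) = (f x != 0%R).
  rewrite mem_filter andb_idr// => _.
  by rewrite in_fset_set ?mem_set.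
pose n := size ys; pose c (i : 'I_n) := tnth (in_tuple ys) i.
have c0 i : (0 < c i)%R.
  have : c i \in ys by exact: mem_tnth.
  rewrite mem_filter => /andP[y0]; rewrite in_fset_set// inE.
  by move=> [x _ yE]; rewrite lt_neqAle eq_sym y0 -yE f0.
have c_inj : injective c by apply/tuple_uniqP.
pose A i := f @^-1` [set c i].
have level (phi : R -> R) x : phi 0%R = 0%R ->
    phi (f x) = (\sum_i phi (c i) * \1_(A i) x)%R.
  move=> phi0; have [fx0|fx0] := eqVneq (f x) 0%R.
    rewrite fx0 phi0 big1// => i _.
    rewrite indicE memNset ?mulr0//= => fxy.
    by have := c0 i; rewrite -fxy fx0 ltxx.
  have /tnthP[i0 fxi] : f x \in in_tuple ys by rewrite ys_mem.
  rewrite (bigD1 i0)//= big1 ?addr0.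
    by rewrite indicE mem_set ?mulr1 ?fxi.
  move=> i ii0; rewrite indicE memNset ?mulr0//= => fxy.
  by move: ii0; rewrite -(inj_eq c_inj) -fxy fxi eqxx.
have mA i : measurable (A i) by rewrite -[X in measurable X]setTI; exact: mf.
have tA : trivIset setT A.
  by apply/trivIsetP => i j _ _ ij; rewrite -subset0 => x [fi fj]; have /c_inj/eqP : c i = c j by [rewrite -fi -fj]; rewrite (negPf ij).
pose X i := atom_count xi (A i).
have mX i : measurable_fun setT (X i) by exact: measurable_atom_count.
have X0 i w : 0 <= X i w by apply: nneseries_ge0 => k _ _; rewrite diracE lee_fin.
transitivity (\int[P]_w \prod_i (expN ((c i)%:E * X i w))%:E).
  apply: eq_integral => w _.
  transitivity (expN (\sum_i (c i)%:E * X i w))%:E.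
    congr (expN _)%:E.
    under [RHS]eq_bigr => i _ do rewrite /X /atom_count -nneseriesZl//.
    rewrite -nneseries_sum//; last first.
      by move=> i k _; rewrite mule_ge0// lee_fin ltW.
    apply: eq_eseriesr => k _; rewrite (level id)// -sumEFin.
    by apply: eq_bigr => i _; rewrite EFinM diracE indicE.
  rewrite expN_sum; last by move=> i; rewrite mule_ge0// lee_fin ltW.
  by elim/big_rec2: _ => // i y1 y2 _ <-; rewrite EFinM.
pose a i k := (expk (c i) k)%:E.
pose D (i : 'I_n) (k : nat) : set (\bar R) := [set k%:R%:E].
transitivity (\int[P]_w \prod_i \sum_(0 <= k <oo) (a i k * (\1_(D i k) (X i w))%:E)).
  apply: ge0_ae_eq_integral => //.
  - apply: emeasurable_prod => i; apply/measurable_EFinP.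
    apply: measurableT_comp; first exact: measurable_expN.
    exact: emeasurable_funM.
  - apply: emeasurable_prod => i; apply: ge0_emeasurable_sum => // [k w _ _|k _].
      by rewrite mule_ge0// lee_fin expR_ge0.
    apply: emeasurable_funM => //; apply/measurable_EFinP.
    by apply: measurableT_comp => //; apply: measurable_indic; exact: emeasurable_set1.
  - by move=> w _; rewrite prode_ge0// => i _; rewrite lee_fin expN_ge0.
  - move=> w _; rewrite prode_ge0// => i _; apply: nneseries_ge0 => k _ _.
    by rewrite mule_ge0// lee_fin expR_ge0.
  - have : {ae P, forall w, forall i, (expN ((c i)%:E * X i w))%:E =
        \sum_(0 <= k <oo) (a i k * (\1_(D i k) (X i w))%:E)}.
      by apply: filter_forall => i; exact: poisson_expN_ae.
    by apply: filterS => w h _; apply: eq_bigr => i _; rewrite h.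
rewrite (integral_prod_independent mX (hind _ _ mA tA))//; last 2 first.
- by move=> i k; rewrite lee_fin expR_ge0.
- by move=> i k; exact: emeasurable_set1.
transitivity (\prod_i (expN ((1 - expR (- c i))%:E * rem_intensity (A i)))%:E).
  by apply: eq_bigr => i _; rewrite poisson_laplace.
have c1 i : (0 <= 1 - expR (- c i))%R by rewrite subr_ge0 -expR0 ler_expR oppr_le0 ltW.
transitivity (expN (\sum_i (1 - expR (- c i))%:E * rem_intensity (A i)))%:E.
  rewrite expN_sum; last by move=> i; apply: mule_ge0; [rewrite lee_fin|exact: rem_intensity_ge0].
  by elim/big_rec2: _ => // i y1 y2 _ ->; rewrite EFinM.
have mexp : measurable_fun setT (fun x : R => expR (- x)).
  by apply: measurableT_comp => //; exact: measurable_funN.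
congr (expN _)%:E.
transitivity (\int[lebesgue_measure]_x
    \sum_i ((1 - expR (- c i))%:E * ((\1_(A i) x)%:E * (expR (- x))%:E))); last first.
  apply: eq_integral => x _.
  rewrite (level (fun y => 1 - expR (- y))%R) ?oppr0 ?expR0 ?subrr//.
  rewrite mulr_suml -sumEFin; apply: eq_bigr => i _.
  by rewrite !EFinM muleA.
rewrite ge0_integral_sum//; last 2 first.
- move=> i; apply: emeasurable_funM => //; apply: emeasurable_funM; apply/measurable_EFinP.
    by apply: measurable_indic; exact: mA.
  exact: mexp.
- by move=> i x _; rewrite mule_ge0 ?lee_fin// mulr_ge0// expR_ge0.
apply: eq_bigr => i _; rewrite ge0_integralZl//; last 2 first.
- by apply: emeasurable_funM; apply/measurable_EFinP => //; apply: measurable_indic; exact: mA.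
- by rewrite lee_fin.
congr (_ * _); rewrite /rem_intensity [LHS]integral_mkcond.
apply: eq_integral => x _; rewrite patchE indicE.
by case: ifP => _; rewrite ?mul1e ?mul0e.
Qed.

(** Approximation of [f] from below by simple functions.  The left-hand sides
converge because their integrands are bounded by 1, the exponents on the right
by monotone convergence. *)
Lemma laplace_functional (f : R -> R) : measurable_fun setT f -> (forall x, 0 <= f x)%R ->
  \int[P]_w (expN (\sum_(0 <= i <oo) (f (xi i w))%:E))%:E =
  (expN (\int[lebesgue_measure]_x ((1 - expR (- f x)) * expR (- x))%:E))%:E.
Proof.
move=> mf f0.
have mef : measurable_fun (setT : set (measurableTypeR R)) (EFin \o f) by exact/measurable_EFinP.
pose F n : R -> R := nnsfun_approx measurableT mef n.
have F0 n x : (0 <= F n x)%R by [].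
have mF n : measurable_fun (setT : set (measurableTypeR R)) (F n) by [].
have FF n m x : (n <= m)%N -> (F n x <= F m x)%R.
  by move=> nm; have /lefP := nd_nnsfun_approx measurableT mef nm; exact.
have Ff x : (F n x)%:E @[n --> \oo] --> (f x)%:E.
  apply: (cvg_nnsfun_approx measurableT mef) => // y _.
  by rewrite /= lee_fin.
have Ffr x : F n x @[n --> \oo] --> f x by exact: (fine_cvg (Ff x)).
pose S (g : R -> R) w := \sum_(0 <= i <oo) (g (xi i w))%:E.
have S0 (g : R -> R) w : (forall x, 0 <= g x)%R -> 0 <= S g w.
  by move=> g0; apply: nneseries_ge0 => i _ _; rewrite lee_fin.
have mS (g : R -> R) : measurable_fun (setT : set (measurableTypeR R)) g ->
    (forall x, 0 <= g x)%R -> measurable_fun setT (S g).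
  move=> mg g0; apply: ge0_emeasurable_sum => // [i w _ _|i _].
    by rewrite lee_fin.
  by apply/measurable_EFinP; apply: measurableT_comp.
pose J (g : R -> R) x : \bar R := ((1 - expR (- g x)) * expR (- x))%:E.
have J0 (g : R -> R) x : (forall x, 0 <= g x)%R -> 0 <= J g x.
  move=> g0; rewrite lee_fin mulr_ge0 ?expR_ge0// subr_ge0 -expR0.
  by rewrite ler_expR oppr_le0.
have lhs : \int[P]_w (expN (S (F n) w))%:E @[n --> \oo] --> \int[P]_w (expN (S f w))%:E.
  apply: (@dominated_cvg _ _ _ P setT _ _ _ (cst 1)) => //.
  - move=> n; apply/measurable_EFinP; apply: measurableT_comp; first exact: measurable_expN.
    exact: mS.
  - move=> w _; apply: cvg_EFin; first exact: nearW.
    apply: cvg_expN; first by move=> n; exact: S0.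
    apply: nneseries_monotone_cvg => //.
    + by move=> n i; rewrite lee_fin.
    + by move=> i n m nm; rewrite lee_fin FF.
  - by apply: finite_measure_integrable_cst.
  - move=> n w _; rewrite gee0_abs ?lee_fin ?expN_ge0//.
    by apply: expN_le1; exact: S0.
have rhs : \int[lebesgue_measure]_x J (F n) x @[n --> \oo] --> \int[lebesgue_measure]_x J f x.
  have -> : \int[lebesgue_measure]_x J f x =
      \int[lebesgue_measure]_x limn (fun n => J (F n) x).
    apply: eq_integral => x _; apply/esym/cvg_lim => //.
    apply: cvg_EFin; first exact: nearW.
    have h : (fun n => - F n x)%R @ \oo --> (- f x)%R by exact: cvgN.
    have h1 := cvg_comp _ _ h (@continuous_expR R (- f x)%R).
    have h2 : (fun n => 1 - expR (- F n x))%R @ \oo --> (1 - expR (- f x))%R.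
      by apply: cvgB => //; exact: cvg_cst.
    by apply: (cvgM h2); exact: cvg_cst.
  apply: cvg_monotone_convergence => //.
  - move=> n; apply/measurable_EFinP; apply: measurable_funM.
      apply: measurable_funB => //; apply: measurableT_comp => //.
      exact: measurable_funN.
    by apply: measurableT_comp => //; exact: measurable_funN.
  - by move=> n x _; exact: J0.
  - move=> x _ n m nm; rewrite lee_fin ler_wpM2r ?expR_ge0//.
    by rewrite lerD2l lerN2 ler_expR lerN2 FF.
apply: (cvg_unique (@ereal_hausdorff R) lhs).
have -> : (fun n => \int[P]_w (expN (S (F n) w))%:E) =
    (fun n => (expN (\int[lebesgue_measure]_x J (F n) x))%:E).
  apply/funext => n; apply: laplace_simple; [exact: mF| |exact: F0].
  exact: (@fimfunP _ _ (nnsfun_approx measurableT mef n)).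
apply: cvg_EFin; first exact: nearW.
by apply: cvg_expN => // n; apply: integral_ge0 => x _; exact: J0.
Qed.

End poisson_laplace.

(** * The Mecke formula *)

Section dyadic_quotient.
Context {R : realType}.
Implicit Types x y : \bar R.

(** Minus the difference quotient of [t |-> exp (- t x)] between 0 and [2^-n].
Along these dyadic steps it increases to [x], also when [x = +oo], so that
derivatives can be exchanged with integrals by monotone convergence. *)
Definition dyq (n : nat) (x : \bar R) : R := 2 ^+ n * (1 - expN ((2 ^- n)%:E * x)%E).

Lemma dyq_ge0 n x : (0 <= x)%E -> 0 <= dyq n x.
Proof.
move=> x0; rewrite mulr_ge0// ?exprn_ge0// subr_ge0 expN_le1// mule_ge0// lee_fin.
Qed.

(** With [a = exp (- 2^-(n+1) x)], the quotients compare as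
[1 - a^2 = (1 + a) (1 - a) <= 2 (1 - a)]. *)
Lemma dyq_ndecr x : (0 <= x)%E -> {homo dyq ^~ x : n m / (n <= m)%N >-> n <= m}.
Proof.
move=> x0; apply/nondecreasing_seqP => n.
have t0 : (0 <= (2 ^- n.+1)%:E * x)%E by rewrite mule_ge0// lee_fin invr_ge0 exprn_ge0.
rewrite /dyq; set a := expN ((2 ^- n.+1)%:E * x)%E.
have -> : expN ((2 ^- n)%:E * x)%E = a * a.
  rewrite -expND// -ge0_muleDl ?lee_fin ?invr_ge0 ?exprn_ge0//; congr (expN (_ * _)%E).
  rewrite -EFinD; congr EFin; rewrite exprS invfM -mulrDl.
  (* The step 2^-n is twice the step 2^-(n+1). *)
  have -> : 2^-1 + 2^-1 = 1 :> R by lra.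
  by rewrite mul1r.
have a1 : a <= 1 by exact: expN_le1.
have a0 : 0 <= a by exact: expN_ge0.
rewrite exprSr -mulrA ler_pM2l ?exprn_gt0//; nra.
Qed.

Lemma dyq_bounds n r : 0 <= r ->
  r - 2 ^- n * r ^+ 2 <= dyq n r%:E <= r.
Proof.
move=> r0; rewrite /dyq/=; set t := 2 ^- n.
have t0 : 0 < t by rewrite invr_gt0 exprn_gt0.
have -> : 2 ^+ n = t^-1 by rewrite invrK.
(* The lower bound is 1 - e^-u >= u / (1 + u) >= u - u^2 with u = t r. *)
have h1 := expR_ge1Dx (- (t * r)).
have h2 := expR_ge1Dx (t * r).
have e0 := expR_gt0 (- (t * r)).
have h3 : expR (- (t * r)) * expR (t * r) = 1 by rewrite -expRD addNr expR0.
set e := expR (- (t * r)) in h1 h3 e0 *.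
have tr0 : 0 <= t * r by rewrite mulr_ge0// ltW.
have e1 : e * (1 + t * r) <= 1 by rewrite -[leRHS]h3 ler_pM2l.
apply/andP; split.
- rewrite [leRHS]mulrC ler_pdivlMr//; nra.
- rewrite [leLHS]mulrC ler_pdivrMr//; lra.
Qed.

Lemma cvg_halfpow : (2 ^- n : R) @[n --> \oo] --> (0 : R).
Proof.
have := @cvg_geometric R 1 2^-1; rewrite ger0_norm//.
have h : (2^-1 : R) < 1 by rewrite invf_lt1// ltr1n.
move=> /(_ h); apply: cvg_trans; apply: near_eq_cvg; near=> n.
by rewrite /geometric/= mul1r exprVn.
Unshelve. all: by end_near. Qed.

Lemma cvg_dyq x : (0 <= x)%E -> (dyq n x)%:E @[n --> \oo] --> x.
Proof.
case: x => [r|_|//]; rewrite ?lee_fin.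
- move=> r0; apply: cvg_EFin; first exact: nearW.
  apply: (@squeeze_cvgr _ _ _ _ (fun n => r - 2 ^- n * r ^+ 2) (cst r)).
  + by apply: nearW => n; exact: dyq_bounds.
  + rewrite -[X in _ --> X]subr0 -(mul0r (r ^+ 2)); apply: cvgB; first exact: cvg_cst.
    apply: cvgM; [exact: cvg_halfpow|exact: cvg_cst].
  + exact: cvg_cst.
- apply/cvgeryP; have -> : dyq ^~ +oo%E = fun n => 2 ^+ n : R.
    apply/funext => n; rewrite /dyq gt0_muley ?lte_fin ?invr_gt0 ?exprn_gt0//=.
    by rewrite subr0 mulr1.
  by rewrite -gtr0_cvgV0; [exact: cvg_halfpow|apply: nearW => n; exact: exprn_gt0].
Qed.

End dyadic_quotient.

Section mecke.
Local Open Scope ereal_scope.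
Context d (T : measurableType d) (R : realType) (P : probability T R)
  (xi : nat -> {RV P >-> R}).
Hypothesis hxi : is_poisson_point_process rem_intensity xi.
Let mu := @lebesgue_measure R.

Definition psum (g : R -> R) (w : T) : \bar R := \sum_(0 <= i <oo) (g (xi i w))%:E.

Lemma psum_ge0 g w : (forall x, 0 <= g x)%R -> 0 <= psum g w.
Proof. by move=> g0; apply: nneseries_ge0 => i _ _; rewrite lee_fin. Qed.

Lemma measurable_psum (g : R -> R) : measurable_fun setT g -> (forall x, 0 <= g x)%R ->
  measurable_fun setT (psum g).
Proof.
move=> mg g0; apply: ge0_emeasurable_sum => // [i w _ _|i _].
  by rewrite lee_fin.
by apply/measurable_EFinP; apply: measurableT_comp.
Qed.

(** The derivative at [t = 0] of the Laplace functional of [f + t g], computed with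
the difference quotients [dyq] on both sides. *)
Lemma campbell_mecke (f g : R -> R) :
  measurable_fun setT f -> (forall x, 0 <= f x)%R ->
  measurable_fun setT g -> (forall x, 0 <= g x)%R ->
  let I := \int[mu]_x (g x * (expR (- f x) * expR (- x)))%:E in
  I < +oo ->
  \int[P]_w (psum g w * (expN (psum f w))%:E) =
  I * (expN (\int[mu]_x ((1 - expR (- f x)) * expR (- x))%:E))%:E.
Proof.
move=> mf f0 mg g0 I Ioo.
set phi := \int[mu]_x _.
have mexp : measurable_fun setT (fun x : R => expR (- x)).
  by apply: measurableT_comp => //; exact: measurable_funN.
have mef : measurable_fun setT (fun x : R => expR (- f x)).
  by apply: measurableT_comp => //; exact: measurable_funN.
have mw : measurable_fun setT (fun x : R => expR (- f x) * expR (- x))%R.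
  exact: measurable_funM.
have w0 x : (0 <= expR (- f x) * expR (- x))%R by rewrite mulr_ge0 ?expR_ge0.
have I0 : 0 <= I by apply: integral_ge0 => x _; rewrite lee_fin mulr_ge0.
have phi0 : 0 <= phi.
  apply: integral_ge0 => x _; rewrite lee_fin mulr_ge0 ?expR_ge0// subr_ge0.
  by rewrite -expR0 ler_expR oppr_le0.
have mdyq n : measurable_fun setT (dyq n : \bar R -> R).
  apply: measurable_funM => //; apply: measurable_funB => //.
  apply: measurableT_comp; first exact: measurable_expN.
  exact: emeasurable_funM.
pose K n := \int[mu]_x (dyq n (g x)%:E * (expR (- f x) * expR (- x)))%:E.
have K0 n : 0 <= K n.
  by apply: integral_ge0 => x _; rewrite lee_fin mulr_ge0// dyq_ge0 ?lee_fin.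
have mKint n : measurable_fun setT (fun x => (dyq n (g x)%:E * (expR (- f x) * expR (- x)))%:E).
  apply/measurable_EFinP; apply: measurable_funM => //.
  by apply: measurableT_comp (mdyq n) _; exact/measurable_EFinP.
have KI n : K n <= I.
  apply: ge0_le_integral => //.
  - by move=> x _; rewrite lee_fin mulr_ge0// dyq_ge0 ?lee_fin.
  - exact: mKint.
  - by apply/measurable_EFinP; apply: measurable_funM.
  - move=> x _; rewrite lee_fin ler_wpM2r//.
    by have /andP[] := dyq_bounds n (g0 x).
have cK : K n @[n --> \oo] --> I.
  have -> : I = \int[mu]_x limn (fun n => (dyq n (g x)%:E * (expR (- f x) * expR (- x)))%:E).
    apply: eq_integral => x _; apply/esym/cvg_lim => //.
    have cg : (dyq n (g x)%:E)%:E @[n --> \oo] --> (g x)%:E by apply: cvg_dyq; rewrite lee_fin.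
    exact: (@cvgeZr _ _ _ _ _ (expR (- f x) * expR (- x))%:E _ cg).
  apply: cvg_monotone_convergence => //.
  - by move=> n x _; rewrite lee_fin mulr_ge0// dyq_ge0 ?lee_fin.
  - by move=> x _ n m nm; rewrite lee_fin ler_wpM2r// dyq_ndecr ?lee_fin.
have lhs : \int[P]_w (dyq n (psum g w) * expN (psum f w))%:E @[n --> \oo] -->
    \int[P]_w (psum g w * (expN (psum f w))%:E).
  have -> : \int[P]_w (psum g w * (expN (psum f w))%:E) =
      \int[P]_w limn (fun n => (dyq n (psum g w) * expN (psum f w))%:E).
    apply: eq_integral => w _; apply/esym/cvg_lim => //.
    under eq_fun do rewrite EFinM.
    by apply: cvgeZr => //; apply: cvg_dyq; exact: psum_ge0.
  apply: cvg_monotone_convergence => //.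
  - move=> n; apply/measurable_EFinP; apply: measurable_funM.
      by apply: measurableT_comp (mdyq n) _; exact: measurable_psum.
    by apply: measurableT_comp measurable_expN _; exact: measurable_psum.
  - by move=> n w _; rewrite lee_fin mulr_ge0 ?expN_ge0// dyq_ge0// psum_ge0.
  - by move=> w _ n m nm; rewrite lee_fin ler_wpM2r ?expN_ge0// dyq_ndecr// psum_ge0.
have step n : \int[P]_w (dyq n (psum g w) * expN (psum f w))%:E =
    (dyq n (K n) * expN phi)%:E.
  set t := (2 ^- n : R)%R.
  have t0 : (0 < t)%R by rewrite invr_gt0 exprn_gt0.
  pose h x := (f x + t * g x)%R.
  have mh : measurable_fun setT h by apply: measurable_funD => //; apply: measurable_funM.
  have h0 x : (0 <= h x)%R by rewrite addr_ge0// mulr_ge0// ltW.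
  have hE w : psum h w = psum f w + t%:E * psum g w.
    rewrite /psum -nneseriesZl; last by move=> i _; rewrite lee_fin.
    rewrite -nneseriesD//; last 2 first.
    - by move=> i _ _; rewrite lee_fin.
    - by move=> i _ _; rewrite mule_ge0// lee_fin// ltW.
  have intexp (k : R -> R) : measurable_fun setT k -> (forall x, 0 <= k x)%R ->
      P.-integrable setT (fun w => (expN (psum k w))%:E).
    move=> mk k0; apply: (@le_integrable _ _ _ P _ measurableT _ (cst 1)) => //.
    - apply/measurable_EFinP; apply: measurableT_comp measurable_expN _.
      exact: measurable_psum.
    - move=> w _ /=; rewrite normr1 ger0_norm ?expN_ge0// lee_fin.
      by apply: expN_le1; exact: psum_ge0.
    - exact: finite_measure_integrable_cst.
  transitivity ((2 ^+ n)%:E * (\int[P]_w (expN (psum f w))%:E - \int[P]_w (expN (psum h w))%:E)).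
    rewrite -integralB//; [|exact: intexp..].
    rewrite -integralZl//; last by apply: integrableB => //; exact: intexp.
    apply: eq_integral => w _; rewrite -EFinB -EFinM; congr EFin.
    rewrite hE expND ?psum_ge0//; last by rewrite mule_ge0 ?psum_ge0// lee_fin ltW.
    rewrite /dyq -/t; ring.
  rewrite !laplace_functional// -/phi.
  have -> : \int[mu]_x ((1 - expR (- h x)) * expR (- x))%:E = phi + t%:E * K n.
    rewrite -ge0_integralZl//; last 3 first.
    - exact: mKint.
    - by move=> x _; rewrite lee_fin mulr_ge0// dyq_ge0 ?lee_fin.
    - by rewrite lee_fin ltW.
    rewrite -ge0_integralD//; last 4 first.
    - move=> x _; rewrite lee_fin mulr_ge0 ?expR_ge0// subr_ge0.
      by rewrite -expR0 ler_expR oppr_le0.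
    - by apply/measurable_EFinP; apply: measurable_funM => //; apply: measurable_funB.
    - move=> x _; rewrite mule_ge0// lee_fin; first exact: ltW.
      by rewrite mulr_ge0// dyq_ge0 ?lee_fin.
    - by apply: emeasurable_funM => //; exact: mKint.
    apply: eq_integral => x _; rewrite -EFinM -EFinD; congr EFin.
    rewrite /dyq/= -/t /h opprD expRD.
    have -> : (2 ^+ n = t^-1 :> R)%R by rewrite invrK.
    by field; rewrite gt_eqF.
  rewrite (@expND _ phi (t%:E * K n))//; last by rewrite mule_ge0// lee_fin ltW.
  rewrite -EFinB -EFinM; congr EFin; rewrite /dyq -/t; ring.
apply: (cvg_unique (@ereal_hausdorff R) lhs).
rewrite /= (funext step).
have Ifin : I \is a fin_num by rewrite ge0_fin_numE.
have Kfin n : K n \is a fin_num by rewrite ge0_fin_numE// (le_lt_trans (KI n)).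
rewrite -(fineK Ifin) -EFinM; apply: cvg_EFin; first exact: nearW.
apply: cvgM; last exact: cvg_cst.
have cKr : fine (K n) @[n --> \oo] --> fine I by apply: fine_cvg; rewrite fineK.
apply: (@squeeze_cvgr _ _ _ _ (fun n => fine (K n) - 2 ^- n * (fine I) ^+ 2)%R (fun n => fine (K n))) => //.
- apply: nearW => n.
  have k0 : (0 <= fine (K n))%R by exact: fine_ge0.
  have := dyq_bounds n k0; rewrite fineK// => /andP[h1 ->]; rewrite andbT.
  apply: le_trans h1; rewrite lerD2l lerN2 ler_wpM2l ?invr_ge0 ?exprn_ge0//.
  by rewrite lerXn2r ?nnegrE ?fine_ge0// fine_le.
- rewrite -[X in _ --> X]subr0 -(mul0r (fine I ^+ 2)%R); apply: cvgB => //.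
  by apply: cvgM; [exact: cvg_halfpow|exact: cvg_cst].
Qed.

End mecke.

(** * One-variable calculus *)

Section derivation_rules.
Context {R : realType}.
Implicit Types (f g : R -> R) (x a b : R).

Lemma is_deriveD_fun f g x a b : is_derive x (1:R) f a -> is_derive x (1:R) g b ->
  is_derive x (1:R) (fun t => f t + g t) (a + b).
Proof. exact: is_deriveD. Qed.

Lemma is_deriveB_fun f g x a b : is_derive x (1:R) f a -> is_derive x (1:R) g b ->
  is_derive x (1:R) (fun t => f t - g t) (a - b).
Proof. exact: is_deriveB. Qed.

Lemma is_deriveN_fun f x a : is_derive x (1:R) f a ->
  is_derive x (1:R) (fun t => - f t) (- a).
Proof. exact: is_deriveN. Qed.

Lemma is_deriveM_fun f g x a b : is_derive x (1:R) f a -> is_derive x (1:R) g b ->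
  is_derive x (1:R) (fun t => f t * g t) (f x * b + g x * a).
Proof. exact: is_deriveM. Qed.

Lemma is_derive_comp_fun f g x a b : is_derive (g x) (1:R) f a -> is_derive x (1:R) g b ->
  is_derive x (1:R) (fun t => f (g t)) (a * b).
Proof. move=> hf hg; exact: is_derive1_comp. Qed.

Lemma is_derive_expR_fun g x b : is_derive x (1:R) g b ->
  is_derive x (1:R) (fun t => expR (g t)) (expR (g x) * b).
Proof. by move=> h; apply: is_derive_comp_fun. Qed.

Lemma is_derive_ln_fun g x b : 0 < g x -> is_derive x (1:R) g b ->
  is_derive x (1:R) (fun t => ln (g t)) ((g x)^-1 * b).
Proof. by move=> gx h; apply: is_derive_comp_fun; exact: is_derive1_ln. Qed.

Lemma is_derive_inv_fun g x b : g x != 0 -> is_derive x (1:R) g b ->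
  is_derive x (1:R) (fun t => (g t)^-1) (- (g x) ^- 2 * b).
Proof. by move=> gx h; exact: is_deriveV. Qed.

Lemma is_derive_continuous f x a : is_derive x (1:R) f a -> {for x, continuous f}.
Proof. by move=> [df _]; apply: differentiable_continuous; exact/derivable1_diffP. Qed.

Lemma is_derive_shift_fun f x c a : is_derive (x + c) (1:R) f a ->
  is_derive x (1:R) (fun t => f (t + c)) a.
Proof.
move=> h; have hg : is_derive x (1:R) (fun t : R => t + c) (1 + 0).
  exact: (is_deriveD_fun (is_derive_id x 1) (is_derive_cst c x 1)).
have := @is_derive_comp_fun f (fun t => t + c) x a (1 + 0) h hg.
by rewrite addr0 mulr1.
Qed.

Lemma MVT_fun f (df : R -> R) (a b : R) : a <= b ->
  (forall x, a <= x <= b -> is_derive x (1:R) f (df x)) ->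
  exists2 c, a <= c <= b & f b - f a = df c * (b - a).
Proof.
move=> ab h; have [| |c] := @MVT_segment R f df a b ab.
- by move=> x; rewrite in_itv/= => /andP[x1 x2]; apply: h; rewrite !ltW.
- apply: continuous_in_subspaceT => x; rewrite inE/= in_itv/= => hx.
  exact: is_derive_continuous (h x hx).
- by rewrite in_itv/= => hc ->; exists c.
Qed.

Lemma derive1_expR : (@expR R)^`()%classic = expR.
Proof. by apply/funext => z; rewrite derive1E; have [_ ->] := is_derive_expR z. Qed.

End derivation_rules.

Section real_line_integrals.
Context {R : realType}.
Let mu := @lebesgue_measure R.

Lemma integrable_expNabs (c : R) : 0 < c ->
  mu.-integrable setT (EFin \o (fun y => expR (- (c * `|y|)))).
Proof.
move=> c0; have cont : continuous (fun y : R => expR (- (c * `|y|))).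
  move=> y; apply: continuous_comp; last exact: continuous_expR.
  by apply: continuousN; apply: continuousM; [exact: cvg_cst|exact: norm_continuous].
apply/integrableP; split.
  by apply/measurable_EFinP; exact: continuous_measurable_fun.
under eq_integral do rewrite gee0_abs ?lee_fin ?expR_ge0//.
rewrite ge0_symfun_integralT//; last by move=> y /=; rewrite normrN.
rewrite lte_mul_pinfty ?lee_fin//.
have := @integral_exponential_pdf R c c0.
rewrite (_ : (\int[lebesgue_measure]_x _ = \int[lebesgue_measure]_(y in `[0%R, +oo[) (c * expR (- c * y))%:E)%E); last first.
  rewrite [RHS]integral_mkcond; apply: eq_integral => y _.
  by rewrite /exponential_pdf !patchE; case: ifP.
rewrite (_ : `[0, +oo[%classic = [set x : R | 0 <= x]); last first.
  by apply/seteqP; split => y; rewrite /= in_itv/= andbT.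
have -> : (\int[lebesgue_measure]_(y in [set x : R | (0 <= x)%R]) (c * expR (- c * y))%:E =
    c%:E * \int[lebesgue_measure]_(y in [set x : R | (0 <= x)%R]) (expR (- (c * `|y|)))%:E)%E.
  rewrite -(@ge0_integralZl _ _ _ lebesgue_measure _ _ (fun y => (expR (- (c * `|y|)))%:E)).
  - by apply: eq_integral => y; rewrite inE/= => y0; rewrite ger0_norm// mulNr EFinM.
  - by rewrite -set_itvcy.
  - apply/measurable_EFinP; apply: measurable_funTS; exact: continuous_measurable_fun.
  - by move=> y _; rewrite lee_fin expR_ge0.
  - by rewrite lee_fin ltW.
by case: (integral _ _ _) => [r| |]; rewrite ?ltry// gt0_muley ?lte_fin.
Qed.

Lemma ge0_cvg_integral_itv (f : R -> R) : measurable_fun setT f -> (forall x, 0 <= f x) ->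
  (\int[mu]_(x in `[(- n%:R)%R, n%:R%R]) (f x)%:E)%E @[n --> \oo] --> (\int[mu]_x (f x)%:E)%E.
Proof.
move=> mf f0.
have -> : [set: R] = \bigcup_n `[(- n%:R : R), n%:R]%classic.
  apply/seteqP; split => // x _; exists (Num.bound `|x|) => //=.
  have := archi_boundP (normr_ge0 x); rewrite in_itv/= -ler_norml => h.
  exact: ltW.
apply: ge0_nondecreasing_set_cvg_integral => //.
- move=> n m nm; apply/subsetPset; apply: subset_itv; rewrite bnd_simp ?lerN2 ler_nat//.
- by move=> n; apply/measurable_EFinP; exact: measurable_funTS.
- by move=> n x _; rewrite lee_fin.
Qed.

(** Stated with the Jacobian [a] inside the integral, the form in which it is
rewritten below. *)
Lemma ge0_integral_affine (a c : R) (G : R -> R) : 0 < a -> continuous G ->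
  (forall x, 0 <= G x) ->
  (\int[mu]_y (G y)%:E = \int[mu]_y (a * G (a * y + c)%R)%:E)%E.
Proof.
move=> a0 cG G0; pose F y := a * y + c.
have dF x : is_derive x (1:R) F a.
  have := is_deriveD_fun (is_deriveM_fun (is_derive_cst a x 1) (is_derive_id x 1)) (is_derive_cst c x 1).
  by rewrite mulr1 mulr0 !addr0.
have F' : F^`()%classic = cst a.
  by apply/funext => x; rewrite derive1E; exact: derive_val.
rewrite (@increasing_ge0_integration_by_substitutionT _ F)//.
- by apply: eq_integral => y _; rewrite F' /= fctE /= mulrC.
- by move=> x y xy; rewrite /F ltrD2r ltr_pM2l.
- by rewrite F' => ?; exact: cvg_cst.
- by rewrite F'; exact: is_cvg_cst.
- by rewrite F'; exact: is_cvg_cst.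
- apply/cvgrNyPle => A; exists (a^-1 * (A - c)); split; first exact: num_real.
  by move=> x /ltW h; rewrite /F -lerBrDr -ler_pdivlMl.
- apply/cvgryPge => A; exists (a^-1 * (A - c)); split; first exact: num_real.
  by move=> x /ltW h; rewrite /F -lerBlDr -ler_pdivrMl.
Qed.

Lemma measurable_affine_comp (a c : R) (G : R -> R) : continuous G ->
  measurable_fun setT (fun y => (a * G (a * y + c))%:E).
Proof.
move=> cG; apply/measurable_EFinP; apply: measurable_funM => //.
apply: measurableT_comp; first exact: continuous_measurable_fun.
by apply: measurable_funD => //; exact: measurable_funM.
Qed.

(** A vanishing integral would make [f] vanish almost everywhere, on a set of
infinite measure. *)
Lemma Rintegral_gt0 (f : R -> R) : mu.-integrable setT (EFin \o f) ->
  (forall x, 0 < f x) -> 0 < \int[mu]_x f x.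
Proof.
move=> intf f0; rewrite lt_neqAle Rintegral_ge0 ?andbT//; last by move=> x _; exact: ltW.
apply/negP => /eqP /esym h.
have mf := measurable_int _ intf.
have : (\int[mu]_(x in setT) `|(EFin \o f) x| = 0)%E.
  under eq_integral do rewrite /= ger0_norm ?ltW//.
  by rewrite -[RHS]/(0%:E)%E -h /Rintegral fineK//; exact: integrable_fin_num.
move=> /(ae_eq_integral_abs _ measurableT mf) [N [mN N0 sub]].
have : (mu `[0%R, 1%R] <= mu N)%E.
  apply: le_measure; rewrite ?inE//.
  move=> x _; apply: sub => /= /(_ I) [] fx.
  by have := f0 x; rewrite fx ltxx.
rewrite [X in (_ <= X)%E -> _]N0 /mu lebesgue_measure_itv/= lte_fin ltr01 oppr0 adde0.
by rewrite lee_fin ler10.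
Qed.

End real_line_integrals.

(** * Derivatives of the Gamma function *)

Section gamma_moments.
Context {R : realType}.
Let mu := @lebesgue_measure R.

(** After the substitution [t = e^y] the Gamma integral is the integral over the
line of [e^(x y - e^y)], and each derivative in [x] brings down a factor [y].
Thus [Gm k] is the derivative of order [k] of Gamma on the positive half-line. *)
Definition gmo (k : nat) (x y : R) : R := y ^+ k * expR (x * y - expR y).
Definition Gm (k : nat) (x : R) : R := \int[mu]_y gmo k x y.

Lemma continuous_gmo k x : continuous (gmo k x).
Proof.
move=> y; apply: (@cvgM _ _ (nbhs y) _ (fun z => z ^+ k) (fun z => expR (x * z - expR z))).
  exact: exprn_continuous.
apply: (@continuous_comp _ _ _ (fun y => x * y - expR y) expR); last exact: continuous_expR.
apply: continuousB; last exact: continuous_expR.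
by apply: continuousM; [exact: cvg_cst|exact: cvg_id].
Qed.

(** The bound is uniform for [x] in a compact interval: it dominates the
differentiation under the integral sign, and its exponential decay makes the
boundary terms of [Gm0S] vanish. *)
Lemma normr_gmo_le k (u v : R) : 0 < u -> u <= v ->
  exists C c, [/\ 0 < c, 0 <= C & forall x y, u <= x <= v ->
    `|gmo k x y| <= C * expR (- (c * `|y|))].
Proof.
move=> u0 uv.
pose c := Num.min u 1; have c0 : 0 < c by rewrite lt_min u0 ltr01.
have cu : c <= u by rewrite ge_min lexx.
have c1 : c <= 1 by rewrite ge_min lexx orbT.
have [e [e0 ek]] : exists e, 0 < e /\ e * k%:R <= c / 2.
  exists (c / (2 * k.+1%:R)); split; first by rewrite divr_gt0// mulr_gt0.
  rewrite invfM mulrA -mulrA ler_piMr//; first by rewrite divr_ge0// ltW.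
  by rewrite mulrC ler_pdivrMr// mul1r ler_nat.
exists (e ^- k * expR ((v + 1) ^+ 2)), (c / 2); split.
- by rewrite divr_gt0.
- by rewrite mulr_ge0 ?expR_ge0// invr_ge0 exprn_ge0// ltW.
move=> x y /andP[ux xv].
have b1 : x * y - expR y <= (v + 1) ^+ 2 - c * `|y|.
  have [y0|y0] := ltP y 0.
    rewrite ltr0_norm//; have := expR_ge0 y; nra.
  rewrite ger0_norm//.
  have h : (1 + y / 2) ^+ 2 <= expR y.
    rewrite [in leRHS](splitr y) expRD -expr2 lerXn2r ?nnegrE ?expR_ge0//.
      by rewrite addr_ge0// divr_ge0.
    exact: expR_ge1Dx.
  have h1 : x * y <= v * y by rewrite ler_wpM2r.
  have h2 : c * y <= y by rewrite ler_piMl.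
  have h3 := sqr_ge0 (v + 1 - y / 2); nra.
have b2 : `|y| ^+ k <= e ^- k * expR (c / 2 * `|y|).
  have h : (e * `|y|) ^+ k <= expR (c / 2 * `|y|).
    apply: (@le_trans _ _ (expR (e * `|y|) ^+ k)).
      rewrite lerXn2r ?nnegrE ?expR_ge0 ?mulr_ge0// ?(ltW e0)//.
      by apply: le_trans (expR_ge1Dx _); rewrite lerDr.
    rewrite -expRM_natr ler_expR mulrAC ler_wpM2r//.
  by rewrite -ler_pdivrMl ?invr_gt0 ?exprn_gt0// invrK -exprMn.
rewrite /gmo normrM normrX (ger0_norm (expR_ge0 _)).
apply: (@le_trans _ _ ((e ^- k * expR (c / 2 * `|y|)) * expR ((v + 1) ^+ 2 - c * `|y|))).
  by rewrite ler_pM ?expR_ge0 ?exprn_ge0// ler_expR.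
rewrite -!mulrA ler_wpM2l ?invr_ge0 ?exprn_ge0// ?(ltW e0)//.
rewrite -!expRD ler_expR; lra.
Qed.

Lemma integrable_gmo k x : 0 < x -> mu.-integrable setT (EFin \o gmo k x).
Proof.
move=> x0; have [C [c [c0 C0 h]]] := normr_gmo_le k x0 (lexx x).
apply: (@le_integrable _ _ _ mu _ measurableT _ (fun y => C%:E * (expR (- (c * `|y|)))%:E)%E).
- by apply/measurable_EFinP; apply: continuous_measurable_fun; exact: continuous_gmo.
- move=> y _ /=; rewrite lee_fin [leRHS]ger0_norm ?mulr_ge0 ?expR_ge0//.
  by apply: h; rewrite lexx.
- by apply: integrableZl => //; exact: integrable_expNabs.
Qed.

Lemma is_derive_gmo k (x y : R) : is_derive x (1:R) (fun x : R => gmo k x y) (gmo k.+1 x y).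
Proof.
have h := is_deriveB_fun (is_deriveM_fun (is_derive_id x 1) (is_derive_cst y x 1))
  (is_derive_cst (expR y) x 1).
apply: (is_derive_eq (is_deriveM_fun (is_derive_cst (y ^+ k) x 1) (is_derive_expR_fun h))).
rewrite /gmo /cst exprS; ring.
Qed.

Lemma is_derive_Gm k (x : R) : 0 < x -> is_derive x (1:R) (Gm k : R -> R) (Gm k.+1 x).
Proof.
move=> x0; have x2 : 0 < x / 2 by rewrite divr_gt0.
have [C [c [c0 C0 h]]] := @normr_gmo_le k.+1 (x / 2) (x + 1) x2 ltac:(lra).
have I : `](x / 2), (x + 1)[%classic x by rewrite /= in_itv/=; apply/andP; split; lra.
have d1 z y : partial1of2 (gmo k) z y = gmo k.+1 z y.
  by rewrite partial1of2E; have /@derive_val -> := is_derive_gmo k z y.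
have intf z : `](x / 2), (x + 1)[%classic z -> mu.-integrable setT (EFin \o gmo k z).
  rewrite /= in_itv/= => /andP[z1 _]; apply: integrable_gmo; exact: lt_trans z1.
have der z y : `](x / 2), (x + 1)[%classic z -> [set: R] y -> derivable (gmo k ^~ y) z 1.
  by move=> _ _; have [] := is_derive_gmo k z y.
have G0 (y : R) : 0 <= C * expR (- (c * `|y|)) by rewrite mulr_ge0 ?expR_ge0.
have iG : mu.-integrable setT (EFin \o (fun y => C * expR (- (c * `|y|)))).
  by apply: (integrableZl _ C (integrable_expNabs c0)).
have ub z y : `](x / 2), (x + 1)[%classic z -> [set: R] y ->
    `|partial1of2 (gmo k) z y| <= C * expR (- (c * `|y|)).
  rewrite /= in_itv/= => /andP[z1 z2] _; rewrite d1; apply: h.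
  by rewrite !ltW.
split.
  have H := derivable_under_integral measurableT I intf der G0 iG ub.
  exact: H.
rewrite -derive1E (differentiation_under_integral measurableT I intf der G0 iG ub).
by apply: eq_Rintegral => y _; rewrite d1.
Qed.

End gamma_moments.

Section gamma_functional_equation.
Context {R : realType}.
Let mu := @lebesgue_measure R.

Lemma gmo_ge0 (x y : R) : 0 <= gmo 0 x y.
Proof. by rewrite /gmo mulr_ge0 ?expR_ge0. Qed.

Lemma integral_gmo0 (x : R) : 0 < x -> (\int[mu]_y (gmo 0 x y)%:E = (Gm 0 x)%:E)%E.
Proof. by move=> x0; rewrite fineK//; apply: integrable_fin_num => //; exact: integrable_gmo. Qed.

Lemma Gamma_Gm (x : R) : 0 < x -> Gamma x = Gm 0 x.
Proof.
move=> x0.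
pose G t := t `^ (x - 1) * expR (- t).
pose A n := `[expR (- n%:R : R), expR (n%:R : R)]%classic.
have mG : measurable_fun setT G.
  apply: measurable_funM; first exact: measurable_powR.
  by apply: measurableT_comp => //; exact: measurable_funN.
have UA : \bigcup_n A n = `]0, +oo[%classic.
  apply/seteqP; split => [t [n _]|t]; rewrite /A/= !in_itv/= andbT.
    by move=> /andP[+ _]; apply: lt_le_trans; exact: expR_gt0.
  move=> t0; exists (Num.bound `|ln t|) => //.
  have := archi_boundP (normr_ge0 (ln t)) => /ltW; rewrite ler_norml => /andP[h1 h2].
  by rewrite /= in_itv/= -[X in _ <= X <= _](lnK t0) !ler_expR h1.
have c1 : (\int[mu]_(t in A n) (G t)%:E)%E @[n --> \oo] --> (\int[mu]_(t in `]0%R, +oo[) (G t)%:E)%E.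
  rewrite -UA; apply: ge0_nondecreasing_set_cvg_integral.
  - move=> n m nm; apply/subsetPset; apply: subset_itv; rewrite bnd_simp ler_expR ?lerN2 ler_nat//.
  - by move=> n; exact: measurable_itv.
  - by move=> n; apply/measurable_EFinP; exact: measurable_funTS.
  - by move=> n t _; rewrite lee_fin mulr_ge0 ?powR_ge0 ?expR_ge0.
have c2 := ge0_cvg_integral_itv (continuous_measurable_fun (@continuous_gmo R 0 x)) (gmo_ge0 x).
suff E n : (\int[mu]_(t in A n) (G t)%:E = \int[mu]_(y in `[(- n%:R)%R, n%:R%R]) (gmo 0 x y)%:E)%E.
  rewrite /Gamma /Gm /Rintegral; congr fine.
  apply: (cvg_unique (@ereal_hausdorff R) c1).
  by rewrite /= (funext E).
rewrite /A integration_by_substitution_increasing.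
- apply: eq_integral => y _; congr EFin.
  rewrite derive1_expR.
  rewrite /gmo /G fctE /= -expRM -!expRD expr0 mul1r; congr expR; lra.
- by apply: (@le_trans _ _ 0) => //; rewrite oppr_le0.
- by move=> a b _ _ ab; rewrite ltr_expR.
- rewrite derive1_expR.
  by move=> y _; exact: continuous_expR.
- rewrite derive1_expR.
  by apply/cvg_ex; eexists; apply: cvg_at_right_filter; exact: continuous_expR.
- rewrite derive1_expR.
  by apply/cvg_ex; eexists; apply: cvg_at_left_filter; exact: continuous_expR.
- split.
  + by move=> y _; exact: derivable_expR.
  + by apply: cvg_at_right_filter; exact: continuous_expR.
  + by apply: cvg_at_left_filter; exact: continuous_expR.
- apply: continuous_in_subspaceT => t; rewrite inE/= in_itv/= => /andP[t1 _].
  have t0 : 0 < t by apply: lt_le_trans t1; exact: expR_gt0.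
  have /is_derive_continuous := is_deriveM_fun (@is_derive1_powR R (x - 1) t t0)
    (is_derive_expR_fun (is_deriveN_fun (is_derive_id t 1))).
  exact.
Qed.

Lemma Gm0_gt0 (x : R) : 0 < x -> 0 < Gm 0 x.
Proof.
move=> x0; apply: Rintegral_gt0; first exact: integrable_gmo.
by move=> y; rewrite /gmo expr0 mul1r expR_gt0.
Qed.

Lemma is_derive_gmo0 (x y : R) :
  is_derive y (1:R) (gmo 0 x) (x * gmo 0 x y - gmo 0 (x + 1) y).
Proof.
have h := is_deriveB_fun (is_deriveM_fun (is_derive_cst x y 1) (is_derive_id y 1))
  (is_derive_expR_fun (is_derive_id y 1)).
rewrite (_ : gmo 0 x = fun t => expR (x * t - expR t)); last first.
  by apply/funext => t; rewrite /gmo expr0 mul1r.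
apply: (is_derive_eq (is_derive_expR_fun h)).
rewrite /gmo /cst !expr0 !mul1r !mulr1 mulr0 addr0 mulrBr mulrC -expRD.
by congr (_ - expR _); lra.
Qed.

Lemma cvg_gmo0 (x : R) : 0 < x ->
  (gmo 0 x n%:R @[n --> \oo] --> (0:R)) /\ (gmo 0 x (- n%:R) @[n --> \oo] --> (0:R)).
Proof.
move=> x0; have [C [c [c0 C0 h]]] := normr_gmo_le 0 x0 (lexx x).
have hb y : 0 <= gmo 0 x y <= C * expR (- (c * `|y|)).
  rewrite gmo_ge0/= (le_trans (ler_norm _))// h// lexx//.
have cb : C * expR (- (c * n%:R)) @[n --> \oo] --> (0:R).
  rewrite -(mulr0 C); apply: cvgM; first exact: cvg_cst.
  have := @cvg_geometric R 1 (expR (- c)).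
  rewrite ger0_norm ?expR_ge0// => /(_ _)/(_ _).
  have e1 : expR (- c) < 1 by rewrite -expR0 ltr_expR oppr_lt0.
  move=> /(_ e1); apply: cvg_trans; apply: near_eq_cvg; near=> n.
  by rewrite /geometric/= mul1r -expRM_natr mulNr.
split.
- apply: (squeeze_cvgr _ (cvg_cst 0) cb); near=> n.
  by have := hb n%:R; rewrite ger0_norm.
- apply: (squeeze_cvgr _ (cvg_cst 0) cb); near=> n.
  by have := hb (- n%:R); rewrite normrN ger0_norm.
Unshelve. all: by end_near. Qed.

(** The derivative of [y |-> e^(x y - e^y)] is [x * gmo 0 x - gmo 0 (x + 1)], and it
integrates to 0 over the line. *)
Lemma Gm0S (x : R) : 0 < x -> Gm 0 (x + 1) = x * Gm 0 x.
Proof.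
move=> x0; have x10 : 0 < x + 1 by rewrite addr_gt0.
pose B n := `[(- n%:R : R), n%:R]%classic.
have mB n : measurable (B n : set (measurableTypeR R)) by exact: measurable_itv.
have cR z : 0 < z -> \int[mu]_(y in B n) gmo 0 z y @[n --> \oo] --> Gm 0 z.
  move=> z0; apply: fine_cvg; rewrite -integral_gmo0//.
  exact: (ge0_cvg_integral_itv (continuous_measurable_fun (@continuous_gmo R 0 z)) (gmo_ge0 z)).
have iB z n : 0 < z -> mu.-integrable (B n) (EFin \o gmo 0 z).
  by move=> z0; apply: (integrableS measurableT); [exact: mB|by []|exact: integrable_gmo].
have E n : x * (\int[mu]_(y in B n.+1) gmo 0 x y) - \int[mu]_(y in B n.+1) gmo 0 (x + 1) y =
    gmo 0 x n.+1%:R - gmo 0 x (- n.+1%:R).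
  have iZ : mu.-integrable (B n.+1) (EFin \o (fun y => x * gmo 0 x y)).
    by have := integrableZl (mB n.+1) x (iB x n.+1 x0).
  rewrite -(RintegralZl x (mB n.+1) (iB x n.+1 x0)).
  rewrite -(RintegralB (mB n.+1) iZ (iB (x + 1) n.+1 x10)).
  rewrite /Rintegral (@continuous_FTC2 _ _ (gmo 0 x)) ?fineB//.
  - by rewrite (@lt_trans _ _ 0) ?oppr_lt0 ?ltr0n.
  - apply: continuous_subspaceT => y; apply: cvgB; last exact: continuous_gmo.
    apply: cvgM; [exact: cvg_cst|exact: continuous_gmo].
  - split.
    + by move=> y _; have [] := is_derive_gmo0 x y.
    + by apply: cvg_at_right_filter; exact: continuous_gmo.
    + by apply: cvg_at_left_filter; exact: continuous_gmo.
  - by move=> y _; rewrite derive1E; have [_ ->] := is_derive_gmo0 x y.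
have l1 : x * (\int[mu]_(y in B n.+1) gmo 0 x y) - \int[mu]_(y in B n.+1) gmo 0 (x + 1) y
    @[n --> \oo] --> x * Gm 0 x - Gm 0 (x + 1).
  apply: cvgB; first by apply: cvgM; [exact: cvg_cst|rewrite (cvg_shiftS (fun n => \int[mu]_(y in B n) gmo 0 x y)); exact: cR].
  by rewrite (cvg_shiftS (fun n => \int[mu]_(y in B n) gmo 0 (x + 1) y)); exact: cR.
have [d1 d2] := cvg_gmo0 x0.
have l2 : gmo 0 x n.+1%:R - gmo 0 x (- n.+1%:R) @[n --> \oo] --> 0 - (0:R).
  apply: cvgB; first by rewrite (cvg_shiftS (fun n => gmo 0 x n%:R)).
  by rewrite (cvg_shiftS (fun n => gmo 0 x (- n%:R))).
rewrite (funext E) in l1.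
have := cvg_unique (@Rhausdorff R) l1 l2; rewrite subrr => e.
by apply/esym/eqP; rewrite -subr_eq0 e.
Qed.

Lemma Gm0_1 : Gm 0 (1 : R) = 1.
Proof.
rewrite -Gamma_Gm// /Gamma /Rintegral.
have := @integral_exponential_pdf R 1 ltr01.
rewrite (_ : (\int[lebesgue_measure]_x _ = \int[lebesgue_measure]_(y in `[0%R, +oo[) (expR (- y))%:E)%E); last first.
  rewrite [RHS]integral_mkcond; apply: eq_integral => y _.
  by rewrite /exponential_pdf !patchE; case: ifP => // _; rewrite mul1r mulN1r.
rewrite -integral_itv_obnd_cbnd; last first.
  apply/measurable_EFinP; apply: measurable_funTS.
  by apply: measurableT_comp => //; exact: measurable_funN.
move=> h; rewrite (_ : (\int[lebesgue_measure]_(x in _) _)%E = 1%E)//.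
rewrite -[RHS]h; apply: eq_integral => y; rewrite inE/= in_itv/= andbT => y0.
by rewrite subrr powRr0 mul1r.
Qed.

Lemma GmS (x : R) : 0 < x -> Gm 1 (x + 1) = Gm 0 x + x * Gm 1 x.
Proof.
move=> x0; have x10 : 0 < x + 1 by rewrite addr_gt0.
have a : is_derive x (1:R) (fun t : R => Gm 0 (t + 1)) (Gm 1 (x + 1) * (1 + 0)).
  by rewrite addr0 mulr1; apply: is_derive_shift_fun; exact: is_derive_Gm.
have b := is_deriveM_fun (is_derive_id x 1) (is_derive_Gm 0 x0).
have [_ e1] : is_derive x (1:R) (fun t : R => t * Gm 0 t) (Gm 1 (x + 1) * (1 + 0)).
  apply: near_eq_is_derive a; near=> t; rewrite Gm0S//.
  near: t; exact: lt_nbhsr.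
have [_ e2] := b.
have := etrans (esym e1) e2; rewrite addr0 !mulr1 => ->.
by rewrite addrC.
Unshelve. all: by end_near. Qed.

Lemma GmSS (x : R) : 0 < x -> Gm 2 (x + 1) = 2 * Gm 1 x + x * Gm 2 x.
Proof.
move=> x0; have x10 : 0 < x + 1 by rewrite addr_gt0.
have a : is_derive x (1:R) (fun t : R => Gm 1 (t + 1)) (Gm 2 (x + 1) * (1 + 0)).
  by rewrite addr0 mulr1; apply: is_derive_shift_fun; exact: is_derive_Gm.
have b := is_deriveD_fun (is_derive_Gm 0 x0) (is_deriveM_fun (is_derive_id x 1) (is_derive_Gm 1 x0)).
have [_ e1] : is_derive x (1:R) (fun t : R => Gm 0 t + t * Gm 1 t) (Gm 2 (x + 1) * (1 + 0)).
  apply: near_eq_is_derive a; near=> t; rewrite GmS//.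
  near: t; exact: lt_nbhsr.
have [_ e2] := b.
have := etrans (esym e1) e2; rewrite addr0 !mulr1 => ->.
rewrite /=; ring.
Unshelve. all: by end_near. Qed.

Lemma Gamma_derive (x : R) : 0 < x -> derive1 (@Gamma R) x = Gm 1 x.
Proof.
move=> x0; rewrite derive1E.
have [_ <-] : is_derive x (1:R) (@Gamma R) (Gm 1 x).
  apply: near_eq_is_derive (is_derive_Gm 0 x0); near=> t; rewrite Gamma_Gm//.
  near: t; exact: lt_nbhsr.
by [].
Unshelve. all: by end_near. Qed.

Lemma Gamma_derive2 (x : R) : 0 < x -> derive1n 2 (@Gamma R) x = Gm 2 x.
Proof.
move=> x0; rewrite derive1nS derive1n1 derive1E.
have [_ <-] : is_derive x (1:R) (derive1 (@Gamma R)) (Gm 2 x).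
  apply: near_eq_is_derive (is_derive_Gm 1 x0); near=> t; rewrite Gamma_derive//.
  near: t; exact: lt_nbhsr.
by [].
Unshelve. all: by end_near. Qed.

Lemma integral_gmo_shift2 (x c : R) : 0 < x ->
  mu.-integrable setT (EFin \o (fun y => (y - c) ^+ 2 * gmo 0 x y)) /\
  \int[mu]_y ((y - c) ^+ 2 * gmo 0 x y) = Gm 2 x - 2 * c * Gm 1 x + c ^+ 2 * Gm 0 x.
Proof.
move=> x0.
have i0 := integrable_gmo 0 x0; have i1 := integrable_gmo 1 x0; have i2 := integrable_gmo 2 x0.
have iZ a k : mu.-integrable setT (EFin \o (fun y => a * gmo k x y)).
  by have := integrableZl measurableT a (integrable_gmo k x0).
have iB : mu.-integrable setT (EFin \o (fun y => gmo 2 x y - 2 * c * gmo 1 x y)).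
  by have := integrableB measurableT i2 (iZ (2 * c) 1%N).
have iD : mu.-integrable setT (EFin \o (fun y => gmo 2 x y - 2 * c * gmo 1 x y + c ^+ 2 * gmo 0 x y)).
  by have := integrableD measurableT iB (iZ (c ^+ 2) 0%N).
have E : (fun y => (y - c) ^+ 2 * gmo 0 x y) =
    (fun y => gmo 2 x y - 2 * c * gmo 1 x y + c ^+ 2 * gmo 0 x y).
  by apply/funext => y; rewrite /gmo; ring.
rewrite E; split => //.
by rewrite (RintegralD measurableT iB (iZ (c ^+ 2) 0%N)) (RintegralB measurableT i2 (iZ (2 * c) 1%N))
  (RintegralZl _ measurableT i0) (RintegralZl _ measurableT i1).
Qed.

(** The second derivative of [log Gamma]. *)
Definition trigamma (x : R) : R := (Gm 2 x * Gm 0 x - Gm 1 x ^+ 2) / Gm 0 x ^+ 2.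

(** Up to normalisation, the variance of [y] under the density [gmo 0 x]. *)
Lemma trigamma_ge0 (x : R) : 0 < x -> 0 <= trigamma x.
Proof.
move=> x0; have G0 := Gm0_gt0 x0.
have [_ h] := integral_gmo_shift2 (Gm 1 x / Gm 0 x) x0.
have : 0 <= \int[mu]_y ((y - Gm 1 x / Gm 0 x) ^+ 2 * gmo 0 x y).
  by apply: Rintegral_ge0 => // y _; rewrite mulr_ge0 ?sqr_ge0 ?gmo_ge0.
rewrite h => h2; rewrite /trigamma.
rewrite (_ : _ / _ = (Gm 2 x - 2 * (Gm 1 x / Gm 0 x) * Gm 1 x + (Gm 1 x / Gm 0 x) ^+ 2 * Gm 0 x) / Gm 0 x).
  by rewrite divr_ge0// ltW.
by field; rewrite gt_eqF.
Qed.

(** The second logarithmic derivative of the functional equation of Gamma. *)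
Lemma trigammaS (x : R) : 0 < x -> trigamma x = x ^- 2 + trigamma (x + 1).
Proof.
move=> x0; have G0 := Gm0_gt0 x0.
rewrite /trigamma Gm0S// GmS// GmSS//.
by field; rewrite !gt_eqF.
Qed.

(** The right-hand side is [(e^(u/2) - e^(-u/2))^2], and [2 sinh v >= 2 v] for
[v >= 0]. *)
Lemma sqr_le_cosh (u : R) : u ^+ 2 <= expR u - 2 + expR (- u).
Proof.
(* Used twice: for cosh >= 1, hence sinh_ge, and to reduce the claim to sinh_ge. *)
have cosh2 (v : R) : expR v + expR (- v) - 2 = (expR (v / 2) - expR (- (v / 2))) ^+ 2.
  have e1 : expR v = expR (v / 2) ^+ 2 by rewrite expr2 -expRD -splitr.
  have e2 : expR (- v) = expR (- (v / 2)) ^+ 2 by rewrite expr2 -expRD -opprD -splitr.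
  have e3 : expR (v / 2) * expR (- (v / 2)) = 1 by rewrite -expRD subrr expR0.
  rewrite e1 e2; nra.
have sinh_ge (v : R) : 0 <= v -> 2 * v <= expR v - expR (- v).
  move=> v0; pose f (t : R) := expR t - expR (- t) - 2 * t.
  pose df (t : R) : R := expR t + expR (- t) - 2.
  have dfE (t : R) : is_derive t (1:R) f (df t).
    have h := is_deriveB_fun (is_deriveB_fun (is_derive_expR t)
      (is_derive_expR_fun (is_deriveN_fun (is_derive_id t 1))))
      (is_deriveM_fun (is_derive_cst (2 : R) t 1) (is_derive_id t 1)).
    by apply: (is_derive_eq h); rewrite /df /cst; lra.
  have [c _ E] := MVT_fun v0 (fun x _ => dfE x).
  have : 0 <= df c by rewrite /df cosh2 sqr_ge0.
  move: E; rewrite /f oppr0 subrr mulr0 !subr0 addr0 => E h.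
  have := mulr_ge0 h v0; rewrite -E; lra.
have -> : expR u - 2 + expR (- u) = expR u + expR (- u) - 2 by lra.
rewrite cosh2; have [u0|u0] := leP 0 u.
  rewrite lerXn2r ?nnegrE//; have := sinh_ge (u / 2); lra.
have h := sinh_ge (- u / 2).
rewrite -sqrrN -[leRHS]sqrrN lerXn2r ?nnegrE//.
- lra.
- by move: h; rewrite mulNr opprK; lra.
- by move: h; rewrite mulNr opprK; lra.
Qed.

(** A variance is at most the second moment about any point; the point [ln x] is
chosen because the upper bound [sqr_le_cosh] of [(y - ln x)^2] integrates to
values of Gamma at [x - 1], [x] and [x + 1]. *)
Lemma trigamma_le (x : R) : 1 < x -> trigamma x <= (x - 1)^-1.
Proof.
move=> x1; have x0 : 0 < x by exact: lt_trans x1.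
have x10 : 0 < x - 1 by rewrite subr_gt0.
have G0 := Gm0_gt0 x0; have G1 := Gm0_gt0 x10.
have E : Gm 0 x = (x - 1) * Gm 0 (x - 1) by rewrite -Gm0S// subrK.
have [i2 h] := integral_gmo_shift2 (ln x) x0.
have x10' : 0 < x + 1 by rewrite addr_gt0.
have iZ a z : 0 < z -> mu.-integrable setT (EFin \o (fun y => a * gmo 0 z y)).
  by move=> z0; have := integrableZl measurableT a (integrable_gmo 0 z0).
have iB : mu.-integrable setT (EFin \o (fun y => x^-1 * gmo 0 (x + 1) y - 2 * gmo 0 x y)).
  by have := integrableB measurableT (iZ x^-1 _ x10') (iZ 2 _ x0).
have iD : mu.-integrable setT (EFin \o (fun y => x^-1 * gmo 0 (x + 1) y - 2 * gmo 0 x y + x * gmo 0 (x - 1) y)).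
  by have := integrableD measurableT iB (iZ x _ x10).
have le1 : \int[mu]_y ((y - ln x) ^+ 2 * gmo 0 x y) <= Gm 0 x / (x - 1).
  apply: (@le_trans _ _ (\int[mu]_y (x^-1 * gmo 0 (x + 1) y - 2 * gmo 0 x y + x * gmo 0 (x - 1) y))).
    apply: le_Rintegral => // y _.
    have ex : expR (ln x) = x by rewrite lnK.
    set u := y - ln x.
    have g1 : gmo 0 (x + 1) y = gmo 0 x y * (x * expR u).
      rewrite /gmo !expr0 !mul1r -[X in _ * (X * _)]ex -!expRD; congr expR; rewrite /u; ring.
    have g2 : gmo 0 (x - 1) y = gmo 0 x y * (x * expR u)^-1.
      rewrite /gmo !expr0 !mul1r -[X in _ * (X * _)^-1]ex -expRD -expRN -!expRD; congr expR; rewrite /u; ring.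
    rewrite g1 g2.
    have w0 := gmo_ge0 x y.
    have -> : x^-1 * (gmo 0 x y * (x * expR u)) - 2 * gmo 0 x y + x * (gmo 0 x y / (x * expR u)) =
        gmo 0 x y * (expR u - 2 + expR (- u)).
      by rewrite expRN; field; rewrite !gt_eqF ?expR_gt0.
    rewrite mulrC ler_wpM2l//; exact: sqr_le_cosh.
  rewrite (RintegralD measurableT iB (iZ x _ x10)) (RintegralB measurableT (iZ x^-1 _ x10') (iZ 2 _ x0)).
  rewrite (RintegralZl _ measurableT (integrable_gmo 0 x10')) (RintegralZl _ measurableT (integrable_gmo 0 x0)).
  rewrite (RintegralZl _ measurableT (integrable_gmo 0 x10)).
  rewrite -![\int[mu]_y gmo 0 _ y]/(Gm 0 _) Gm0S// E.
  by rewrite le_eqVlt; apply/orP; left; apply/eqP; field; rewrite !gt_eqF.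
rewrite h in le1.
have := mulr_ge0 (ltW G0) (sqr_ge0 (Gm 1 x / Gm 0 x - ln x)) => h3.
rewrite (_ : trigamma x = (Gm 2 x - 2 * ln x * Gm 1 x + ln x ^+ 2 * Gm 0 x -
  Gm 0 x * (Gm 1 x / Gm 0 x - ln x) ^+ 2) / Gm 0 x); last first.
  by rewrite /trigamma; field; rewrite gt_eqF.
rewrite ler_pdivrMr// mulrC; move: le1 h3; clear.
by move=> h1 h2; rewrite lerBlDr (mulrC (Gm 1 x)) (mulrC (x - 1)^-1) (le_trans h1)// lerDl.
Qed.

End gamma_functional_equation.

(** * The trigamma series *)

Section trigamma_series.
Context {R : realType}.

Lemma trigamma_sum (x : R) n : 0 < x ->
  trigamma x = \sum_(0 <= k < n) (x + k%:R) ^- 2 + trigamma (x + n%:R).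
Proof.
move=> x0; elim: n => [|n ih]; first by rewrite big_geq// add0r addr0.
rewrite big_nat_recr//= ih -addrA; congr (_ + _).
rewrite trigammaS; last by rewrite ltr_wpDr.
by rewrite -addrA natr1.
Qed.

Lemma cvg_trigamma_tail (x : R) : 0 < x -> trigamma (x + n%:R) @[n --> \oo] --> (0:R).
Proof.
move=> x0; rewrite -(cvg_shiftn 2).
have h : (n%:R + 1 : R)^-1 @[n --> \oo] --> (0:R).
  have := @cvg_harmonic R; apply: cvg_trans; apply: near_eq_cvg; apply: nearW => n.
  by rewrite /harmonic/= natr1.
apply: (squeeze_cvgr _ (cvg_cst 0) h); apply: nearW => n.
have e : x + (n + 2)%:R = (x + (n%:R + 1)) + 1 by rewrite natrD; lra.
have n0 : (0 : R) <= n%:R by [].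
have x1 : 1 < x + (n + 2)%:R by rewrite e; lra.
rewrite trigamma_ge0 ?(lt_trans ltr01)//=.
rewrite e in x1 *.
by apply: (le_trans (trigamma_le x1)); rewrite lef_pV2 ?posrE; lra.
Qed.

(** Iterating [trigammaS] leaves the tail [trigamma (x + n)], which tends to 0 by
[trigamma_le]. *)
Lemma cvg_trigamma (x : R) : 0 < x ->
  \sum_(0 <= k < n) (x + k%:R) ^- 2 @[n --> \oo] --> trigamma x.
Proof.
move=> x0; rewrite -[X in _ --> X]subr0.
have -> : (fun n => \sum_(0 <= k < n) (x + k%:R) ^- 2) =
    (fun n => trigamma x - trigamma (x + n%:R)).
  by apply/funext => n; rewrite (trigamma_sum n x0) addrK.
by apply: cvgB; [exact: cvg_cst|exact: cvg_trigamma_tail].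
Qed.

Lemma trigamma_sum_le (x : R) n : 0 < x -> \sum_(0 <= k < n) (x + k%:R) ^- 2 <= trigamma x.
Proof.
move=> x0; rewrite (trigamma_sum n x0) lerDl trigamma_ge0// ltr_wpDr//.
Qed.

Lemma trigamma_nincr (x y : R) : 0 < x -> x <= y -> trigamma y <= trigamma x.
Proof.
move=> x0 xy; have y0 : 0 < y by exact: lt_le_trans xy.
rewrite -(cvg_lim (@Rhausdorff R) (cvg_trigamma y0)) -(cvg_lim (@Rhausdorff R) (cvg_trigamma x0)).
apply: ler_lim; [by apply/cvg_ex; eexists; exact: cvg_trigamma|by apply/cvg_ex; eexists; exact: cvg_trigamma|].
apply: nearW => n; apply: ler_sum => k _.
have h1 : 0 < x + k%:R by rewrite ltr_wpDr.
have h2 : 0 < y + k%:R by rewrite ltr_wpDr.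
by rewrite lef_pV2 ?posrE ?exprn_gt0// lerXn2r ?nnegrE ?(ltW h1) ?(ltW h2)// lerD2r.
Qed.

End trigamma_series.

(** * The Basel sum *)

Section basel.
Context {R : realType}.

(** Halving the angle turns one term [1 / sin^2] into two.  Starting from
[1 / sin^2 (pi / 2) = 1], the iteration [sum_inv_sin2] leads to the Basel sum;
the argument is due to Hofbauer. *)
Lemma sin_half (x : R) : 0 < x < pi ->
  (sin x) ^- 2 = (sin (x / 2) ^- 2 + sin ((x + pi) / 2) ^- 2) / 4.
Proof.
move=> /andP[x0 xpi].
have h : 0 < x / 2 < pi / 2 by apply/andP; split; lra.
have s0 : sin (x / 2) != 0.
  by rewrite gt_eqF// sin_gt0_pi//; have /andP[? ?] := h; apply/andP; split => //; lra.
have c0 : cos (x / 2) != 0.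
  rewrite gt_eqF// cos_gt0_pihalf//; have /andP[? ?] := h; apply/andP; split => //; lra.
have -> : (x + pi) / 2 = x / 2 + pi / 2 by rewrite mulrDl.
rewrite sinDpihalf.
have -> : sin x = 2 * sin (x / 2) * cos (x / 2).
  by rewrite [in LHS](splitr x) sinD mulrC; lra.
have E := cos2Dsin2 (x / 2).
set a := sin (x / 2) in s0 E *; set c := cos (x / 2) in c0 E *.
transitivity ((c ^+ 2 + a ^+ 2) / (4 * a ^+ 2 * c ^+ 2)).
  by rewrite E; field; rewrite s0 c0.
by field; rewrite s0 c0.
Qed.

Lemma sumr_nat_double (F : nat -> R) n :
  \sum_(0 <= k < n.*2) F k = \sum_(0 <= k < n) (F k.*2 + F k.*2.+1).
Proof.
elim: n => [|n ih]; first by rewrite !big_geq.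
by rewrite doubleS !big_nat_recr//= ih addrA.
Qed.

Lemma sum_inv_sin2 m :
  \sum_(0 <= k < 2 ^ m) sin ((2 * k%:R + 1) * pi / 2 ^+ m.+1) ^- 2 = (4 ^+ m : R).
Proof.
elim: m => [|m ih].
  by rewrite expn0 big_nat1 mulr0 add0r mul1r expr1 sin_pihalf expr1n invr1 expr0.
have e2 : (2 ^ m.+1 = 2 ^ m + 2 ^ m)%N by rewrite expnS mul2n addnn.
rewrite e2 (@big_cat_nat _ _ _ (2 ^ m)) ?leq_addr//=.
rewrite -{2}[(2 ^ m)%N]add0n big_addn addnK -big_split/= [in RHS]exprS -ih mulr_sumr.
apply: eq_big_nat => k /andP[_ km].
have p0 : 0 < (2 : R) ^+ m.+1 by rewrite exprn_gt0.
have kR : (k%:R + 1 <= 2 ^+ m :> R) by rewrite natr1 -natrX ler_nat.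
have pp := @pi_gt0 R; have k0 : 0 <= k%:R :> R by [].
set x := (2 * k%:R + 1) * pi / 2 ^+ m.+1.
have hx : 0 < x < pi.
  rewrite /x; apply/andP; split; first by rewrite divr_gt0// mulr_gt0//; lra.
  rewrite ltr_pdivrMr// mulrC ltr_pM2l// exprS; lra.
rewrite (sin_half hx) [in RHS]mulrC mulfVK//.
congr (sin _ ^- 2 + sin _ ^- 2).
  by rewrite /x [in LHS]exprS; field; rewrite gt_eqF.
rewrite /x natrD natrX [in LHS]exprS exprS; field.
by rewrite gt_eqF// exprn_gt0.
Qed.

(** The sum [sum_inv_sin2] is symmetric under [x |-> pi - x], which exchanges its
two halves. *)
Lemma sum_inv_sin2_half m :
  \sum_(0 <= k < 2 ^ m) sin ((2 * k%:R + 1) * pi / 2 ^+ m.+2) ^- 2 = (2 * 4 ^+ m : R).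
Proof.
have := sum_inv_sin2 m.+1.
have e2 : (2 ^ m.+1 = 2 ^ m + 2 ^ m)%N by rewrite expnS mul2n addnn.
rewrite {1}e2 (@big_cat_nat _ _ _ (2 ^ m)) ?leq_addr//=.
rewrite [X in _ + X]big_nat_rev/=.
rewrite -{2}[(2 ^ m)%N]add0n big_addn addnK.
have -> : \sum_(0 <= i < 2 ^ m)
    sin ((2 * (2 ^ m + (2 ^ m + 2 ^ m) - (i + 2 ^ m).+1)%:R + 1) * pi / 2 ^+ m.+2) ^- 2 =
    \sum_(0 <= k < 2 ^ m) sin ((2 * k%:R + 1) * pi / 2 ^+ m.+2) ^- 2 :> R.
  apply: eq_big_nat => k /andP[_ km].
  rewrite (_ : (2 ^ m + (2 ^ m + 2 ^ m) - (k + 2 ^ m).+1 = (2 ^ m + 2 ^ m) - k.+1)%N); last first.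
    by rewrite addnC -addSn subnDr.
  rewrite natrB; last by rewrite (leq_trans km)// leq_addr.
  rewrite natrD natrX.
  rewrite (_ : _ / _ = pi - (2 * k%:R + 1) * pi / 2 ^+ m.+2); last first.
    by rewrite -natr1 !exprS; field; rewrite gt_eqF// exprn_gt0.
  by rewrite sinB sinpi cospi mul0r sub0r mulN1r opprK.
rewrite (exprS (4 : R) m); lra.
Qed.

Lemma sin_le_id (x : R) : 0 < x -> sin x <= x.
Proof.
move=> x0.
have [c _] := MVT_fun (ltW x0) (fun y _ => @is_derive_sin R y).
rewrite sin0 !subr0 => ->; rewrite ler_piMl ?(ltW x0)//; exact: cos_le1.
Qed.

Lemma mulr_cos_le_sin (x : R) : 0 < x -> x < pi -> x * cos x <= sin x.
Proof.
move=> x0 xpi; pose f (t : R) := sin t - t * cos t.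
have dfE (t : R) : is_derive t (1:R) f (t * sin t).
  have h := is_deriveB_fun (@is_derive_sin R t) (is_deriveM_fun (is_derive_id t 1) (@is_derive_cos R t)).
  by apply: (is_derive_eq h); rewrite mulr1 opprD mulrN opprK addrC subrK.
have [c /andP[c0 cx]] := MVT_fun (ltW x0) (fun y _ => dfE y).
rewrite /f sin0 mul0r !subr0 -subr_ge0 => ->.
rewrite mulr_ge0 ?(ltW x0)// mulr_ge0// sin_ge0_pi// c0/= (le_trans cx)// ltW//.
Qed.

(** This is [sin x <= x <= tan x], since [1 / sin^2 x - 1 = 1 / tan^2 x]. *)
Lemma inv_sqr_bounds (x : R) : 0 < x -> x < pi / 2 ->
  sin x ^- 2 - 1 <= x ^- 2 <= sin x ^- 2.
Proof.
move=> x0 xp; have pp := @pi_gt0 R.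
have s0 : 0 < sin x by apply: sin_gt0_pi; apply/andP; split=> //; lra.
have c0 : 0 < cos x by apply: cos_gt0_pihalf; apply/andP; split=> //; lra.
have h1 := sin_le_id x0.
have h2 : x * cos x <= sin x by apply: mulr_cos_le_sin => //; lra.
apply/andP; split; last first.
  by rewrite lef_pV2 ?posrE ?exprn_gt0// lerXn2r ?nnegrE ?(ltW s0) ?(ltW x0).
have E := cos2Dsin2 x.
rewrite (_ : sin x ^- 2 - 1 = cos x ^+ 2 / sin x ^+ 2); last first.
  by rewrite -(addrK (sin x ^+ 2) (cos x ^+ 2)) E; field; rewrite gt_eqF.
rewrite ler_pdivrMr ?exprn_gt0// mulrC ler_pdivlMr ?exprn_gt0//.
by rewrite -exprMn lerXn2r ?nnegrE ?mulr_ge0 ?(ltW s0) ?(ltW x0) ?(ltW c0)// mulrC.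
Qed.

(** Each of the [2^m] terms of [sum_inv_sin2_half] exceeds the inverse square of its
angle by at most 1, which is negligible against the total [2 * 4^m]. *)
Lemma odd_sum_bounds m : pi ^+ 2 / 8 - pi ^+ 2 / 16 * 2 ^- m <=
  \sum_(0 <= k < 2 ^ m) ((2 * k%:R + 1) ^- 2 : R) <= pi ^+ 2 / 8.
Proof.
set O := \sum_(0 <= k < _) _; have pp := @pi_gt0 R.
pose x k : R := (2 * k%:R + 1) * pi / 2 ^+ m.+2.
have p0 : 0 < (2 : R) ^+ m by rewrite exprn_gt0.
have hx k : (k < 2 ^ m)%N -> 0 < x k /\ x k < pi / 2.
  move=> km; have kR : (k%:R + 1 <= 2 ^+ m :> R) by rewrite natr1 -natrX ler_nat.
  have k0 : 0 <= k%:R :> R by [].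
  rewrite /x; split; first by rewrite divr_gt0 ?exprn_gt0// mulr_gt0//; lra.
  rewrite ltr_pdivrMr ?exprn_gt0// mulrC -mulrA ltr_pM2l// !exprS; lra.
have xE : \sum_(0 <= k < 2 ^ m) x k ^- 2 = 16 * 4 ^+ m / pi ^+ 2 * O.
  rewrite /O mulr_sumr; apply: eq_big_nat => k /andP[_ km].
  have k0 : 0 <= k%:R :> R by [].
  have -> : (4 : R) ^+ m = 2 ^+ m * 2 ^+ m by rewrite -exprMn; congr (_ ^+ _); lra.
  by rewrite /x !exprS; field; rewrite !gt_eqF//; lra.
have S := sum_inv_sin2_half m.
have up : 16 * 4 ^+ m / pi ^+ 2 * O <= 2 * 4 ^+ m.
  rewrite -xE -S !big_mkord; apply: ler_sum => k _.
  by have [h1 h2] := hx k (ltn_ord k); have /andP[] := inv_sqr_bounds h1 h2.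
have lo : 2 * 4 ^+ m - 2 ^+ m <= 16 * 4 ^+ m / pi ^+ 2 * O.
  rewrite -xE -S (_ : 2 ^+ m = \sum_(0 <= k < 2 ^ m) 1); last first.
    by rewrite sumr_const_nat subn0 -natrX.
  rewrite -sumrB !big_mkord; apply: ler_sum => k _.
  by have [h1 h2] := hx k (ltn_ord k); have /andP[] := inv_sqr_bounds h1 h2.
have q0 : 0 < (4 : R) ^+ m by rewrite exprn_gt0.
have c0 : 0 < (16 * 4 ^+ m / pi ^+ 2 : R) by rewrite divr_gt0 ?exprn_gt0// mulr_gt0.
rewrite -(ler_pM2l c0) -[X in _ && X](ler_pM2l c0); apply/andP; split.
  apply: le_trans lo; rewrite le_eqVlt; apply/orP; left; apply/eqP.
  have -> : (4 : R) ^+ m = 2 ^+ m * 2 ^+ m by rewrite -exprMn; congr (_ ^+ _); lra.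
  move: pp p0; clear; generalize (@pi R) => p pp p0.
  by field; rewrite !gt_eqF.
apply: (le_trans up); rewrite le_eqVlt; apply/orP; left; apply/eqP.
move: pp q0; clear; generalize (@pi R) => p pp q0.
by field; rewrite gt_eqF.
Qed.

(** The odd integers contribute [pi^2 / 8] to the sum of inverse squares, and the
even ones a quarter of the whole sum. *)
Lemma trigamma1 : trigamma (1 : R) = pi ^+ 2 / 6.
Proof.
pose s n : R := \sum_(0 <= k < n) (1 + k%:R) ^- 2.
pose O m : R := \sum_(0 <= k < 2 ^ m) (2 * k%:R + 1) ^- 2.
have cs : s n @[n --> \oo] --> trigamma (1 : R) by exact: cvg_trigamma.
have c2 : (2 ^ m)%N @[m --> \oo] --> \oo.
  apply/cvgnyPge => N; near=> m; apply: (@leq_trans m); first by near: m; exact: nbhs_infty_ge.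
  exact: ltnW (ltn_expl _ _).
have s1 : s (2 ^ m)%N @[m --> \oo] --> trigamma (1 : R) by exact: (cvg_comp _ _ c2 cs).
have s2 : s (2 ^ m.+1)%N @[m --> \oo] --> trigamma (1 : R).
  by rewrite (cvg_shiftS (fun m => s (2 ^ m)%N)).
have E m : s (2 ^ m.+1)%N = O m + s (2 ^ m)%N / 4.
  rewrite /s expnS mul2n sumr_nat_double big_split/= mulr_suml; congr (_ + _).
    by apply: eq_bigr => k _; rewrite -muln2 natrM; congr (_ ^- 2); lra.
  apply: eq_bigr => k _; rewrite -addn1 -muln2 natrD natrM.
  have k0 : 0 <= k%:R :> R by [].
  by field; rewrite !gt_eqF//; lra.
have cO : O m @[m --> \oo] --> (pi ^+ 2 / 8 : R).
  apply: (@squeeze_cvgr _ _ _ _ (fun m => pi ^+ 2 / 8 - pi ^+ 2 / 16 * 2 ^- m) (cst (pi ^+ 2 / 8))).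
  - by apply: nearW => m; exact: odd_sum_bounds.
  - rewrite -[X in _ --> X]subr0 -[X in _ - X](mulr0 (pi ^+ 2 / 16)); apply: cvgB; first exact: cvg_cst.
    by apply: cvgM; [exact: cvg_cst|exact: cvg_halfpow].
  - exact: cvg_cst.
have s3 : O m + s (2 ^ m)%N / 4 @[m --> \oo] --> pi ^+ 2 / 8 + trigamma (1 : R) / 4.
  by apply: cvgD => //; apply: cvgM => //; exact: cvg_cst.
rewrite (funext E) in s2.
have : trigamma (1 : R) = pi ^+ 2 / 8 + trigamma (1 : R) / 4.
  exact: (cvg_unique (@Rhausdorff R) s2 s3).
lra.
Unshelve. all: by end_near. Qed.

Lemma trigamma1_gt0 : 0 < trigamma (1 : R).
Proof. by rewrite trigamma1 divr_gt0// exprn_gt0// pi_gt0. Qed.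

End basel.

(** * The closed form at the ends of the temperature range *)

Section asymptotics.
Context {R : realType}.

(** Two terms of the series and [trigamma_le] at 3 suffice, so that no numerical
bound on [pi] is involved. *)
Lemma trigamma1_lt2 : trigamma (1 : R) < 2.
Proof.
rewrite trigammaS// trigammaS; last lra.
have h3 : 1 < 1 + 1 + 1 :> R by lra.
have := trigamma_le h3; rewrite expr1n invr1.
have -> : (1 + 1 + 1 - 1 : R)^-1 = 1 / 2 by field.
have -> : (1 + 1 : R) ^- 2 = 1 / 4 by field.
lra.
Qed.

Lemma cvg_zeta3 : \sum_(0 <= k < n) (1 + k%:R : R) ^- 3 @[n --> \oo] --> zeta (3 : R).
Proof.
have E : series (riemannR (3 : R)) = fun n => \sum_(0 <= k < n) (1 + k%:R : R) ^- 3.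
  apply/funext => n; rewrite /series/=; apply: eq_bigr => k _.
  by rewrite /riemannR/= -natr1 addrC powR_mulrn// addr_ge0.
rewrite /zeta E; apply: nondecreasing_is_cvgn.
  move=> n m nm; rewrite (@big_cat_nat _ _ _ n 0 m _ _ (leq0n n) nm)/= lerDl sumr_ge0//.
exists (trigamma (1 : R)) => _ [n _ <-].
apply: le_trans (trigamma_sum_le n ltr01); apply: ler_sum => k _.
have k1 : (1 : R) <= 1 + k%:R by rewrite lerDl.
have k0 : (0 : R) < 1 + k%:R by lra.
by rewrite lef_pV2 ?posrE ?exprn_gt0//; exact: ler_weXn2l.
Qed.

Lemma zeta3_ge1 : 1 <= zeta (3 : R).
Proof.
rewrite -(cvg_lim (@Rhausdorff R) cvg_zeta3); apply: limr_ge.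
  by apply/cvg_ex; eexists; exact: cvg_zeta3.
near=> n; have n0 : (0 < n)%N by near: n; exact: nbhs_infty_gt.
rewrite -(prednK n0) big_nat_recl// addr0 expr1n invr1 lerDl sumr_ge0//.
Unshelve. all: by end_near. Qed.

(** The expansion is made term by term in the trigamma series: the remainder of
[(m - a)^-2] at order one is bounded by [12 a^2 m^-2], and these bounds are
summed by [trigamma1_lt2]. *)
Lemma trigamma_expansion (a : R) : 0 <= a <= 1 / 2 ->
  0 <= trigamma (1 - a) - trigamma 1 - 2 * a * zeta 3 <= 24 * a ^+ 2.
Proof.
move=> /andP[a0 a1].
have x0 : 0 < 1 - a by lra.
pose e k : R := ((1 - a) + k%:R) ^- 2 - (1 + k%:R) ^- 2 - 2 * a * (1 + k%:R) ^- 3.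
have ce : \sum_(0 <= k < n) e k @[n --> \oo] --> trigamma (1 - a) - trigamma 1 - 2 * a * zeta (3 : R).
  have -> : (fun n => \sum_(0 <= k < n) e k) = fun n =>
      \sum_(0 <= k < n) ((1 - a) + k%:R) ^- 2 - \sum_(0 <= k < n) (1 + k%:R) ^- 2 -
      2 * a * \sum_(0 <= k < n) (1 + k%:R) ^- 3.
    by apply/funext => n; rewrite mulr_sumr -!sumrB.
  apply: cvgB; first by apply: cvgB; exact: cvg_trigamma.
  by apply: cvgM; [exact: cvg_cst|exact: cvg_zeta3].
have eb k : 0 <= e k <= 12 * a ^+ 2 * (1 + k%:R) ^- 2.
  have k0 : (0 : R) <= k%:R by [].
  rewrite /e; set m := 1 + k%:R.
  have m1 : 1 <= m by rewrite /m; lra.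
  have -> : 1 - a + k%:R = m - a by rewrite /m; lra.
  have ma : 0 < m - a by lra.
  have m0 : 0 < m by lra.
  have -> : (m - a) ^- 2 - m ^- 2 - 2 * a * m ^- 3 = a ^+ 2 * (3 * m - 2 * a) / (m ^+ 3 * (m - a) ^+ 2).
    by field; rewrite !gt_eqF.
  have d0 : 0 < m ^+ 3 * (m - a) ^+ 2 by rewrite mulr_gt0 ?exprn_gt0.
  apply/andP; split.
    by apply: divr_ge0; [apply: mulr_ge0; [exact: sqr_ge0|lra]|exact: ltW].
  rewrite ler_pdivrMr//.
  have -> : 12 * a ^+ 2 * m ^- 2 * (m ^+ 3 * (m - a) ^+ 2) = a ^+ 2 * (12 * m * (m - a) ^+ 2).
    by field; rewrite gt_eqF.
  rewrite ler_wpM2l ?sqr_ge0//.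
  have h : m ^+ 2 / 4 <= (m - a) ^+ 2 by nra.
  have h2 : 12 * m * (1 / 4) <= 12 * m * (m - a) ^+ 2.
    by rewrite ler_wpM2l//; nra.
  lra.
have T2 := trigamma1_lt2.
have sb n : 0 <= \sum_(0 <= k < n) e k <= 24 * a ^+ 2.
  apply/andP; split; first by apply: sumr_ge0 => k _; have /andP[] := eb k.
  apply: (@le_trans _ _ (12 * a ^+ 2 * \sum_(0 <= k < n) (1 + k%:R) ^- 2)).
    by rewrite mulr_sumr; apply: ler_sum => k _; have /andP[] := eb k.
  apply: (@le_trans _ _ (12 * a ^+ 2 * 2)); last lra.
  rewrite ler_wpM2l ?mulr_ge0 ?sqr_ge0//.
  exact: le_trans (trigamma_sum_le n ltr01) (ltW T2).
rewrite -(cvg_lim (@Rhausdorff R) ce); apply/andP; split.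
  apply: limr_ge; first by apply/cvg_ex; eexists; exact: ce.
  by apply: nearW => n; have /andP[] := sb n.
apply: limr_le; first by apply/cvg_ex; eexists; exact: ce.
by apply: nearW => n; have /andP[] := sb n.
Qed.

Definition kappa_formula (b : R) : R :=
  2^-1 * (1 / (b ^+ 2 - 1) + 6 / (pi ^+ 2 * b ^+ 3 * (b + 1)) * trigamma ((b - 1) / b)
    - b ^+ 2 / (b ^+ 2 - 1) ^+ 2).

(** By [trigammaS] the pole of trigamma at 0 contributes [b^2 / (b - 1)^2], and the
rest of the series stays between 0 and 2; the quotient is thus squeezed between
two rational functions of [b]. *)
Lemma kappa_formula_at1 :
  kappa_formula b / ((3 / (2 * pi ^+ 2) - 1 / 8) * (1 / (b - 1) ^+ 2)) @[b --> 1^'+] --> (1 : R).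
Proof.
have pp := @pi_gt0 R.
have p2 : 0 < pi ^+ 2 :> R by rewrite exprn_gt0.
have p12 : (pi ^+ 2 : R) < 12 by have := trigamma1_lt2; rewrite trigamma1; lra.
pose c : R := 3 / (2 * pi ^+ 2) - 1 / 8.
have c0 : 0 < c.
  rewrite /c subr_gt0 ltr_pdivlMr ?mulr_gt0//; lra.
(* The quotient, where t is the value of trigamma at (b - 1) / b + 1. *)
pose L (b t : R) : R := 2^-1 * ((b - 1) / (b + 1) +
  6 / (pi ^+ 2 * b ^+ 3 * (b + 1)) * (b ^+ 2 + (b - 1) ^+ 2 * t) - b ^+ 2 / (b + 1) ^+ 2) / c.
have cL t : L b t @[b --> 1^'+] --> (1 : R).
  have L1 : L 1 t = 1.
    rewrite /L (_ : 2^-1 * _ = c) ?divff ?gt_eqF//.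
    rewrite /c; move: pp; clear; generalize (@pi R) => p pp.
    by field; rewrite !gt_eqF//; lra.
  rewrite -[X in _ --> X]L1; apply: cvg_at_right_filter.
  have cb : b @[b --> (1:R)] --> (1:R) by exact: cvg_id.
  have cK (k : R) : k @[b --> (1:R)] --> k by exact: cvg_cst.
  have cb1 : b + 1 @[b --> (1:R)] --> (1 + 1 : R) by exact: cvgD.
  have cbm : b - 1 @[b --> (1:R)] --> (1 - 1 : R) by exact: cvgB.
  have cb2 : b ^+ 2 @[b --> (1:R)] --> (1:R) ^+ 2 by exact: exprn_continuous.
  have cb3 : b ^+ 3 @[b --> (1:R)] --> (1:R) ^+ 3 by exact: exprn_continuous.
  have cbm2 : (b - 1) ^+ 2 @[b --> (1:R)] --> (1 - 1 : R) ^+ 2 by exact: (cvg_comp _ _ cbm (@exprn_continuous R 2 _)).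
  have cb12 : (b + 1) ^+ 2 @[b --> (1:R)] --> (1 + 1 : R) ^+ 2 by exact: (cvg_comp _ _ cb1 (@exprn_continuous R 2 _)).
  apply: cvgM; last exact: cK.
  apply: cvgM; first exact: cK.
  apply: cvgB; last first.
    by apply: cvgM => //; apply: cvgV => //; rewrite gt_eqF//; lra.
  apply: cvgD.
    by apply: cvgM => //; apply: cvgV => //; rewrite gt_eqF//; lra.
  apply: cvgM.
    apply: cvgM; first exact: cK.
    apply: cvgV; first by rewrite gt_eqF//; nra.
    by apply: cvgM => //; apply: cvgM => //; exact: cK.
  by apply: cvgD => //; apply: cvgM => //; exact: cK.
apply: (@squeeze_cvgr _ _ _ _ (L ^~ 0) (L ^~ 2)) => //.
near=> b.
have b1 : 1 < b by near: b; exact: nbhs_right_gt.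
have E : kappa_formula b / ((3 / (2 * pi ^+ 2) - 1 / 8) * (1 / (b - 1) ^+ 2)) =
    L b (trigamma ((b - 1) / b + 1)).
  have bb : 0 < (b - 1) / b by rewrite divr_gt0//; lra.
  rewrite /kappa_formula trigammaS// -/c /L; set t := trigamma _.
  clear -b1 bb pp c0; clearbody c t; move: pp; generalize (@pi R) => p pp.
  by field; rewrite !gt_eqF//; nra.
have t0 : 0 <= trigamma ((b - 1) / b + 1).
  apply: trigamma_ge0; rewrite addr_gt0// divr_gt0//; lra.
have t2 : trigamma ((b - 1) / b + 1) <= 2.
  apply: (le_trans _ (ltW trigamma1_lt2)); apply: trigamma_nincr => //.
  by rewrite lerDr divr_ge0//; lra.
rewrite E; have mono (u v : R) : u <= v -> L b u <= L b v.
  move=> uv; rewrite /L ler_pM2r ?invr_gt0// ler_pM2l ?invr_gt0// lerD2r lerD2l ler_wpM2l//.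
    by rewrite divr_ge0// mulr_ge0//; [rewrite mulr_ge0 ?exprn_ge0//; lra|lra].
  by rewrite lerD2l ler_wpM2l// sqr_ge0.
by rewrite !mono.
Unshelve. all: by end_near. Qed.

(** In the closed form the terms of order less than 5 in [1/b] cancel, because
[6 / pi^2 * trigamma 1 = 1]; the bounds of [trigamma_expansion] squeeze what is
left. *)
Lemma kappa_formula_aty :
  kappa_formula b / ((6 / pi ^+ 2 * zeta 3 - 1 / 2) * (1 / b ^+ 5)) @[b --> +oo] --> (1 : R).
Proof.
have pp := @pi_gt0 R.
have p2 : 0 < pi ^+ 2 :> R by rewrite exprn_gt0.
have p12 : (pi ^+ 2 : R) < 12 by have := trigamma1_lt2; rewrite trigamma1; lra.
have z1 := zeta3_ge1.
pose z : R := zeta 3.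
pose c : R := 6 / pi ^+ 2 * z - 1 / 2.
have c0 : 0 < c.
  have h : 1 / 2 < 6 / pi ^+ 2 :> R by rewrite ltr_pdivlMr//; lra.
  have := ler_wpM2l (ltW (lt_trans _ h)) z1; rewrite /c -/z => /(_ ltac:(lra)); lra.
(* The quotient as a function of t = 1 / b, where s is b^2 times the remainder. *)
pose L (s t : R) : R := 2^-1 * ((- 1 - t + t ^+ 2) / (1 - t ^+ 2) ^+ 2 +
  (12 * z + 6 * s * t) / (pi ^+ 2 * (1 + t))) / c.
have cL s : L s (b^-1) @[b --> +oo] --> (1 : R).
  have cV : b^-1 @[b --> +oo] --> (0 : R).
    by rewrite gtr0_cvgV0; [exact: cvg_id|exact: nbhs_pinfty_gt].
  have L0 : L s 0 = 1.
    rewrite /L (_ : 2^-1 * _ = c) ?divff ?gt_eqF//.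
    rewrite /c; move: pp; clear; generalize (@pi R) => p pp.
    by field; rewrite !gt_eqF//; lra.
  rewrite -[X in _ --> X]L0; apply: (cvg_comp _ _ cV).
  have cb : b @[b --> (0:R)] --> (0:R) by exact: cvg_id.
  have cK (k : R) : k @[b --> (0:R)] --> k by exact: cvg_cst.
  have cb2 : b ^+ 2 @[b --> (0:R)] --> (0:R) ^+ 2 by exact: exprn_continuous.
  have cd : (1 - b ^+ 2) ^+ 2 @[b --> (0:R)] --> (1 - 0 ^+ 2 : R) ^+ 2.
    have cd1 : 1 - b ^+ 2 @[b --> (0:R)] --> (1 - 0 ^+ 2 : R) by exact: cvgB.
    by exact: (cvg_comp _ _ cd1 (@exprn_continuous R 2 _)).
  apply: cvgM; last exact: cK.
  apply: cvgM; first exact: cK.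
  apply: cvgD.
    apply: cvgM; first by apply: cvgD => //; apply: cvgB => //; exact: cK.
    by apply: cvgV => //; rewrite gt_eqF//; lra.
  apply: cvgM.
    by apply: cvgD; [exact: cK|apply: cvgM => //; exact: cK].
  apply: cvgV; first by rewrite gt_eqF//; nra.
  by apply: cvgM; [exact: cK|apply: cvgD => //; exact: cK].
apply: (@squeeze_cvgr _ _ _ _ (fun b => L 0 b^-1) (fun b => L 24 b^-1)) => //.
near=> b.
have b2 : 2 < b by near: b; apply: nbhs_pinfty_gt; exact: num_real.
have b0 : 0 < b by lra.
pose r := trigamma ((b - 1) / b) - trigamma 1 - 2 * b^-1 * zeta 3.
have /andP[r0 r1] : 0 <= r <= 24 * b^-1 ^+ 2.
  rewrite /r (_ : (b - 1) / b = 1 - b^-1); last by field; rewrite gt_eqF.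
  apply: trigamma_expansion; rewrite invr_ge0 ltW//= div1r lef_pV2 ?posrE//; lra.
have E : kappa_formula b / ((6 / pi ^+ 2 * zeta 3 - 1 / 2) * (1 / b ^+ 5)) = L (r * b ^+ 2) b^-1.
  rewrite /kappa_formula -/z -/c.
  have -> : trigamma ((b - 1) / b) = r + pi ^+ 2 / 6 + 2 * b^-1 * z.
    by rewrite /r trigamma1 -/z; ring.
  rewrite /L; clear -b2 pp c0; clearbody c r z; move: pp; generalize (@pi R) => p pp.
  by field; rewrite !gt_eqF//; nra.
rewrite E; have mono (u v : R) : u <= v -> L u b^-1 <= L v b^-1.
  move=> uv; rewrite /L ler_pM2r ?invr_gt0// ler_pM2l ?invr_gt0// lerD2l ler_wpM2r//.
    by rewrite invr_ge0 mulr_ge0// ltW// addr_gt0// invr_gt0.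
  by rewrite lerD2l -!mulrA ler_wpM2l// ler_wpM2r// invr_ge0 ltW.
rewrite !mono//.
  by move: r1; rewrite exprVn ler_pdivlMr ?exprn_gt0.
by rewrite mulr_ge0// sqr_ge0.
Unshelve. all: by end_near. Qed.

End asymptotics.

(** * The partition function *)

Section partition_function.
Local Open Scope ereal_scope.
Context d (T : measurableType d) (R : realType) (P : probability T R)
  (xi : nat -> {RV P >-> R}).
Hypothesis hxi : is_poisson_point_process rem_intensity xi.
Let mu := @lebesgue_measure R.

Let wgt (b x : R) : R := expR (b * x).

Lemma ZE_psum b : Z xi b = psum xi (wgt b). Proof. by []. Qed.

Lemma continuous_wgt b : continuous (wgt b).
Proof.
move=> x; apply: (@continuous_comp _ _ _ (fun x => b * x)%R expR); last exact: continuous_expR.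
by apply: cvgM; [exact: cvg_cst|exact: cvg_id].
Qed.

Lemma measurable_wgt b : measurable_fun setT (wgt b).
Proof. apply: continuous_measurable_fun; exact: continuous_wgt. Qed.

Lemma wgt_ge0 b x : (0 <= wgt b x)%R. Proof. exact: expR_ge0. Qed.

Lemma measurable_Z b : measurable_fun setT (Z xi b).
Proof. by rewrite ZE_psum; apply: measurable_psum; [exact: measurable_wgt|exact: wgt_ge0]. Qed.

Lemma Z_gt0 b w : 0 < Z xi b w.
Proof.
have /lt_le_trans : 0 < (wgt b (xi 0%N w))%:E by rewrite lte_fin expR_gt0.
apply; rewrite ZE_psum /psum (@nneseriesD1 _ _ 0%N xpredT)//; last first.
  by move=> k _; rewrite lee_fin wgt_ge0.
by rewrite leeDl// nneseries_ge0// => k _ _; rewrite lee_fin wgt_ge0.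
Qed.

Let phi_int (b : R) (y : R) : R := ((1 - expR (- wgt b y)) * expR (- y))%R.
(** The constant of the Laplace transform of [Z b]: shifting the atoms shows that
[E (exp (- e^s Z b)) = exp (- e^(s/b) phi b)]. *)
Definition phi (b : R) : R := \int[mu]_y phi_int b y.

Lemma continuous_phi_int b : continuous (phi_int b).
Proof.
move=> y; apply: cvgM.
  apply: cvgB; first exact: cvg_cst.
  apply: (@continuous_comp _ _ _ (fun y => - wgt b y)%R expR); last exact: continuous_expR.
  by apply: cvgN; exact: continuous_wgt.
apply: (@continuous_comp _ _ _ (fun y => - y)%R expR); last exact: continuous_expR.
by apply: cvgN; exact: cvg_id.
Qed.

Lemma phi_int_ge0 b y : (0 <= phi_int b y)%R.
Proof.
by rewrite mulr_ge0 ?expR_ge0// subr_ge0 -expR0 ler_expR oppr_le0 wgt_ge0.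
Qed.

(** The integrand is at most [e^-y], and at most [e^((b - 1) y)] because
[1 - e^-t <= t]; the latter decays at [-oo] precisely because [b > 1]. *)
Lemma integrable_phi b : (1 < b)%R -> mu.-integrable setT (EFin \o phi_int b).
Proof.
move=> b1; pose c := Num.min (b - 1)%R 1%R.
have c0 : (0 < c)%R by rewrite lt_min subr_gt0 b1 ltr01.
have cb : (c <= b - 1)%R by rewrite ge_min lexx.
have c1 : (c <= 1)%R by rewrite ge_min lexx orbT.
apply: (@le_integrable _ _ _ mu _ measurableT _ _ _ _ (integrable_expNabs c0)).
  by apply/measurable_EFinP; apply: continuous_measurable_fun; exact: continuous_phi_int.
move=> y _ /=; rewrite lee_fin (ger0_norm (expR_ge0 _)) ger0_norm ?phi_int_ge0//.
have e0 := expR_ge0 (- wgt b y)%R.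
have [y0|y0] := leP 0%R y.
  rewrite ger0_norm//; apply: (@le_trans _ _ (1 * expR (- y)))%R.
    by rewrite ler_wpM2r ?expR_ge0//; lra.
  by rewrite mul1r ler_expR lerN2 ler_piMl.
rewrite ltr0_norm//.
apply: (@le_trans _ _ (wgt b y * expR (- y)))%R.
  rewrite ler_wpM2r ?expR_ge0//; have := expR_ge1Dx (- wgt b y)%R; lra.
rewrite /wgt -expRD ler_expR; nra.
Qed.

Lemma phi_scale b s : (1 < b)%R ->
  \int[mu]_x ((1 - expR (- (expR s * wgt b x))) * expR (- x))%:E =
  (expR (s / b) * phi b)%:E.
Proof.
move=> b1; have b0 : (0 < b)%R by lra.
have h := ge0_integral_affine (s / b) ltr01 (@continuous_phi_int b) (phi_int_ge0 b).
have e : \int[mu]_y (phi_int b y)%:E = (phi b)%:E.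
  by rewrite /phi fineK//; apply: integrable_fin_num => //; exact: integrable_phi.
rewrite EFinM -e h -ge0_integralZl_EFin ?expR_ge0//; last first.
- exact: (measurable_affine_comp _ _ (@continuous_phi_int b)).
- by move=> y _; rewrite lee_fin mul1r phi_int_ge0.
apply: eq_integral => x _; rewrite -EFinM; congr EFin.
rewrite /phi_int /wgt !mul1r.
have -> : (b * (x + s / b) = s + b * x)%R by field; rewrite gt_eqF.
have -> : (expR (- x) = expR (s / b) * expR (- (x + s / b)))%R by rewrite -expRD; congr expR; ring.
by rewrite expRD mulrCA.
Qed.

Lemma laplace_Z b s : (1 < b)%R ->
  \int[P]_w (expN ((expR s)%:E * Z xi b w))%:E = (expR (- (expR (s / b) * phi b)))%:E.
Proof.
move=> b1.
have mf : measurable_fun setT (fun x => expR s * wgt b x)%R.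
  by apply: measurable_funM => //; exact: measurable_wgt.
have f0 x : (0 <= expR s * wgt b x)%R by rewrite mulr_ge0 ?expR_ge0 ?wgt_ge0.
have := laplace_functional hxi mf f0; rewrite phi_scale//= => <-.
apply: eq_integral => w _; congr (expN _)%:E.
rewrite ZE_psum /psum -nneseriesZl//; last by move=> i _; rewrite lee_fin wgt_ge0.
Qed.

Lemma phi_ge0 b : (0 <= phi b)%R.
Proof. by apply: Rintegral_ge0 => // y _; exact: phi_int_ge0. Qed.

(** On the event [Z b = +oo] the variable [exp (- e^s Z b)] vanishes, so the
probability of this event is at most [1 - exp (- e^(s/b) phi b)], which tends to
0 as [s] tends to [-oo]. *)
Lemma Z_fin_ae b : (1 < b)%R -> {ae P, forall w, Z xi b w < +oo}.
Proof.
move=> b1; have b0 : (0 < b)%R by lra.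
pose A := Z xi b @^-1` [set +oo].
have mA : measurable A.
  by rewrite -[X in measurable X]setTI; apply: measurable_Z => //; exact: emeasurable_set1.
suff PA : P A = 0.
  exists A; split => // w /= /negP; rewrite -leNgt leye_eq => /eqP; exact.
have pA : P A \is a fin_num by exact: fin_num_measure.
have key s : (fine (P A) <= expR (s / b) * phi b)%R.
  have : \int[P]_w (expN ((expR s)%:E * Z xi b w))%:E <= \int[P]_w (\1_(~` A) w)%:E.
    apply: ge0_le_integral => //.
    - by move=> w _; rewrite lee_fin expN_ge0.
    - apply/measurable_EFinP; apply: measurableT_comp; first exact: measurable_expN.
      by apply: emeasurable_funM => //; exact: measurable_Z.
    - by apply/measurable_EFinP; apply: measurable_indic; exact: measurableC.
    - move=> w _; rewrite lee_fin indicE.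
      have [Aw|Aw] := pselect (A w).
        by rewrite (_ : Z xi b w = +oo)//= gt0_muley ?lte_fin ?expR_gt0//=.
      by rewrite mem_set// expN_le1// mule_ge0 ?lee_fin ?expR_ge0// ltW// Z_gt0.
  rewrite laplace_Z// integral_indic ?setIT//; last exact: measurableC.
  have PC : P (~` A) = 1 - P A by exact: probability_setC.
  rewrite [X in _ <= X -> _]PC -(fineK pA) -EFinB lee_fin => h.
  have := expR_ge1Dx (- (expR (s / b) * phi b))%R; lra.
rewrite -(fineK pA); congr EFin; apply/eqP; rewrite eq_le fine_ge0// andbT.
rewrite leNgt; apply/negP => p0.
have f1 : (0 < phi b + 1)%R by rewrite ltr_wpDl ?phi_ge0.
(* For this s the bound of key is less than P A / 2. *)
have := key (b * ln (fine (P A) / (2 * (phi b + 1))))%R.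
rewrite mulrAC divff ?gt_eqF// mul1r lnK ?posrE ?divr_gt0// ?mulr_gt0//.
apply/negP; rewrite -ltNge -mulrA gtr_pMr// mulrC ltr_pdivrMr ?mulr_gt0//.
have := phi_ge0 b; lra.
Qed.

Definition Zfine b w : R := fine (Z xi b w).

Lemma Z_fine_ae b : (1 < b)%R -> {ae P, forall w, Z xi b w = (Zfine b w)%:E /\ (0 < Zfine b w)%R}.
Proof.
move=> b1; apply: filterS (Z_fin_ae b1) => w h.
have E : Z xi b w = (Zfine b w)%:E.
  by rewrite /Zfine fineK// ge0_fin_numE// ltW// Z_gt0.
by split => //; rewrite -lte_fin -E Z_gt0.
Qed.

Lemma measurable_Zfine b : measurable_fun setT (Zfine b).
Proof. by apply: measurableT_comp => //; exact: measurable_Z. Qed.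

Lemma Zfine_ge0 b w : (0 <= Zfine b w)%R.
Proof. by rewrite fine_ge0// ltW// Z_gt0. Qed.

(** In the Mecke formula for the weights [e^(b' x)], the substitution
[y = b x + s] makes the intensity integral a value of Gamma. *)
Lemma mecke_Z b b' s : (1 < b)%R -> (1 < b')%R ->
  \int[P]_w (Zfine b' w * expR (- (Zfine b w * expR s)))%:E =
  (Gm 0 ((b' - 1) / b) / b * expR (- ((b' - 1) / b * s)) * expR (- (expR (s / b) * phi b)))%:E.
Proof.
move=> b1 b1'; have b0 : (0 < b)%R by lra.
set p := ((b' - 1) / b)%R; have p0 : (0 < p)%R by rewrite divr_gt0//; lra.
have mf : measurable_fun setT (fun x => expR s * wgt b x)%R.
  by apply: measurable_funM => //; exact: measurable_wgt.
have f0 x : (0 <= expR s * wgt b x)%R by rewrite mulr_ge0 ?expR_ge0 ?wgt_ge0.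
have I : \int[mu]_x (wgt b' x * (expR (- (expR s * wgt b x)) * expR (- x)))%:E =
    (Gm 0 p / b * expR (- (p * s)))%:E.
  have h := ge0_integral_affine s b0 (@continuous_gmo R 0 p) (gmo_ge0 p).
  rewrite (integral_gmo0 p0) in h.
  rewrite -mulrA mulrC EFinM h -ge0_integralZl_EFin; last 4 first.
  - exact: measurableT.
  - by move=> y _; rewrite lee_fin mulr_ge0 ?gmo_ge0// ltW.
  - exact: (measurable_affine_comp _ _ (@continuous_gmo R 0 p)).
  - by rewrite mulr_ge0 ?expR_ge0// invr_ge0 ltW.
  apply: eq_integral => x _; rewrite -EFinM; congr EFin.
  rewrite /gmo expr0 mul1r /wgt.
  have -> : (b^-1 * expR (- (p * s)) * (b * expR (p * (b * x + s) - expR (b * x + s))) =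
      expR (- (p * s)) * expR (p * (b * x + s) - expR (b * x + s)))%R.
    by field; rewrite gt_eqF.
  rewrite -!expRD (addrC (b * x)%R); congr expR.
  by rewrite /p; field; rewrite gt_eqF.
have := campbell_mecke hxi mf f0 (@measurable_wgt b') (@wgt_ge0 b').
rewrite /= I ltry => /(_ erefl); rewrite phi_scale//= -EFinM => Q.
rewrite -[RHS]Q.
apply: ge0_ae_eq_integral => //.
- apply/measurable_EFinP; apply: measurable_funM; first exact: measurable_Zfine.
  apply: measurableT_comp => //; apply: measurable_funN.
  by apply: measurable_funM => //; exact: measurable_Zfine.
- apply: emeasurable_funM; first exact: measurable_Z.
  apply/measurable_EFinP; apply: measurableT_comp; first exact: measurable_expN.
  exact: measurable_psum.
- by move=> w _; rewrite lee_fin mulr_ge0 ?Zfine_ge0 ?expR_ge0.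
- by move=> w _; rewrite mule_ge0 ?psum_ge0 ?lee_fin ?expN_ge0//; exact: wgt_ge0.
- apply: filterS2 (Z_fine_ae b1) (Z_fine_ae b1') => w [Zb _] [Zb' _] _.
  have -> : psum xi (wgt b') w = (Zfine b' w)%:E by [].
  have -> : psum xi (fun x => expR s * wgt b x)%R w = (expR s)%:E * Z xi b w.
    by rewrite ZE_psum /psum -nneseriesZl//; move=> i _; rewrite lee_fin wgt_ge0.
  by rewrite Zb -EFinM/= (mulrC (expR s)) EFinM.
Qed.

End partition_function.

(** * Moments of ratios and logarithms of partition functions *)

Section partition_moments.
Local Open Scope ereal_scope.
Context d (T : measurableType d) (R : realType) (P : probability T R)
  (xi : nat -> {RV P >-> R}).
Hypothesis hxi : is_poisson_point_process rem_intensity xi.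
Let mu := @lebesgue_measure R.

Lemma phi_gt0 b : (1 < b)%R -> (0 < phi b :> R)%R.
Proof.
move=> b1; apply: Rintegral_gt0; first exact: integrable_phi.
move=> x; rewrite mulr_gt0 ?expR_gt0// subr_gt0 -[ltRHS]expR0 ltr_expR oppr_lt0.
exact: expR_gt0.
Qed.

Lemma measurable_ln_Zfine b : measurable_fun setT (fun w => ln (Zfine xi b w)).
Proof. by apply: measurableT_comp; [exact: measurable_ln|exact: measurable_Zfine]. Qed.

(** Integrate [mecke_Z] against [k s * e^s] over [s].  On the left the substitution
[y = s + ln Z(b)] isolates the ratio [Z(b') / Z(b)] and a shift by [ln Z(b)]; on
the right, [y = s / b + L] leaves the Gamma weight of parameter [q].  The ratio
is written as an exponential, which is the form in which it is expanded
later. *)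
Lemma tonelli_Z (k : R -> R) b b' : continuous k -> (forall s, 0 <= k s)%R ->
  (1 < b)%R -> (1 < b')%R ->
  let p := ((b' - 1) / b)%R in let q := (1 - (b' - b))%R in let L := ln (phi b : R) in
  \int[P]_w ((expR (ln (Zfine xi b' w) - ln (Zfine xi b w)))%:E *
             \int[mu]_y (k (y - ln (Zfine xi b w)) * gmo 0 1 y)%:E) =
  (Gm 0 p * expR (- (q * L)))%:E * \int[mu]_y (k (b * (y - L)) * gmo 0 q y)%:E.
Proof.
move=> ck k0 b1 b1' p q L; have b0 : (0 < b)%R by lra.
have f0 := phi_gt0 b1.
have p0 : (0 < p)%R by rewrite divr_gt0//; lra.
pose f (t : T * R) : R := (k t.2 * (Zfine xi b' t.1 * expR (t.2 - Zfine xi b t.1 * expR t.2)))%R.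
have f_ge0 t : (0 <= f t)%R by rewrite !mulr_ge0 ?Zfine_ge0 ?expR_ge0.
have mf : measurable_fun setT f.
  apply: measurable_funM.
    apply: measurableT_comp; last exact: measurable_snd.
    exact: continuous_measurable_fun.
  apply: measurable_funM.
    by apply: measurableT_comp; [exact: measurable_Zfine|exact: measurable_fst].
  apply: measurableT_comp => //; apply: measurable_funB; first exact: measurable_snd.
  apply: measurable_funM.
    by apply: measurableT_comp; [exact: measurable_Zfine|exact: measurable_fst].
  by apply: measurableT_comp => //; exact: measurable_snd.
have mEf : measurable_fun setT (EFin \o f) by apply/measurable_EFinP.
have cG (c : R) : continuous (fun y : R => k (y - c) * gmo 0 1 y)%R.
  move=> y; apply: cvgM; last exact: continuous_gmo.
  apply: (@continuous_comp _ _ _ (fun y => y - c)%R k); last exact: ck.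
  by apply: cvgB; [exact: cvg_id|exact: cvg_cst].
have cH : continuous (fun y : R => k (b * (y - L)) * gmo 0 q y)%R.
  move=> y; apply: cvgM; last exact: continuous_gmo.
  apply: (@continuous_comp _ _ _ (fun y => b * (y - L))%R k); last exact: ck.
  apply: cvgM; first exact: cvg_cst.
  by apply: cvgB; [exact: cvg_id|exact: cvg_cst].
have inner w : Z xi b w = (Zfine xi b w)%:E /\ (0 < Zfine xi b w)%R ->
    Z xi b' w = (Zfine xi b' w)%:E /\ (0 < Zfine xi b' w)%R ->
    \int[mu]_s (f (w, s))%:E =
    (expR (ln (Zfine xi b' w) - ln (Zfine xi b w)))%:E * \int[mu]_y (k (y - ln (Zfine xi b w)) * gmo 0 1 y)%:E.
  move=> [_ zw] [_ zw'].
  have G0 (y : R) : (0 <= k (y - ln (Zfine xi b w)) * gmo 0 1 y)%R.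
    by rewrite mulr_ge0// gmo_ge0.
  rewrite (ge0_integral_affine (ln (Zfine xi b w)) ltr01 (cG _) G0) -ge0_integralZl_EFin; first last.
  - exact: expR_ge0.
  - exact: (measurable_affine_comp _ _ (cG _)).
  - by move=> y _; rewrite lee_fin mul1r.
  - exact: measurableT.
  - apply: eq_integral => s _; rewrite -EFinM; congr EFin.
    rewrite /f /gmo/= expr0 !mul1r addrK.
    rewrite !expRB expRD !lnK ?posrE// (mulrC (Zfine xi b w) (expR s)).
    by field; rewrite (gt_eqF (expR_gt0 _)) gt_eqF.
transitivity (\int[P]_w \int[mu]_s (f (w, s))%:E).
  apply: ge0_ae_eq_integral => //.
  - apply: emeasurable_funM.
      apply/measurable_EFinP; apply: measurableT_comp => //.
      by apply: measurable_funB; exact: measurable_ln_Zfine.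
    pose g (t : T * R) : R := (k (t.2 - ln (Zfine xi b t.1)) * gmo 0 1 t.2)%R.
    have mg : measurable_fun setT (EFin \o g).
      apply/measurable_EFinP; apply: measurable_funM.
        apply: measurableT_comp; first exact: continuous_measurable_fun.
        apply: measurable_funB; first exact: measurable_snd.
        by apply: (measurableT_comp (measurable_ln_Zfine b)); exact: measurable_fst.
      apply: measurableT_comp; last exact: measurable_snd.
      by apply: continuous_measurable_fun; exact: continuous_gmo.
    have g0 t : 0 <= (EFin \o g) t by rewrite lee_fin mulr_ge0// gmo_ge0.
    exact: (measurable_fun_fubini_tonelli_F (m2 := mu) _ mg g0).
  - apply: (measurable_fun_fubini_tonelli_F (m2 := mu) _ mEf).
    by move=> t; rewrite lee_fin.
  - move=> w _; rewrite mule_ge0 ?lee_fin ?expR_ge0// integral_ge0// => y _.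
    by rewrite lee_fin mulr_ge0// gmo_ge0.
  - by move=> w _; rewrite integral_ge0// => s _; rewrite lee_fin.
  - by apply: filterS2 (Z_fine_ae hxi b1) (Z_fine_ae hxi b1') => w h h' _; rewrite inner.
have fE0 t : 0 <= (EFin \o f) t by rewrite lee_fin.
rewrite (fubini_tonelli (m1 := P) (m2 := mu) _ mEf fE0)/=.
have G0 (y : R) : (0 <= k (b * (y - L)) * gmo 0 q y)%R by rewrite mulr_ge0// gmo_ge0.
have bV0 : (0 < b^-1)%R by rewrite invr_gt0.
rewrite (ge0_integral_affine L bV0 cH G0) -ge0_integralZl_EFin; first last.
- by apply: mulr_ge0; [apply: ltW; exact: Gm0_gt0|exact: expR_ge0].
- exact: (measurable_affine_comp _ _ cH).
- by move=> y _; rewrite lee_fin; apply: mulr_ge0 (G0 _); exact: ltW.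
- exact: measurableT.
- apply: eq_integral => s _; rewrite -EFinM.
  transitivity ((k s * expR s)%:E * \int[P]_w (Zfine xi b' w * expR (- (Zfine xi b w * expR s)))%:E).
    rewrite -ge0_integralZl_EFin; first last.
    - by apply: mulr_ge0; [exact: k0|exact: expR_ge0].
    - apply/measurable_EFinP; apply: measurable_funM; first exact: measurable_Zfine.
      apply: measurableT_comp => //; apply: measurable_funN.
      by apply: measurable_funM => //; exact: measurable_Zfine.
    - by move=> w _; rewrite lee_fin mulr_ge0 ?Zfine_ge0 ?expR_ge0.
    - exact: measurableT.
    - apply: eq_integral => w _; rewrite -EFinM; congr EFin.
      rewrite /f/= expRD; ring.
  rewrite mecke_Z// -EFinM; congr EFin.
  have -> : (b * (b^-1 * s + L - L) = s)%R by field; rewrite gt_eqF.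
  rewrite /gmo expr0 mul1r.
  have -> : (expR (b^-1 * s + L) = expR (s / b) * phi b)%R.
    by rewrite (mulrC s) expRD lnK ?posrE.
  transitivity (Gm 0 p / b * k s * expR (s - p * s - expR (s / b) * phi b))%R.
    by rewrite !expRD /p; ring.
  transitivity (Gm 0 p / b * k s * expR (- (q * L) + (q * (b^-1 * s + L) - expR (s / b) * phi b)))%R; last first.
    by rewrite [expR (- (q * L) + _)]expRD; field; rewrite gt_eqF.
  congr (_ * expR _)%R; rewrite /p /q; field; rewrite gt_eqF//.
Qed.

Lemma tonelli_Z_cst b b' : (1 < b)%R -> (1 < b')%R -> (b' - b < 1)%R ->
  \int[P]_w (expR (ln (Zfine xi b' w) - ln (Zfine xi b w)))%:E =
  (Gm 0 ((b' - 1) / b) * expR (- ((1 - (b' - b)) * ln (phi b : R))) * Gm 0 (1 - (b' - b)))%:E.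
Proof.
move=> b1 b1' hlt.
have := @tonelli_Z (cst 1%R) b b' (fun x => cvg_cst _) (fun=> ler01) b1 b1'.
rewrite /=; under [X in _ = _ * X]eq_integral do rewrite mul1r.
rewrite integral_gmo0 ?subr_gt0// -EFinM => <-; apply: eq_integral => w _.
under eq_integral do rewrite mul1r.
by rewrite integral_gmo0// Gm0_1 mule1.
Qed.

(** Take [b' = b] in [tonelli_Z_cst]: the left-hand side is then the total mass 1. *)
Lemma phi_Gm b : (1 < b)%R -> phi b = Gm 0 ((b - 1) / b) :> R.
Proof.
move=> b1; have f0 := phi_gt0 b1; have bb : (b - b < 1)%R by rewrite subrr.
have := tonelli_Z_cst b1 b1 bb.
under eq_integral do rewrite subrr expR0.
have PT : P setT = 1 by exact: probability_setT.
rewrite integral_cst// mul1e [X in X = _ -> _]PT subrr subr0 Gm0_1 mul1r mulr1.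
rewrite expRN lnK ?posrE// => -[] E.
by have := congr1 (fun x => x * phi b)%R E; rewrite divfK ?gt_eqF// mul1r.
Qed.

Lemma expectation_ratio b h : (1 < b)%R -> (1 < b + h)%R -> (h < 1)%R ->
  \int[P]_w (expR (ln (Zfine xi (b + h) w) - ln (Zfine xi b w)))%:E =
  (Gm 0 ((b + h - 1) / b) * expR (- ((1 - h) * ln (Gm 0 ((b - 1) / b) : R))) * Gm 0 (1 - h))%:E.
Proof.
move=> b1 bh1 h1; rewrite tonelli_Z_cst//; last by rewrite addrC addKr.
by rewrite phi_Gm// (addrC b h) addrK.
Qed.

(** The value of [E (log Z(b))] found in [logZ_mean]. *)
Definition mean_ln_Z (b : R) : R := b * ln (Gm 0 ((b - 1) / b)) + (1 - b) * Gm 1 1.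

(** For [b' = b] and [k] a shifted square, [tonelli_Z] compares second moments of
one and the same density [gmo 0 1], shifted by [ln Z(b)] on the left and
stretched by [b] on the right.  As [c] is arbitrary, this contains both the mean
and the variance of [ln Z(b)]. *)
Lemma expectation_ln_Z_sq b c : (1 < b)%R ->
  \int[P]_w ((ln (Zfine xi b w) - c) ^+ 2)%:E =
  ((b ^+ 2 - 1) * trigamma 1 + (mean_ln_Z b - c) ^+ 2)%:E.
Proof.
move=> b1; have b0 : (0 < b)%R by lra.
pose L : R := ln (Gm 0 ((b - 1) / b)); pose m1 : R := Gm 1 1.
(* The shift makes the inner integral equal to trigamma 1 + (ln Z(b) - c)^2. *)
pose k (y : R) : R := ((y + (c - m1)) ^+ 2)%R.
have ck : continuous k.
  move=> y; apply: (@continuous_comp _ _ _ (fun y => y + (c - m1))%R (fun y => y ^+ 2)%R).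
    by apply: cvgD; [exact: cvg_id|exact: cvg_cst].
  exact: exprn_continuous.
have := tonelli_Z ck (fun s => sqr_ge0 _) b1 b1.
rewrite /= phi_Gm// -/L subrr subr0 mul1r.
have G0 : (0 < Gm 0 ((b - 1) / b) :> R)%R by rewrite Gm0_gt0// divr_gt0//; lra.
rewrite expRN lnK ?posrE// divff ?gt_eqF// mul1e.
have shift (u : R) : \int[mu]_y ((y - u) ^+ 2 * gmo 0 1 y)%:E =
    (trigamma 1 + (u - m1) ^+ 2)%:E.
  have [i e] := integral_gmo_shift2 u (@ltr01 R).
  rewrite -[LHS]fineK; last exact: integrable_fin_num.
  congr EFin; rewrite -[LHS]/(Rintegral _ _ _) e /trigamma Gm0_1 -/m1; by field.
have -> : \int[mu]_y (k (b * (y - L)) * gmo 0 1 y)%:E =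
    (b ^+ 2 * (trigamma 1 + (L - (c - m1) / b - m1) ^+ 2))%:E.
  rewrite EFinM -shift -ge0_integralZl_EFin//.
  - apply: eq_integral => y _; rewrite -EFinM; congr EFin; rewrite /k; field.
    by rewrite gt_eqF.
  - by move=> y _; rewrite lee_fin mulr_ge0 ?sqr_ge0 ?gmo_ge0.
  - apply/measurable_EFinP; apply: measurable_funM.
      by apply: measurable_funX; exact: measurable_funB.
    by apply: continuous_measurable_fun; exact: continuous_gmo.
  - exact: sqr_ge0.
have inner w : (expR (ln (Zfine xi b w) - ln (Zfine xi b w)))%:E *
    \int[mu]_y (k (y - ln (Zfine xi b w)) * gmo 0 1 y)%:E =
    (trigamma 1)%:E + ((ln (Zfine xi b w) - c) ^+ 2)%:E.
  rewrite subrr expR0 mul1e -EFinD.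
  have kE (y : R) : k (y - ln (Zfine xi b w))%R = ((y - (ln (Zfine xi b w) - (c - m1))) ^+ 2)%R.
    by rewrite /k; congr (_ ^+ 2)%R; ring.
  under eq_integral do rewrite kE.
  by rewrite shift; congr (_ + _ ^+ 2)%:E; ring.
under eq_integral do rewrite inner.
have mS : measurable_fun setT (fun w => ((ln (Zfine xi b w) - c) ^+ 2)%:E).
  apply/measurable_EFinP; apply: measurable_funX.
  by apply: measurable_funB => //; exact: measurable_ln_Zfine.
have -> : \int[P]_w ((trigamma 1)%:E + ((ln (Zfine xi b w) - c) ^+ 2)%:E) =
    \int[P]_w (trigamma 1)%:E + \int[P]_w ((ln (Zfine xi b w) - c) ^+ 2)%:E.
  apply: ge0_integralD => //.
    by move=> w _; rewrite lee_fin trigamma_ge0.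
  by move=> w _; rewrite lee_fin sqr_ge0.
have PT : P setT = 1 by exact: probability_setT.
rewrite integral_cst// [X in _ * X + _]PT mule1.
case: (integral _ _ _) => [r| |]//; rewrite -EFinD => -[] E.
congr EFin; rewrite (_ : mean_ln_Z b = b * L + (1 - b) * m1)%R//.
apply: (@addrI _ (trigamma 1)); rewrite E; field; rewrite gt_eqF//.
Qed.

End partition_moments.

(** * Expansions of second order *)

Section analysis.
Context {R : realType}.
Implicit Types (f df : R -> R) (u h : R).

Lemma MVT_norm_le f df u (M : R) :
  (forall x, `|x| <= `|u| -> is_derive x (1:R) f (df x)) ->
  (forall x, `|x| <= `|u| -> `|df x| <= M) -> `|f u - f 0| <= M * `|u|.
Proof.
move=> fd dM; have [u0|u0] := leP 0 u.
  have [|c /andP[c0 cu] ->] := @MVT_fun _ f df 0 u u0.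
    by move=> x /andP[x0 xu]; apply: fd; rewrite !ger0_norm// (le_trans x0).
  by rewrite subr0 normrM ler_wpM2r// dM// !ger0_norm.
have [|c /andP[c0 cu] E] := @MVT_fun _ f df u 0 (ltW u0).
  by move=> x /andP[ux x0]; apply: fd; rewrite !ler0_norm ?lerN2// ltW.
rewrite distrC E sub0r normrM normrN ler_wpM2r// dM// !ler0_norm ?lerN2//.
exact: ltW.
Qed.

(** Three applications of the mean value theorem, each of which gains one factor
[|u|]. *)
Lemma expR_taylor2 u : `|u ^+ 2 - 2 * (expR u - 1 - u)| <= 2 * expR `|u| * `|u| ^+ 3.
Proof.
have leE c : `|c| <= `|u| -> `|expR c| <= expR `|u|.
  by move=> cu; rewrite ger0_norm ?expR_ge0// ler_expR (le_trans (ler_norm _)).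
have b1 c : `|c| <= `|u| -> `|expR c - 1| <= expR `|u| * `|u|.
  move=> cu; rewrite -[1]expR0; apply: le_trans (_ : expR `|u| * `|c| <= _).
    apply: (@MVT_norm_le expR expR) => x xc.
    by apply: leE; exact: le_trans cu.
  by rewrite ler_wpM2l ?expR_ge0.
have b2 c : `|c| <= `|u| -> `|expR c - 1 - c| <= expR `|u| * `|u| * `|u|.
  move=> cu; apply: le_trans (_ : expR `|u| * `|u| * `|c| <= _); last first.
    by rewrite ler_wpM2l ?mulr_ge0 ?expR_ge0.
  have -> : expR c - 1 - c = (expR c - c) - (expR 0 - 0) by rewrite expR0; ring.
  apply: (@MVT_norm_le (fun x => expR x - x) (fun x => expR x - 1)) => x xc.
  by apply: b1; exact: le_trans cu.
pose f x : R := 2 * (expR x - x) - x ^+ 2.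
have -> : u ^+ 2 - 2 * (expR u - 1 - u) = - (f u - f 0).
  by rewrite /f expR0; ring.
rewrite normrN exprSr mulrA.
apply: (@MVT_norm_le f (fun x => 2 * (expR x - 1 - x))) => x xu.
  have h := is_deriveB_fun (is_deriveM_fun (is_derive_cst (2:R) x 1)
    (is_deriveB_fun (is_derive_expR x) (is_derive_id x 1)))
    (is_deriveM_fun (is_derive_id x 1) (is_derive_id x 1)).
  by apply: (is_derive_eq h); rewrite /cst; ring.
rewrite normrM ger0_norm// -mulrA ler_wpM2l// expr2 mulrA; exact: b2.
Qed.

Lemma is_derive_quotient f (b a : R) : is_derive b (1:R) f a ->
  (f (b + h) - f b) / h @[h --> (0:R)^'] --> a.
Proof.
move=> [df <-].
have cl : (fun h : R => h^-1 *: ((f \o shift b) (h *: 1) - f b)) @ (0:R)^' --> 'D_1 f b.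
  exact: df.
apply: cvg_trans cl; apply: near_eq_cvg; apply: nearW => h.
by rewrite /= -[h%:A]/(h * 1) mulr1 -[LHS]/(h^-1 * (f (h + b) - f b)) [LHS]mulrC (addrC h).
Qed.

(** Taylor's formula of order 2 when the second derivative exists at 0 only: the
mean value theorem is applied to [f x - a / 2 * x^2], whose derivative is
[o(x)]. *)
Lemma second_order_limit f df (a : R) : f 0 = 0 -> df 0 = 0 ->
  (\forall x \near (0:R), is_derive x (1:R) f (df x)) -> is_derive (0:R) (1:R) df a ->
  f h / h ^+ 2 @[h --> (0:R)^'] --> a / 2.
Proof.
move=> f0 df0 fd dfa.
have dl : h^-1 * df h @[h --> (0:R)^'] --> a.
  have := is_derive_quotient dfa; apply: cvg_trans; apply: near_eq_cvg; apply: nearW => h.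
  by rewrite /= add0r df0 subr0 mulrC.
apply/cvgrPdist_le => e e0; have := dl => /cvgrPdist_le/(_ e e0) h1.
rewrite near_withinE in h1.
have [d /= d0 hd] : exists2 d : R, 0 < d & forall x, `|x| < d ->
    is_derive x (1:R) f (df x) /\ (x != 0 -> `|a - x^-1 * df x| <= e).
  have : \forall x \near (0:R), is_derive x (1:R) f (df x) /\ (x != 0 -> `|a - x^-1 * df x| <= e).
    by apply: filterS2 fd h1 => x; split.
  move=> /nbhs_ballP[d /= d0 hd]; exists d; [exact: d0|move=> x xd; apply: hd].
  by rewrite /ball/= sub0r normrN.
near=> h.
have h0 : h != 0 by near: h; exact: nbhs_dnbhs_neq.
have hlt : `|h| < d by near: h; apply: dnbhs0_lt.
have key : `|(f h - a / 2 * h ^+ 2) - (f 0 - a / 2 * 0 ^+ 2)| <= e * `|h| * `|h|.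
  apply: (@MVT_norm_le (fun x => f x - a / 2 * x ^+ 2) (fun x => df x - a * x)) => x xh.
    have [fx _] := hd x (le_lt_trans xh hlt).
    have H := is_deriveB_fun fx (is_deriveM_fun (is_derive_cst (a / 2) x 1)
      (is_deriveM_fun (is_derive_id x 1) (is_derive_id x 1))).
    by apply: (is_derive_eq H); rewrite /cst; field.
  have [->|x0] := eqVneq x 0; first by rewrite df0 mulr0 subrr normr0 mulr_ge0// ltW.
  have [_ /(_ x0) dx] := hd x (le_lt_trans xh hlt).
  have -> : df x - a * x = - (x * (a - x^-1 * df x)) by field.
  rewrite normrN normrM mulrC ler_pM//.
have -> : a / 2 - f h / h ^+ 2 = - (((f h - a / 2 * h ^+ 2) - (f 0 - a / 2 * 0 ^+ 2)) / h ^+ 2).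
  by rewrite f0; field.
rewrite normrN normrM normfV normrX ler_pdivrMr ?exprn_gt0 ?normr_gt0//.
by move: key; rewrite -(mulrA e) -expr2.
Unshelve. all: by end_near. Qed.

(** The exponential lies above its tangent at the barycentre. *)
Lemma expR_convex (t u v : R) : 0 <= t <= 1 ->
  expR (t * u + (1 - t) * v) <= t * expR u + (1 - t) * expR v.
Proof.
move=> /andP[t0 t1]; set m := t * u + (1 - t) * v.
have hm := expR_ge0 m.
have h x : expR m * (1 + (x - m)) <= expR x.
  by rewrite -[in leRHS](subrK m x) (expRD (x - m)) [leRHS]mulrC ler_wpM2l ?expR_ge1Dx.
have hu := ler_wpM2l t0 (h u).
have t1' : 0 <= 1 - t by rewrite subr_ge0.
have hv := ler_wpM2l t1' (h v).
apply: le_trans (lerD hu hv); rewrite le_eqVlt; apply/orP; left; apply/eqP.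
by rewrite /m; ring.
Qed.

(** With [y] the maximum of [U], [V] and 0, the bounds give [|u| <= r y], so the
remainder of [expR_taylor2] is at most [2 r^3 y^3 e^(y/2)]; the factor [y^3] is
absorbed by a second [e^(y/2)]. *)
Lemma log_ratio_remainder (u r U V : R) : 0 <= r <= 1 / 2 -> - (r * V) <= u <= r * U ->
  `|u ^+ 2 - 2 * (expR u - 1 - u)| <= 2 * 6 ^+ 3 * r ^+ 3 * (expR U + expR V).
Proof.
move=> /andP[r0 r1] /andP[uV uU].
pose y := Num.max 0 (Num.max U V).
have y0 : 0 <= y by rewrite le_max lexx.
have Uy : U <= y by rewrite !le_max lexx orbT.
have Vy : V <= y by rewrite !le_max lexx !orbT.
have ury : `|u| <= r * y.
  rewrite ler_norml; have := ler_wpM2l r0 Uy; have := ler_wpM2l r0 Vy; lra.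
have [ypos|y00] := ltP 0 y; last first.
  have u0 : u = 0.
    apply/eqP; rewrite -normr_le0; apply: le_trans ury _.
    by rewrite (le_anti (introT andP (conj y00 y0))) mulr0.
  rewrite u0 expR0 expr0n/= !subrr mulr0 subrr normr0.
  by rewrite !mulr_ge0 ?exprn_ge0// addr_ge0 ?expR_ge0.
apply: le_trans (expR_taylor2 u) _.
(* This comes from y / 6 <= e^(y/6). *)
have y3 : y ^+ 3 <= 6 ^+ 3 * expR (y / 2).
  have h : y <= 6 * expR (y / 6) by have := expR_ge1Dx (y / 6); lra.
  have -> : expR (y / 2) = expR (y / 6) ^+ 3 by rewrite -expRM_natr; congr expR; field.
  have -> : 6 ^+ 3 * expR (y / 6) ^+ 3 = (6 * expR (y / 6)) ^+ 3 by rewrite exprMn.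
  by rewrite lerXn2r ?nnegrE ?mulr_ge0 ?expR_ge0.
have h1 : expR `|u| <= expR (y / 2) by rewrite ler_expR; apply: le_trans ury _; nra.
have h2 : `|u| ^+ 3 <= r ^+ 3 * (6 ^+ 3 * expR (y / 2)).
  apply: (@le_trans _ _ ((r * y) ^+ 3)).
    by rewrite lerXn2r ?nnegrE ?mulr_ge0.
  by rewrite exprMn ler_wpM2l ?exprn_ge0.
have h3 : expR (y / 2) * expR (y / 2) <= expR U + expR V.
  rewrite -expRD -splitr.
  have [UV|VU] := leP U V.
    have -> : y = V by move: ypos; rewrite /y (max_r UV) maxEle; case: ifP => // _; rewrite ltxx.
    by rewrite lerDr expR_ge0.
  have -> : y = U by move: ypos; rewrite /y (max_l (ltW VU)) maxEle; case: ifP => // _; rewrite ltxx.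
  by rewrite lerDl expR_ge0.
apply: (@le_trans _ _ (2 * expR (y / 2) * (r ^+ 3 * (6 ^+ 3 * expR (y / 2))))).
  by rewrite ler_pM ?mulr_ge0 ?expR_ge0 ?exprn_ge0// ler_wpM2l.
have := ler_wpM2l (exprn_ge0 3 r0) h3.
have := exprn_ge0 3 r0; set q := r ^+ 3; lra.
Qed.

End analysis.

Section ratio_expansion.
Context {R : realType}.
Implicit Types (b c h : R) (k : nat).

Lemma frac_gt0 c : 1 < c -> 0 < (c - 1) / c.
Proof. by move=> c1; rewrite divr_gt0//; lra. Qed.

(** The value of [E (Z(b + h) / Z(b))] found in [expectation_ratio]. *)
Definition mean_ratio b h : R :=
  Gm 0 ((b + h - 1) / b) * expR (- ((1 - h) * ln (Gm 0 ((b - 1) / b)))) * Gm 0 (1 - h).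

Definition dmean_ratio b h : R :=
  (b^-1 * Gm 1 ((b + h - 1) / b) * Gm 0 (1 - h)
   + ln (Gm 0 ((b - 1) / b)) * Gm 0 ((b + h - 1) / b) * Gm 0 (1 - h)
   - Gm 0 ((b + h - 1) / b) * Gm 1 (1 - h)) * expR (- ((1 - h) * ln (Gm 0 ((b - 1) / b)))).

Definition dmean_ln_Z c : R :=
  ln (Gm 0 ((c - 1) / c)) + Gm 1 ((c - 1) / c) / Gm 0 ((c - 1) / c) / c - Gm 1 1.

Lemma is_derive_Gm_ratio k b h : 1 < b -> 1 < b + h ->
  is_derive h (1:R) (fun h => Gm k ((b + h - 1) / b)) (b^-1 * Gm k.+1 ((b + h - 1) / b)).
Proof.
move=> b1 hb.
have H := is_deriveM_fun (is_deriveB_fun (is_deriveD_fun (is_derive_cst b h 1)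
  (is_derive_id h 1)) (is_derive_cst (1:R) h 1)) (is_derive_cst b^-1 h 1).
have p : 0 < (b + h - 1) / b by rewrite divr_gt0//; lra.
have := @is_derive_comp_fun _ (Gm k) (fun h => (b + h - 1) / b) h _ _ (is_derive_Gm k p) H.
move=> /is_derive_eq; apply; rewrite /cst; ring.
Qed.

Lemma is_derive_Gm_rev k h : h < 1 ->
  is_derive h (1:R) (fun h : R => Gm k (1 - h)) (- Gm k.+1 (1 - h)).
Proof.
move=> hb; have p : 0 < 1 - h by lra.
have H := is_deriveB_fun (is_derive_cst (1:R) h 1) (is_derive_id h 1).
have := @is_derive_comp_fun _ (Gm k) (fun h => 1 - h) h _ _ (is_derive_Gm k p) H.
by move=> /is_derive_eq; apply; ring.
Qed.

Lemma is_derive_expR_rev c h :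
  is_derive h (1:R) (fun h => expR (- ((1 - h) * c))) (c * expR (- ((1 - h) * c))).
Proof.
have H := is_derive_expR_fun (is_deriveN_fun (is_deriveM_fun
  (is_deriveB_fun (is_derive_cst (1:R) h 1) (is_derive_id h 1)) (is_derive_cst c h 1))).
by apply: (is_derive_eq H); rewrite /cst; ring.
Qed.

Lemma is_derive_mean_ratio b h : 1 < b -> 1 < b + h -> h < 1 ->
  is_derive h (1:R) (mean_ratio b) (dmean_ratio b h).
Proof.
move=> b1 hb h1.
have H := is_deriveM_fun (is_deriveM_fun (is_derive_Gm_ratio 0 b1 hb)
  (is_derive_expR_rev (ln (Gm 0 ((b - 1) / b))) h)) (is_derive_Gm_rev 0 h1).
apply: (is_derive_eq H); rewrite /dmean_ratio; clear.
by move: (Gm _ _) (Gm _ _) (Gm _ _) (Gm _ _) (Gm _ _) (expR _) => *; ring.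
Qed.

Lemma is_derive_Gm_frac k c : 1 < c ->
  is_derive c (1:R) (fun c : R => Gm k ((c - 1) / c)) (Gm k.+1 ((c - 1) / c) * c ^- 2).
Proof.
move=> c1; have cN : c != 0 by rewrite gt_eqF//; lra.
have H := is_deriveM_fun (is_deriveB_fun (is_derive_id c 1) (is_derive_cst (1:R) c 1))
  (is_derive_inv_fun cN (is_derive_id c 1)).
have := @is_derive_comp_fun _ (Gm k) (fun c => (c - 1) / c) c _ _ (is_derive_Gm k (frac_gt0 c1)) H.
by move=> /is_derive_eq; apply; rewrite /cst; field.
Qed.

Lemma is_derive_mean_ln_Z c : 1 < c -> is_derive c (1:R) (@mean_ln_Z R) (dmean_ln_Z c).
Proof.
move=> c1; have cN : c != 0 by rewrite gt_eqF//; lra.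
have p := Gm0_gt0 (frac_gt0 c1).
have pN : Gm 0 ((c - 1) / c) != 0 by rewrite gt_eqF.
have H := is_deriveD_fun (is_deriveM_fun (is_derive_id c 1) 
    (@is_derive_ln_fun _ (fun c => Gm 0 ((c - 1) / c)) c _ p (is_derive_Gm_frac 0 c1)))
  (is_deriveM_fun (is_deriveB_fun (is_derive_cst (1:R) c 1) (is_derive_id c 1)) (is_derive_cst (Gm 1 1 : R) c 1)).
by apply: (is_derive_eq H); rewrite /dmean_ln_Z /cst; field; rewrite ?cN ?pN.
Qed.

(** The function divided by [h^2] vanishes together with its derivative at 0,
because [E R_h - 1] and [E (log R_h)] have the same derivative there. *)
Lemma variance_rate b : 1 < b ->
  (2 * (mean_ratio b h - 1 - (mean_ln_Z (b + h) - mean_ln_Z b)) -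
    (mean_ln_Z (b + h) - mean_ln_Z b) ^+ 2) / h ^+ 2 @[h --> (0:R)^'] -->
  trigamma 1 + (b - 1) / b ^+ 3 * trigamma ((b - 1) / b).
Proof.
move=> b1; have bN : b != 0 by rewrite gt_eqF//; lra.
pose f (h : R) := 2 * (mean_ratio b h - 1 - (mean_ln_Z (b + h) - mean_ln_Z b)) -
    (mean_ln_Z (b + h) - mean_ln_Z b) ^+ 2.
pose df (h : R) := 2 * (dmean_ratio b h - dmean_ln_Z (b + h)) -
    2 * (mean_ln_Z (b + h) - mean_ln_Z b) * dmean_ln_Z (b + h).
pose x0 := (b - 1) / b; pose g0 : R := Gm 0 x0; pose L := ln g0.
have g0_gt0 : 0 < g0 by exact: Gm0_gt0 (frac_gt0 b1).
have g0N0 : g0 != 0 by rewrite gt_eqF.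
have G01 : Gm 0 (1 - 0) = 1 :> R by rewrite subr0 Gm0_1.
have e0 : expR (- ((1 - 0) * L)) = g0^-1 by rewrite subr0 mul1r expRN lnK.
have xx : (b + 0 - 1) / b = x0 by rewrite addr0.
pose g1 := Gm 1 x0; pose g2 := Gm 2 x0; pose c1 : R := Gm 1 1; pose c2 : R := Gm 2 1.
pose D : R := L + g1 / g0 / b - c1.
have dr0 : dmean_ratio b 0 = D.
  rewrite /dmean_ratio xx G01 -/x0 -/g0 -/L e0 subr0 -/g1 -/c1 /D.
  by field; rewrite bN g0N0.
have dm0 : dmean_ln_Z (b + 0) = D by rewrite addr0.
set v := (X in _ --> X).
have -> : v = (2 * v) / 2 by field.
have near1 : \forall h \near (0:R), 1 < h + b /\ h < 1.
  have n1 := @nbhs0_lt R R 1 ltr01.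
  have b10 : 0 < b - 1 by lra.
  have n2 := @nbhs0_lt R R (b - 1) b10.
  apply: filterS2 n1 n2 => h; rewrite !ltr_norml => /andP[_ h1] /andP[h2 _]; split; lra.
have shift_m h : 1 < h + b -> is_derive h (1:R) (fun h => mean_ln_Z (b + h)) (dmean_ln_Z (b + h)).
  move=> hb; have := is_derive_shift_fun (is_derive_mean_ln_Z hb).
  rewrite (addrC h b).
  by under [X in is_derive _ _ X]eq_fun do rewrite addrC.
apply: (@second_order_limit _ f df).
- rewrite /f addr0 subrr /mean_ratio xx G01 -/x0 -/g0 -/L e0 mulr1 divff//; ring.
- by rewrite /df dr0 dm0 addr0 !subrr mulr0 mul0r subrr.
- apply: filterS near1 => h [hb h1].
  have H1 := is_deriveB_fun (shift_m h hb) (is_derive_cst (mean_ln_Z b) h 1).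
  have hb' : 1 < b + h by rewrite addrC.
  have H2 := is_deriveB_fun (is_derive_mean_ratio b1 hb' h1) (is_derive_cst (1:R) h 1).
  have H := is_deriveB_fun (is_deriveM_fun (is_derive_cst (2:R) h 1) (is_deriveB_fun H2 H1))
    (is_deriveM_fun H1 H1).
  by apply: (is_derive_eq H); rewrite /df /cst; ring.
- have b01 : 1 < b + 0 by rewrite addr0.
  have b10 : 1 < 0 + b by rewrite add0r.
  have R0 k := is_derive_Gm_ratio k b1 b01.
  have S0 k := is_derive_Gm_rev k (@ltr01 R).
  have F0 k := is_derive_Gm_frac k b1.
  have M0 := is_deriveB_fun (shift_m (0:R) b10) (is_derive_cst (mean_ln_Z b) (0:R) 1).
  have dM : is_derive (0:R) (1:R) (fun h => dmean_ln_Z (b + h)) ((g2 / g0 - (g1 / g0) ^+ 2) / b ^+ 3).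
    have : is_derive b (1:R) (@dmean_ln_Z : R -> R) ((g2 / g0 - (g1 / g0) ^+ 2) / b ^+ 3).
      have H := is_deriveB_fun (is_deriveD_fun (@is_derive_ln_fun _ (fun c => Gm 0 ((c - 1) / c)) b _ g0_gt0 (F0 0%N))
        (is_deriveM_fun (is_deriveM_fun (F0 1%N) 
            (@is_derive_inv_fun _ (fun c => Gm 0 ((c - 1) / c)) b _ g0N0 (F0 0%N)))
          (is_derive_inv_fun bN (is_derive_id b 1)))) (is_derive_cst c1 b 1).
      apply: (is_derive_eq H); rewrite -/x0 -/g0 -/g1 -/g2; by field; rewrite bN g0N0.
    rewrite -[X in is_derive X _ _ _](add0r b) => /is_derive_shift_fun.
    by under [X in is_derive _ _ X]eq_fun do rewrite addrC.
  have H := is_deriveM_fun (is_deriveB_fun (is_deriveD_fun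
      (is_deriveM_fun (is_deriveM_fun (is_derive_cst b^-1 (0:R) 1) (R0 1%N)) (S0 0%N))
      (is_deriveM_fun (is_deriveM_fun (is_derive_cst L (0:R) 1) (R0 0%N)) (S0 0%N)))
      (is_deriveM_fun (R0 0%N) (S0 1%N))) (is_derive_expR_rev L (0:R)).
  have K := is_deriveB_fun (is_deriveM_fun (is_derive_cst (2:R) (0:R) 1) (is_deriveB_fun H dM))
    (is_deriveM_fun (is_deriveM_fun (is_derive_cst (2:R) (0:R) 1) M0) dM).
  apply: (is_derive_eq K).
  rewrite /cst dm0 !xx e0 addr0 !subrr !G01 !subr0 -/g0 -/g1 -/g2 -/c1 -/c2 /v /trigamma Gm0_1.
  rewrite -/x0 -/g0 -/g1 -/g2 -/c1 -/c2 /D; clearbody g0 g1 g2 c1 c2 L; clear -bN g0N0.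
  by field; rewrite ?bN ?g0N0.
Unshelve. all: by end_near. Qed.

End ratio_expansion.

(** * Integrals of real random variables *)

Section real_integrals.
Context d (T : measurableType d) (R : realType) (P : probability T R).
Implicit Types (f g : T -> R) (c : R).

Definition rintegrable f := P.-integrable setT (EFin \o f).

Lemma rintegrableD f g : rintegrable f -> rintegrable g -> rintegrable (fun w => f w + g w).
Proof. by move=> hf hg; have := integrableD measurableT hf hg. Qed.

Lemma rintegrableB f g : rintegrable f -> rintegrable g -> rintegrable (fun w => f w - g w).
Proof. by move=> hf hg; have := integrableB measurableT hf hg. Qed.

Lemma rintegrableZ c f : rintegrable f -> rintegrable (fun w => c * f w).
Proof. by move=> hf; have := integrableZl measurableT c hf. Qed.

Lemma rintegrable_cst c : rintegrable (fun=> c).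
Proof. exact: finite_measure_integrable_cst. Qed.

Lemma rintegrable_le f g : measurable_fun setT f -> (forall w, `|f w| <= g w) ->
  rintegrable g -> rintegrable f.
Proof.
move=> mf fg ig; apply: le_integrable ig => //; first exact/measurable_EFinP.
by move=> w _; rewrite /= lee_fin (le_trans (fg w))// ler_norm.
Qed.

Lemma Rintegral_D f g : rintegrable f -> rintegrable g ->
  \int[P]_w (f w + g w) = \int[P]_w f w + \int[P]_w g w.
Proof. exact: RintegralD. Qed.

Lemma Rintegral_B f g : rintegrable f -> rintegrable g ->
  \int[P]_w (f w - g w) = \int[P]_w f w - \int[P]_w g w.
Proof. exact: RintegralB. Qed.

Lemma Rintegral_Z c f : rintegrable f -> \int[P]_w (c * f w) = c * \int[P]_w f w.
Proof. by move=> hf; exact: RintegralZl. Qed.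

Lemma Rintegral_cst1 c : \int[P]_w c = c.
Proof.
have PT : P setT = 1%E by exact: probability_setT.
by rewrite Rintegral_cst// [X in fine X]PT/= mulr1.
Qed.

Lemma rintegrable_ge0 f (r : R) : measurable_fun setT f -> (forall w, 0 <= f w) ->
  (\int[P]_w (f w)%:E)%E = r%:E -> rintegrable f /\ \int[P]_w f w = r.
Proof.
move=> mf f0 E; split; last by rewrite /Rintegral E.
apply/integrableP; split; first exact/measurable_EFinP.
under eq_integral do rewrite /= ger0_norm//.
by rewrite E ltry.
Qed.

Lemma le_normr_Rintegral_ae f g : rintegrable f -> rintegrable g -> (forall w, 0 <= g w) ->
  {ae P, forall w, `|f w| <= g w} -> `|\int[P]_w f w| <= \int[P]_w g w.
Proof.
move=> hf hg g0 fg; apply: le_trans (le_normr_Rintegral _ hf) _ => //.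
rewrite fine_le//.
- apply: integrable_fin_num => //.
  by have := integrable_norm hf.
- exact: integrable_fin_num.
apply: ae_ge0_le_integral => //.
- have := measurable_int _ hf => /measurable_EFinP mf.
  by apply/measurable_EFinP; apply: measurableT_comp.
- by move=> w _; rewrite lee_fin.
- exact: measurable_int hg.
- by apply: filterS fg => w h _; rewrite lee_fin.
Qed.

End real_integrals.

(** * Convexity of the free energy *)

Section convexity.
Context d (T : measurableType d) (R : realType) (P : probability T R)
  (xi : nat -> {RV P >-> R}).
Implicit Types (a b c k r t u v : R) (w : T).

(** Hoelder's inequality, atom by atom: apply [expR_convex] to
[a x - log Z(a)] and [c x - log Z(c)], then sum over the atoms [x]. *)
Lemma logZ_convex a c t w : 0 <= t <= 1 -> (Z xi a w < +oo)%E -> (Z xi c w < +oo)%E ->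
  logZ xi (t * a + (1 - t) * c) w <= t * logZ xi a w + (1 - t) * logZ xi c w.
Proof.
move=> t01 Za Zc; have /andP[t0 t1] := t01.
have zpos b : (Z xi b w < +oo)%E -> Z xi b w = (expR (logZ xi b w))%:E.
  move=> h; have Zb := Z_gt0 xi b w.
  have fin : Z xi b w \is a fin_num by rewrite ge0_fin_numE// ltW.
  by rewrite /logZ lnK ?fineK// posrE -lte_fin fineK.
have mixE (n A' B' p q : R) : expR n * (t * expR (p - A') + (1 - t) * expR (q - B')) =
    expR (n - A') * t * expR p + expR (n - B') * (1 - t) * expR q.
  by rewrite !expRB; field; rewrite !gt_eqF ?expR_gt0.
set A := logZ xi a w; set B := logZ xi c w; set m := _ + _ * B.
have le1 : (Z xi (t * a + (1 - t) * c) w <= (expR m)%:E)%E.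
  have -> : (expR m)%:E = ((expR (m - A) * t)%:E * Z xi a w + (expR (m - B) * (1 - t))%:E * Z xi c w)%E.
    by rewrite (zpos _ Za) (zpos _ Zc) -!EFinM -EFinD -mixE !subrr expR0; congr EFin; ring.
  rewrite /Z -!nneseriesZl; first last.
  - by move=> i _; rewrite lee_fin expR_ge0.
  - by move=> i _; rewrite lee_fin expR_ge0.
  rewrite -nneseriesD; first last.
  - by move=> i _ _; rewrite mule_ge0// lee_fin ?expR_ge0// mulr_ge0 ?expR_ge0// subr_ge0.
  - by move=> i _ _; rewrite mule_ge0// lee_fin ?expR_ge0// mulr_ge0 ?expR_ge0.
  apply: lee_nneseries => [i _ _|i _]; first by rewrite lee_fin expR_ge0.
  set x : R := xi i w; rewrite -!EFinM -EFinD lee_fin.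
  have := expR_convex (a * x - A) (c * x - B) t01.
  move=> /(ler_wpM2l (expR_ge0 m)); rewrite -expRD.
  have -> : m + (t * (a * x - A) + (1 - t) * (c * x - B)) = (t * a + (1 - t) * c) * x.
    by rewrite /m; clearbody A B x; clear; ring.
  by rewrite mixE.
have h := le_lt_trans le1 (ltry _).
by move: le1; rewrite (zpos _ h) lee_fin ler_expR.
Qed.

(** Convexity on the triples [b], [b + r k], [b + k] and [b - k], [b], [b + r k].
The increment [k] may be negative, so that both signs of [h] are covered. *)
Lemma logZ_slope b k r w : 0 <= r <= 1 -> (Z xi b w < +oo)%E ->
  (Z xi (b + k) w < +oo)%E -> (Z xi (b - k) w < +oo)%E -> (Z xi (b + r * k) w < +oo)%E ->
  - (r * (logZ xi (b - k) w - logZ xi b w)) <= logZ xi (b + r * k) w - logZ xi b w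
    <= r * (logZ xi (b + k) w - logZ xi b w).
Proof.
move=> /andP[r0 r1] Zb Zp Zm Zr.
have r01 : 0 <= r <= 1 by rewrite r0.
have h1 := logZ_convex r01 Zp Zb.
have e1 : r * (b + k) + (1 - r) * b = b + r * k by clear; ring.
rewrite e1 in h1.
have t01 : 0 <= r / (1 + r) <= 1.
  by rewrite divr_ge0 ?addr_ge0//= ler_pdivrMr ?mul1r ?lerDr// ltr_pwDl.
have h2 := logZ_convex t01 Zm Zr.
have rN : 1 + r != 0 by rewrite gt_eqF// ltr_pwDl.
have e2 : r / (1 + r) * (b - k) + (1 - r / (1 + r)) * (b + r * k) = b by clear -rN; field.
rewrite e2 in h2.
have h3 : (1 + r) * logZ xi b w <= r * logZ xi (b - k) w + logZ xi (b + r * k) w.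
  have r10 : 0 <= 1 + r by rewrite addr_ge0.
  apply: le_trans (ler_wpM2l r10 h2) _; rewrite le_eqVlt; apply/orP; left; apply/eqP.
  by clear -rN; move: (logZ _ _ _) (logZ _ _ _) => *; field.
move: h1 h3; clear; move: (logZ _ _ _) (logZ _ _ _) (logZ _ _ _) (logZ _ _ _) => *.
apply/andP; split; lra.
Qed.

End convexity.

(** * Covariances of the free energy *)

Section moments.
Context d (T : measurableType d) (R : realType) (P : probability T R)
  (xi : nat -> {RV P >-> R}).
Hypothesis hxi : is_poisson_point_process rem_intensity xi.
Implicit Types (b c h : R).

Lemma measurable_logZ b : measurable_fun setT (logZ xi b).
Proof. exact: measurable_ln_Zfine. Qed.

Lemma logZ_sq_moment b c : 1 < b -> rintegrable P (fun w => (logZ xi b w - c) ^+ 2) /\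
  \int[P]_w ((logZ xi b w - c) ^+ 2) = (b ^+ 2 - 1) * trigamma 1 + (mean_ln_Z b - c) ^+ 2.
Proof.
move=> b1; apply: rintegrable_ge0; last exact: expectation_ln_Z_sq.
- by apply: measurable_funX; apply: measurable_funB => //; exact: measurable_logZ.
- by move=> w; exact: sqr_ge0.
Qed.

Lemma logZ_mean b : 1 < b -> rintegrable P (logZ xi b) /\ \int[P]_w logZ xi b w = mean_ln_Z b.
Proof.
move=> b1; have [i0 e0] := logZ_sq_moment 0 b1; have [i1 e1] := logZ_sq_moment 1 b1.
have E w : logZ xi b w = 2^-1 * (((logZ xi b w - 0) ^+ 2 - (logZ xi b w - 1) ^+ 2) + 1).
  by move: (logZ xi b w) => x; field.
have iB := rintegrableB i0 i1; have ic := rintegrable_cst P 1.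
have iD := rintegrableD iB ic.
split; first by rewrite (funext E); exact: rintegrableZ.
under eq_Rintegral do rewrite E.
rewrite Rintegral_Z// Rintegral_D// Rintegral_B// Rintegral_cst1 e0 e1.
by move: (mean_ln_Z b) (trigamma 1) => m v; field.
Qed.

Lemma ratio_moment b h : 1 < b -> 1 < b + h -> h < 1 ->
  rintegrable P (fun w => expR (logZ xi (b + h) w - logZ xi b w)) /\
  \int[P]_w expR (logZ xi (b + h) w - logZ xi b w) = mean_ratio b h.
Proof.
move=> b1 bh h1; apply: rintegrable_ge0; last exact: expectation_ratio.
- apply: measurableT_comp => //; apply: measurable_funB; exact: measurable_logZ.
- by move=> w; exact: expR_ge0.
Qed.

Lemma rintegrable_diff_sq b b' c : 1 < b -> 1 < b' ->
  rintegrable P (fun w => (logZ xi b' w - logZ xi b w - c) ^+ 2).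
Proof.
move=> b1 b1'; have [i0 _] := logZ_sq_moment 0 b1; have [i1 _] := logZ_sq_moment c b1'.
apply: rintegrable_le (rintegrableD (rintegrableZ 2 i1) (rintegrableZ 2 i0)).
  apply: measurable_funX; apply: measurable_funB => //; apply: measurable_funB; exact: measurable_logZ.
move=> w; rewrite ger0_norm ?sqr_ge0//.
move: (logZ xi b' w) (logZ xi b w) => x y.
have := sqr_ge0 (x - c + y); nra.
Qed.

Definition var_diff b b' : R :=
  \int[P]_w ((logZ xi b' w - logZ xi b w - (mean_ln_Z b' - mean_ln_Z b)) ^+ 2).

Lemma var_diffE b b' : 1 < b -> 1 < b' ->
  var_diff b b' = \int[P]_w ((logZ xi b' w - logZ xi b w - 0) ^+ 2) -
                  (mean_ln_Z b' - mean_ln_Z b) ^+ 2.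
Proof.
move=> b1 b1'; rewrite /var_diff; set c := mean_ln_Z b' - _.
have i2 := rintegrable_diff_sq 0 b1 b1'.
have [i1 e1] := logZ_mean b1'; have [i0 e0] := logZ_mean b1.
have iB := rintegrableB i1 i0.
have iC := rintegrableB (rintegrableZ (2 * c) iB) (rintegrable_cst P (c ^+ 2)).
have E w : (logZ xi b' w - logZ xi b w - c) ^+ 2 =
    (logZ xi b' w - logZ xi b w - 0) ^+ 2 - (2 * c * (logZ xi b' w - logZ xi b w) - c ^+ 2).
  by move: (logZ xi b' w) (logZ xi b w) => x y; ring.
under eq_Rintegral do rewrite E.
rewrite Rintegral_B// Rintegral_B//; [|exact: rintegrableZ|exact: rintegrable_cst].
rewrite Rintegral_Z// Rintegral_B// Rintegral_cst1 e1 e0 -/c.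
by clearbody c; clear; move: (\int[P]_w _) => x; ring.
Qed.

(** Polarisation: [2 Cov (X, Y) = Var X + Var Y - Var (Y - X)]. *)
Lemma covariance_logZ b b' : 1 < b -> 1 < b' ->
  fine (covariance P (logZ xi b) (logZ xi b')) =
  ((b ^+ 2 - 1) * trigamma 1 + (b' ^+ 2 - 1) * trigamma 1 - var_diff b b') / 2.
Proof.
move=> b1 b1'; have [_ m0] := logZ_mean b1; have [_ m1] := logZ_mean b1'.
have EE b0 : fine 'E_P[logZ xi b0]%E = \int[P]_w logZ xi b0 w by rewrite unlock.
have -> : covariance P (logZ xi b) (logZ xi b') =
    (\int[P]_w ((logZ xi b w - mean_ln_Z b) * (logZ xi b' w - mean_ln_Z b'))%:E)%E.
  by rewrite unlock !EE m0 m1 unlock.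
rewrite -/(Rintegral P setT (fun w => (logZ xi b w - mean_ln_Z b) * (logZ xi b' w - mean_ln_Z b'))).
have [i0 e0] := logZ_sq_moment (mean_ln_Z b) b1.
have [i1 e1] := logZ_sq_moment (mean_ln_Z b') b1'.
have i2 := rintegrable_diff_sq (mean_ln_Z b' - mean_ln_Z b) b1 b1'.
have iD := rintegrableD i0 i1; have iB := rintegrableB iD i2.
have E w : (logZ xi b w - mean_ln_Z b) * (logZ xi b' w - mean_ln_Z b') =
  2^-1 * (((logZ xi b w - mean_ln_Z b) ^+ 2 + (logZ xi b' w - mean_ln_Z b') ^+ 2) -
    (logZ xi b' w - logZ xi b w - (mean_ln_Z b' - mean_ln_Z b)) ^+ 2).
  by move: (logZ xi b' w) (logZ xi b w) (mean_ln_Z b) (mean_ln_Z b') => x y u v; field.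
under eq_Rintegral do rewrite E.
rewrite Rintegral_Z// Rintegral_B// Rintegral_D// e0 e1 -/(var_diff b b').
rewrite !subrr expr0n/= !addr0; exact: mulrC.
Qed.

Lemma sigma_logZ b : 1 < b -> sigma P (logZ xi b) = Num.sqrt ((b ^+ 2 - 1) * trigamma 1).
Proof.
move=> b1; rewrite /sigma /variance covariance_logZ//.
have -> : var_diff b b = 0.
  rewrite /var_diff; under eq_Rintegral do rewrite !subrr expr0n/=.
  exact: Rintegral_cst1.
by congr Num.sqrt; move: (trigamma 1) => v; field.
Qed.

(** This is [E u^2 = 2 (E e^u - 1 - E u) + O(h^3)] for [u = log R_h]: by convexity
[u] is squeezed between multiples of its values at a fixed distance [e], whose
exponentials are integrable. *)
Lemma var_diff_approx b : 1 < b -> exists K h0, [/\ 0 < h0, 0 <= K & forall h, `|h| <= h0 ->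
  `|var_diff b (b + h) - (2 * (mean_ratio b h - 1 - (mean_ln_Z (b + h) - mean_ln_Z b)) -
    (mean_ln_Z (b + h) - mean_ln_Z b) ^+ 2)| <= K * `|h| ^+ 3].
Proof.
move=> b1; have half1 : 1 / 2 <= 1 :> R by lra.
(* Both b - e > 1 and e < 1 hold, so the ratios at distance e have a mean. *)
pose e : R := Num.min 1 (b - 1) / 2.
have b10 : 0 < b - 1 by lra.
have e0 : 0 < e by rewrite divr_gt0// lt_min ltr01.
have e1 : 2 * e <= 1 by rewrite /e mulrC divfK// ge_min lexx.
have eb : 2 * e <= b - 1 by rewrite /e mulrC divfK// ge_min lexx orbT.
clearbody e.
pose M := mean_ratio b e + mean_ratio b (- e).
have [ip ep] := @ratio_moment b e b1 ltac:(lra) ltac:(lra).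
have [im em] := @ratio_moment b (- e) b1 ltac:(lra) ltac:(lra).
have M0 : 0 <= M.
  by rewrite addr_ge0// -?ep -?em Rintegral_ge0// => w _; exact: expR_ge0.
have [A [A0 rem]] : exists A : R, 0 <= A /\ forall u r U V : R, 0 <= r <= 1 / 2 ->
    - (r * V) <= u <= r * U ->
    `|u ^+ 2 - 2 * (expR u - 1 - u)| <= A * r ^+ 3 * (expR U + expR V).
  exists (2 * 6 ^+ 3); split; last exact: log_ratio_remainder.
  by apply: mulr_ge0 => //; exact: exprn_ge0.
exists (A * e ^- 3 * M), (e / 2); split; first by rewrite divr_gt0.
  by rewrite !mulr_ge0 ?invr_ge0 ?exprn_ge0// ltW.
move=> h he; have hn := ler_norm h; have hn' := ler_norm (- h); rewrite normrN in hn'.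
have bh : 1 < b + h by clear -hn hn' he eb e0; lra.
have h1 : h < 1 by clear -hn hn' he e1 e0; lra.
have [ir er] := ratio_moment b1 bh h1.
pose r : R := `|h| / e.
have r01 : 0 <= r <= 1 / 2.
  by rewrite divr_ge0 ?(ltW e0)//= ler_pdivrMr// div1r mulrC.
pose u w : R := logZ xi (b + h) w - logZ xi b w.
pose F w : R := (u w - 0) ^+ 2 - 2 * ((expR (u w) - 1) - u w).
pose G w : R := A * r ^+ 3 * (expR (logZ xi (b + e) w - logZ xi b w) + expR (logZ xi (b - e) w - logZ xi b w)).
have [i1 m1] := logZ_mean bh; have [i0 m0] := logZ_mean b1.
have iu := rintegrableB i1 i0.
have iR1 := rintegrableB ir (rintegrable_cst P 1).
have iR := rintegrableB iR1 iu.
have iR2 := rintegrableZ 2 iR.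
have i2 := rintegrable_diff_sq 0 b1 bh.
have iF : rintegrable P F := rintegrableB i2 iR2.
have iM := rintegrableD ip im.
have iG : rintegrable P G := rintegrableZ _ iM.
have EF : \int[P]_w F w = \int[P]_w ((u w - 0) ^+ 2) - 2 * (mean_ratio b h - 1 - (mean_ln_Z (b + h) - mean_ln_Z b)).
  rewrite Rintegral_B// Rintegral_Z// Rintegral_B// Rintegral_B//; last exact: rintegrable_cst.
  by rewrite er Rintegral_cst1 Rintegral_B// m1 m0.
have EG : \int[P]_w G w = A * r ^+ 3 * M.
  have EM := etrans (Rintegral_D ip im) (congr2 +%R ep em).
  exact: etrans (Rintegral_Z (A * r ^+ 3) iM) (congr1 ( *%R (A * r ^+ 3)) EM).
have G0 w : 0 <= G w.
  case/andP: r01 => r0 _; apply: mulr_ge0; last by apply: addr_ge0; exact: expR_ge0.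
  by apply: mulr_ge0 => //; exact: exprn_ge0.
have FG : {ae P, forall w, `|F w| <= G w}.
  have bp : 1 < b + e by clear -b1 e0; lra.
  have bm : 1 < b - e by clear -eb e0; lra.
  apply: filterS2 (filterI (Z_fin_ae hxi b1) (Z_fin_ae hxi bh)) (filterI (Z_fin_ae hxi bp) (Z_fin_ae hxi bm)).
  move=> w [zb zh] [zp zm]; rewrite /F subr0.
  have r1 : 0 <= r <= 1 by case/andP: r01 => -> /le_trans; apply; exact: half1.
  have [h_ge0|h_lt0] := leP 0 h.
    have rE : r * e = h by rewrite /r divfK ?gt_eqF// ger0_norm.
    have zr : (Z xi (b + r * e) w < +oo)%E by rewrite rE.
    have := logZ_slope r1 zb zp zm zr; rewrite rE.
    by move/(rem _ _ _ _ r01).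
  have rE : r * - e = h by rewrite mulrN /r divfK ?gt_eqF// ltr0_norm// opprK.
  have zm' : (Z xi (b - - e) w < +oo)%E by rewrite opprK.
  have zr : (Z xi (b + r * - e) w < +oo)%E by rewrite rE.
  have := logZ_slope r1 zb zm zm' zr; rewrite rE opprK.
  move/(rem _ _ _ _ r01) => H; apply: (le_trans H).
  rewrite le_eqVlt; apply/orP; left; apply/eqP.
  exact: (congr1 ( *%R (A * r ^+ 3)) (addrC _ _)).
have := le_normr_Rintegral_ae iF iG G0 FG; rewrite EF EG var_diffE// -/(u _).
rewrite -/r.
have -> : A * r ^+ 3 * M = A * e ^- 3 * M * `|h| ^+ 3 by rewrite /r exprMn exprVn; clear; ring.
move=> H; apply: le_trans H; rewrite le_eqVlt; apply/orP; left; apply/eqP.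
by congr `|_|; clear; move: (\int[P]_w _) => x; ring.
Qed.

End moments.

(** * The susceptibility *)

Section susceptibility.
Context d (T : measurableType d) (R : realType) (P : probability T R)
  (xi : nat -> {RV P >-> R}).
Hypothesis hxi : is_poisson_point_process rem_intensity xi.
Implicit Types (b c h k : R).

Lemma cvg_var_diff b : 1 < b -> var_diff xi b (b + h) / h ^+ 2 @[h --> (0:R)^'] -->
  trigamma 1 + (b - 1) / b ^+ 3 * trigamma ((b - 1) / b).
Proof.
move=> b1; have [K [h0 [h00 K0 hK]]] := var_diff_approx hxi b1.
have := variance_rate b1; set F := (fun h : R => _ / h ^+ 2) => cF.
have -> : (fun h => var_diff xi b (b + h) / h ^+ 2) =
    (fun h => F h + (var_diff xi b (b + h) / h ^+ 2 - F h)).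
  by apply/funext => h; rewrite [RHS]addrC subrK.
rewrite -[X in _ --> X]addr0; apply: cvgD => //.
apply: norm_cvg0.
have c0 : K * `|h| @[h --> (0:R)^'] --> (0:R).
  have cn : `|h| @[h --> (0:R)^'] --> `|0 : R| by apply: cvg_norm; exact: nbhs_dnbhs.
  have cM : K * `|h| @[h --> (0:R)^'] --> K * `|0 : R| by apply: cvgM => //; exact: cvg_cst.
  by move: cM; rewrite normr0 mulr0.
apply: (@squeeze_cvgr _ _ _ _ (fun=> 0) (fun h => K * `|h|)) => //; last exact: cvg_cst.
near=> h.
have hN : h != 0 by near: h; exact: nbhs_dnbhs_neq.
have hlt : `|h| <= h0 by apply: ltW; near: h; apply: dnbhs0_lt.
rewrite normr_ge0/= /F -mulrBl normrM normfV normrX ler_pdivrMr ?exprn_gt0 ?normr_gt0//.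
by rewrite -mulrA -exprS; exact: hK.
Unshelve. all: by end_near. Qed.

(** With [s c] the standard deviation of [logZ c], the quotient is
[(var_diff / h^2 - ((s (b + h) - s b) / h)^2) / (2 s(b) s(b + h))]. *)
Lemma correlation_expansion b : 1 < b ->
  (1 - C xi b (b + h)) / h ^+ 2 @[h --> (0:R)^'] --> kappa_formula b.
Proof.
move=> b1; have V0 := @trigamma1_gt0 R; set V := trigamma (1:R) in V0.
pose x c := (c ^+ 2 - 1) * V; pose s c := Num.sqrt (x c).
have x0 c : 1 < c -> 0 < x c by move=> c1; rewrite mulr_gt0// subr_gt0 expr2; nra.
have s0 c : 1 < c -> 0 < s c by move=> /x0; rewrite sqrtr_gt0.
have s2 c : 1 < c -> s c ^+ 2 = x c by move=> /x0/ltW; exact: sqr_sqrtr.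
have ds : is_derive b (1:R) s (b * V / s b).
  have dx := is_deriveM_fun (is_deriveB_fun (is_deriveM_fun (is_derive_id b 1) (is_derive_id b 1))
    (is_derive_cst (1:R) b 1)) (is_derive_cst V b 1).
  have := @is_derive_comp_fun _ Num.sqrt x b _ _ (is_derive1_sqrt (x0 b b1)) dx.
  move=> /is_derive_eq; apply; rewrite -/(s b) /cst; field.
  by rewrite gt_eqF// s0.
have c1 : (s (b + h) - s b) / h @[h --> (0:R)^'] --> b * V / s b by exact: is_derive_quotient.
have c2 : s (b + h) @[h --> (0:R)^'] --> s b.
  have cb : b + h @[h --> (0:R)^'] --> b.
    by rewrite -[X in _ --> X]addr0; apply: cvgD; [exact: cvg_cst|exact: nbhs_dnbhs].
  exact: (cvg_comp _ _ cb (is_derive_continuous ds)).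
have cD := cvg_var_diff b1.
set v := (X in _ --> X) in cD; rewrite -/V in v cD.
have b21 : b ^+ 2 - 1 != 0 by rewrite gt_eqF// subr_gt0 expr2; nra.
have VN : V != 0 by rewrite gt_eqF.
have E : kappa_formula b = (v - (b * V / s b) ^+ 2) / (2 * s b * s b).
  have -> : (b * V / s b) ^+ 2 = b ^+ 2 * V / (b ^+ 2 - 1).
    by rewrite exprMn exprVn s2// /x; field; rewrite b21 VN.
  have -> : 2 * s b * s b = 2 * x b by rewrite -s2// expr2 mulrA.
  rewrite /x /v /kappa_formula.
  have -> : pi ^+ 2 = 6 * V :> R by rewrite /V trigamma1; field.
  have bN : b != 0 by rewrite gt_eqF//; lra.
  have bN1 : b + 1 != 0 by rewrite gt_eqF//; lra.
  have bN2 : b - 1 != 0 by rewrite gt_eqF//; lra.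
  move: VN; generalize V (trigamma ((b - 1) / b)) => W t WN.
  by field; rewrite ?WN ?bN ?b21 ?bN1 ?bN2.
rewrite E.
have : (var_diff xi b (b + h) / h ^+ 2 - ((s (b + h) - s b) / h) ^+ 2) / (2 * s b * s (b + h))
    @[h --> (0:R)^'] --> (v - (b * V / s b) ^+ 2) / (2 * s b * s b).
  apply: cvgM.
    apply: cvgB => //; exact: (cvg_comp _ _ c1 (@exprn_continuous R 2 _)).
  apply: cvgV; first by rewrite gt_eqF// !mulr_gt0 ?s0.
  by apply: cvgM => //; exact: cvg_cst.
apply: cvg_trans; apply: near_eq_cvg; near=> h.
have hN : h != 0 by near: h; exact: nbhs_dnbhs_neq.
have hb : `|h| < b - 1 by near: h; apply: dnbhs0_lt; rewrite subr_gt0.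
have bh : 1 < b + h by move: hb; rewrite ltr_norml => /andP[+ _]; lra.
rewrite /C !sigma_logZ// covariance_logZ// -/V -/(x b) -/(x (b + h)) -/(s b) -/(s (b + h)).
rewrite -!s2//; move: (s0 _ b1) (s0 _ bh) => /lt0r_neq0 p /lt0r_neq0 q.
move: (var_diff _ _ _) (s b) (s (b + h)) p q => D S S' p q.
by field; rewrite hN p q.
Unshelve. all: by end_near. Qed.

Lemma is_susceptibility_cvg b k : (1 - C xi b (b + h)) / h ^+ 2 @[h --> (0:R)^'] --> k ->
  is_susceptibility xi b k.
Proof.
move=> /cvgrPdist_le ck; apply/eqoP => e e0; have := ck e e0.
apply: filterS2 (@nbhs_dnbhs_neq R 0) => h hN.
have -> : k - (1 - C xi b (b + h)) / h ^+ 2 = (C xi b (b + h) - (1 - k * h ^+ 2)) / h ^+ 2.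
  by field.
by rewrite normrM normfV ler_pdivrMr ?normr_gt0 ?expf_neq0.
Qed.

Lemma susceptibility_unique b k k' : is_susceptibility xi b k -> is_susceptibility xi b k' -> k = k'.
Proof.
move=> /eqoP hk /eqoP hk'; apply/eqP; rewrite -subr_eq0 -normr_le0; apply/ler_addgt0Pr => e e0.
rewrite add0r; have e2 : 0 < e / 2 by rewrite divr_gt0.
have : \forall h \near (0:R)^', `|k - k'| <= e.
  apply: filterS3 (@nbhs_dnbhs_neq R 0) (hk _ e2) (hk' _ e2) => h hN h1 h2.
  have h20 : 0 < `|h ^+ 2| by rewrite normr_gt0 expf_neq0.
  rewrite -(ler_pM2r h20) -normrM.
  have -> : (k - k') * h ^+ 2 = (C xi b (b + h) - (1 - k * h ^+ 2)) - (C xi b (b + h) - (1 - k' * h ^+ 2)) by ring.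
  apply: le_trans (ler_normB _ _) _; apply: le_trans (lerD h1 h2) _.
  by rewrite -mulrDl -splitr.
by move=> /filter_ex[].
Qed.

Lemma kappaE b : 1 < b -> is_susceptibility xi b (kappa xi b) /\ kappa xi b = kappa_formula b.
Proof.
move=> b1; have h := is_susceptibility_cvg (correlation_expansion b1).
have hk : is_susceptibility xi b (kappa xi b) by apply: (@xgetPex _ 0 [set k | is_susceptibility xi b k]); exists (kappa_formula b).
by split => //; exact: susceptibility_unique hk h.
Qed.

End susceptibility.
Theorem theorem1p5 (R : realType) (d : measure_display) (T : measurableType d)
    (P : probability T R) (xi : nat -> {RV P >-> R})
    (hxi : is_poisson_point_process rem_intensity xi) :
  [/\ forall b : R, 1 < b ->
        is_susceptibility xi b (kappa xi b) /\
        kappa xi b =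
          2^-1 * (1 / (b ^+ 2 - 1)
            + 6 / (pi ^+ 2 * b ^+ 3 * (b + 1)) *
              (derive1n 2 Gamma ((b - 1) / b) / Gamma ((b - 1) / b)
               - (derive1 Gamma ((b - 1) / b) / Gamma ((b - 1) / b)) ^+ 2)
            - b ^+ 2 / (b ^+ 2 - 1) ^+ 2),
      kappa xi b / ((3 / (2 * pi ^+ 2) - 1 / 8) * (1 / (b - 1) ^+ 2))
        @[b --> 1^'+] --> (1 : R)
    & kappa xi b / ((6 / pi ^+ 2 * zeta 3 - 1 / 2) * (1 / b ^+ 5))
        @[b --> +oo] --> (1 : R)].
Proof.
split.
- move=> b b1; have [hk E] := kappaE hxi b1; split => //; rewrite E.
  have x0 := frac_gt0 b1; have G0 := Gm0_gt0 x0.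
  rewrite Gamma_derive2// Gamma_derive// Gamma_Gm// /kappa_formula /trigamma.
  congr (_ * (_ + _ * _ - _)).
  by field; rewrite gt_eqF.
- apply: cvg_trans (@kappa_formula_at1 R); apply: near_eq_cvg; near=> b.
  have b1 : 1 < b by near: b; exact: nbhs_right_gt.
  by have [_ ->] := kappaE hxi b1.
- apply: cvg_trans (@kappa_formula_aty R); apply: near_eq_cvg; near=> b.
  have b1 : 1 < b by near: b; apply: nbhs_pinfty_gt; exact: num_real.
  by have [_ ->] := kappaE hxi b1.
Unshelve. all: by end_near. Qed.
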